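(* Let $c\ge 5$. Then the probability $E_2(0,c)$ is bounded above by $$E_2(0,c)\ \le\ e^{-\alpha c^2},\qquad \alpha\approx 0.374.$$
   Context: For $s>0$, $\mathcal{Q}_s$ is the operator on $L^2([-1,1])$ defined by $\mathcal{Q}_s f(x)=\int_{-1}^1\frac{\sin s(y-x)}{\pi(y-x)}f(y)\,dy$ (the kernel being $s/\pi$ at $y=x$). It is self-adjoint, positive and compact; its eigenvalues are simple and are listed in decreasing order $\lambda_0(s)>\lambda_1(s)>\cdots>\lambda_n(s)>\cdots$, $n\ge 0$. For $c>0$, $E_2(0,c)$ denotes the Fredholm determinant $$E_2(0,c)=\det\left(\mathrm{Id}-\mathcal{Q}_{\pi c/2}\right)=\prod_{n=0}^{\infty}\left(1-\lambda_n\left(\tfrac{\pi}{2}c\right)\right).$$ (This is the limit, as the matrix size $n$ tends to infinity, of the probability that $A_n=\sqrt{n}\,M_n$, with $M_n$ an $n\times n$ random matrix from the Gaussian Unitary Ensemble, has no eigenvalue in an interval of length $\pi c$ at the centre of the bulk of the spectrum.) The number $\alpha$ is an absolute constant, independent of $c$, whose approximate value is the one given in the claim; it is $$\alpha=\frac{\pi^2}{4\gamma}-\frac{\pi^2}{8\gamma^2}\log(2e\gamma)-\frac{\pi^2}{16\gamma^2},\qquad \gamma=2.7.$$ *)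

(* Defs.v *)
From HB Require Import structures.
From mathcomp Require Import all_boot all_order all_algebra.
From mathcomp Require Import all_classical all_reals all_analysis.

Set Implicit Arguments.
Unset Strict Implicit.
Unset Printing Implicit Defensive.
Import Order.TTheory GRing.Theory Num.Theory.
Import numFieldNormedType.Exports.
Local Open Scope classical_set_scope.
Local Open Scope ring_scope.

Section SincKernelOperator.
Variable R : realType.

Definition lebesgue_m11 : {measure set (measurableTypeR R) -> \bar R} :=
  mrestr (@lebesgue_measure R) (measurable_itv `[(-1 : R), 1]).

Definition sinc_kernel (s x y : R) : R :=
  if y == x then s / pi else sin (s * (y - x)) / (pi * (y - x)).

Definition sinc_op (s : R) (f : R -> R) (x : R) : R :=
  \int[@lebesgue_measure R]_(y in `[(-1 : R), 1]) (sinc_kernel s x y * f y).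

(* Elements of L^2([-1,1]) are given by representatives defined on R, taken up
   to almost everywhere equality on [-1,1]. Real scalars suffice: the kernel is
   real and the operator is self-adjoint. *)
Definition is_sinc_eigenvalue (s l : R) : Prop :=
  exists f : R -> R,
    [/\ f \in Lfun lebesgue_m11 2%:E,
        ~ (f = cst 0 %[ae lebesgue_m11])
      & sinc_op s f = (fun x => l * f x) %[ae lebesgue_m11] ].

(* The decreasing list of the eigenvalues: each one is the largest eigenvalue
   below all the previous ones. The suprema are attained, because the operator
   is compact and positive, with infinitely many positive eigenvalues; since
   the eigenvalues are simple, listing each of them once agrees with counting
   multiplicities. *)
Fixpoint sinc_eigenvalue (s : R) (n : nat) : R :=
  if n is m.+1 then sup [set l | is_sinc_eigenvalue s l /\ l < sinc_eigenvalue s m]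
  else sup [set l | is_sinc_eigenvalue s l].

(* det(Id - Q_s) as the infinite product over the spectrum. *)
Definition fredholm_det (s : R) : R :=
  limn (fun N : nat => \prod_(n < N) (1 - sinc_eigenvalue s n)).

Definition E2_0 (c : R) : R := fredholm_det (pi / 2 * c).

Definition gamma : R := 27 / 10.

Definition alpha : R :=
  pi ^+ 2 / (4 * gamma)
  - pi ^+ 2 / (8 * gamma ^+ 2) * ln (2 * expR 1 * gamma)
  - pi ^+ 2 / (16 * gamma ^+ 2).

End SincKernelOperator.

Arguments gamma R : clear implicits.
Arguments alpha R : clear implicits.

(* Main.v *)
Require Import Defs.
From HB Require Import structures.
From mathcomp Require Import all_boot all_order all_algebra.
From mathcomp Require Import all_classical all_reals all_analysis.
From mathcomp Require Import measurable_realfun ring lra.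
Import Order.TTheory GRing.Theory Num.Theory.
Import numFieldNormedType.Exports.
Local Open Scope ring_scope.
Set Implicit Arguments.
Unset Strict Implicit.
Unset Printing Implicit Defensive.

(* Let s = pi c / 2. In the eigenspace of Q_s for a positive eigenvalue, consider
   the functions vanishing at both endpoints of [-1, 1]: comparing the operator with d/dx
   and x d/dx shows that this subspace is stable under d/dx, which is bounded on
   it for the sup norm, so that it is zero. Hence positive eigenvalues are simple,
   and the n-th eigenvalue of the statement is at least the n-th one produced by
   successive maximizations of the Rayleigh quotient. By Bessel's inequality all the
   eigenvalues lie in [0, 1], so that for every m the determinant is at most the
   product of its first m factors. By Hadamard's inequality this product is at most
   the product of <f_i, f_i> - <Q_s f_i, f_i> divided by the Gram determinant, for
   any f_1, ..., f_m. The f_i are even step functions of mesh 1/m; their Fourier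
   transforms are sin(a)/a times odd cosine polynomials in a = t/(2m), which are
   taken to be T_{2i+1}(cos a / cos b) with b = s/(2m): small for a in [b, pi/2],
   and with leading coefficients cos(b)^-(2i+1). The bound obtained is
   cos(b)^(2m^2) (1 + O(1/m^3))^m, which tends to exp(-s^2/4) = exp(-pi^2 c^2/16),
   and pi^2/16 > 0.375 > alpha. *)

(** The statement lists each eigenvalue once, as a supremum of what lies strictly below the previous
    one: a multiple eigenvalue would make the product lose small factors and ruin an upper bound.
    Hence the need for simplicity; beyond it, a lower bound on each listed eigenvalue is enough. The
    form <f, f> - <Q f, f> is the energy of the transform of f outside [-s, s]. For step functions
    of mesh 1/m, it is up to small errors the integral of the square of an odd cosine polynomial
    over b <= a <= pi/2. The power cos(b)^(2m^2) reflects a capacity: cos b is the logarithmic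
    capacity of the arc of the points e^(2ia) with b <= a <= pi - b, and T_{2i+1}(z / cos b) are the
    odd Chebyshev polynomials of [-cos b, cos b]. The substitution cos F(x) = cos b cos x turns
    T_{2i+1}(cos a / cos b) into cos((2i+1) x) with Jacobian at most 1. Each diagonal entry is then
    at most about 2/m, and the same factor occurs m times in the Gram determinant and cancels. The
    relative errors, of order b^3 exp(6s) per entry, disappear as m grows with s fixed, so no
    asymptotics in s are involved. *)

Section Calculus.
Local Open Scope classical_set_scope.
Variable R : realType.
Implicit Types (f g df dg : R -> R).

Definition has_deriv f df := forall x : R, is_derive x 1 f (df x).

Lemma has_derivD f g df dg : has_deriv f df -> has_deriv g dg ->
  has_deriv (fun x => f x + g x) (fun x => df x + dg x).
Proof. by move=> hf hg x; exact: (is_deriveD (hf x) (hg x)). Qed.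

Lemma has_derivN f df : has_deriv f df ->
  has_deriv (fun x => - f x) (fun x => - df x).
Proof. by move=> hf x; exact: (is_deriveN (hf x)). Qed.

Lemma has_derivB f g df dg : has_deriv f df -> has_deriv g dg ->
  has_deriv (fun x => f x - g x) (fun x => df x - dg x).
Proof. by move=> hf hg x; exact: (is_deriveB (hf x) (hg x)). Qed.

Lemma has_derivM f g df dg : has_deriv f df -> has_deriv g dg ->
  has_deriv (fun x => f x * g x) (fun x => df x * g x + f x * dg x).
Proof.
move=> hf hg x; apply: (is_derive_eq (is_deriveM (hf x) (hg x))).
by rewrite /GRing.scale/=; ring.
Qed.

Lemma has_deriv_cst (c : R) : has_deriv (fun=> c) (fun=> 0).
Proof. by move=> x; exact: is_derive_cst. Qed.

Lemma has_derivZ (c : R) f df : has_deriv f df ->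
  has_deriv (fun x => c * f x) (fun x => c * df x).
Proof. by move=> hf x; exact: (is_deriveZ c (hf x)). Qed.

Lemma has_deriv_id : has_deriv id (fun=> 1).
Proof. by move=> x; exact: is_derive_id. Qed.

Lemma has_deriv_comp f g df dg : has_deriv f df -> has_deriv g dg ->
  has_deriv (fun x => f (g x)) (fun x => dg x * df (g x)).
Proof.
move=> hf hg x; apply: (is_derive_eq (is_derive1_comp (hf (g x)) (hg x))).
by rewrite /GRing.scale/= mulrC.
Qed.

Lemma has_deriv_cos (t : R) : has_deriv (fun x => cos (t * x)) (fun x => - (t * sin (t * x))).
Proof.
move=> x; have := has_deriv_comp (@is_derive_cos R) (has_derivZ t has_deriv_id) x.
by rewrite mulr1 mulrN.
Qed.

Lemma has_deriv_sin (t : R) : has_deriv (fun x => sin (t * x)) (fun x => t * cos (t * x)).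
Proof.
move=> x; have := has_deriv_comp (@is_derive_sin R) (has_derivZ t has_deriv_id) x.
by rewrite mulr1.
Qed.

Lemma has_deriv_continuous f df : has_deriv f df -> continuous f.
Proof.
move=> hf x; apply: differentiable_continuous; apply/derivable1_diffP.
by have [] := hf x.
Qed.

Lemma has_deriv_within f df (A : set R) : has_deriv f df -> {within A, continuous f}.
Proof. by move=> hf; apply: continuous_subspaceT; exact: has_deriv_continuous hf. Qed.

Lemma has_deriv_mvt f df (a b : R) : has_deriv f df -> a <= b ->
  exists2 c, a <= c <= b & f b - f a = df c * (b - a).
Proof.
move=> hf ab.
have [c cab ->] := MVT_segment ab (fun x _ => hf x) (has_deriv_within hf).
by exists c => //; move: cab; rewrite in_itv.
Qed.

Lemma has_deriv_le f g df dg (a b : R) : has_deriv f df -> has_deriv g dg ->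
  a <= b -> (forall x, a <= x <= b -> df x <= dg x) -> f b - f a <= g b - g a.
Proof.
move=> hf hg ab dfg.
have [c cab E] := has_deriv_mvt (has_derivB hg hf) ab.
have : 0 <= (dg c - df c) * (b - a) by rewrite mulr_ge0 ?subr_ge0// dfg.
by rewrite -E; lra.
Qed.

Lemma sin_lip_bound (x : R) : `|sin x| <= `|x|.
Proof.
have key (y : R) : 0 <= y -> `|sin y| <= y.
  move=> y0; have [c _] := has_deriv_mvt (@is_derive_sin R) y0.
  rewrite sin0 !subr0 => ->; rewrite normrM (ger0_norm y0).
  by rewrite ler_piMl// ler_norml cos_geN1 cos_le1.
have [x0|x0] := leP 0 x; first by rewrite (ger0_norm x0) key.
by rewrite (ltr0_norm x0) -normrN -sinN key// oppr_ge0 ltW.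
Qed.

End Calculus.

(* Locked, lest [done] unfolds it in every side condition. *)
HB.lock Definition locally_bounded_measurable (R : realType) (f : R -> R) : Prop :=
  measurable_fun setT f /\
  forall r : R, exists M, forall x, `|x| <= r -> `|f x| <= M.

HB.lock Definition itg (R : realType) (a b : R) (f : R -> R) : R :=
  \int[@lebesgue_measure R]_(x in `[a, b]) f x.

(** * Integration of locally bounded measurable functions over segments *)

Section Integral.
Local Open Scope classical_set_scope.
Variable R : realType.
Local Notation mu := (@lebesgue_measure R).
Implicit Types (f g : R -> R) (a b c d M : R).

Local Notation itg := (@itg R).

Lemma itgE a b f : itg a b f = \int[mu]_(x in `[a, b]) f x.
Proof. by rewrite itg.unlock. Qed.

Local Notation lbm := (@locally_bounded_measurable R).

Lemma lbmP f : lbm f <-> (measurable_fun setT f /\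
  forall r : R, exists M, forall x, `|x| <= r -> `|f x| <= M).
Proof. by rewrite locally_bounded_measurable.unlock. Qed.

Lemma lbm_measurable f : lbm f -> measurable_fun setT f.
Proof. by move=> /lbmP[]. Qed.

Lemma lbm_continuous f : continuous f -> lbm f.
Proof.
move=> cf; apply/lbmP; split; first exact: continuous_measurable_fun.
move=> r; have cs : compact (f @` `[-r, r]).
  by apply: continuous_compact; [exact: continuous_subspaceT|exact: segment_compact].
have [M [_ HM]] := compact_bounded cs.
exists (M + 1) => x xr; apply: HM; first by rewrite ltrDl.
by exists x => //=; rewrite in_itv/= -ler_norml.
Qed.

Lemma lbm_deriv f df : has_deriv f df -> lbm f.
Proof. by move=> /has_deriv_continuous; exact: lbm_continuous. Qed.

Lemma lbm_cst (k : R) : lbm (fun=> k).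
Proof. exact: lbm_deriv (has_deriv_cst k). Qed.

Lemma lbm_id : lbm id.
Proof. exact: lbm_deriv (@has_deriv_id R). Qed.

Lemma lbm_cos (t : R) : lbm (fun x => cos (t * x)).
Proof. exact: lbm_deriv (has_deriv_cos t). Qed.

Lemma lbm_sin (t : R) : lbm (fun x => sin (t * x)).
Proof. exact: lbm_deriv (has_deriv_sin t). Qed.

Lemma lbmD f g : lbm f -> lbm g -> lbm (fun x => f x + g x).
Proof.
move=> /lbmP[mf bf] /lbmP[mg bg]; apply/lbmP; split; first exact: measurable_funD.
move=> r; have [M HM] := bf r; have [N HN] := bg r; exists (M + N) => x xr.
by rewrite (le_trans (ler_normD _ _))// lerD ?HM ?HN.
Qed.

Lemma lbmM f g : lbm f -> lbm g -> lbm (fun x => f x * g x).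
Proof.
move=> /lbmP[mf bf] /lbmP[mg bg]; apply/lbmP; split; first exact: measurable_funM.
move=> r; have [M HM] := bf r; have [N HN] := bg r; exists (M * N) => x xr.
by rewrite normrM ler_pM ?HM ?HN.
Qed.

Lemma lbmZ (k : R) f : lbm f -> lbm (fun x => k * f x).
Proof. by move=> hf; exact: lbmM (lbm_cst k) hf. Qed.

Lemma lbmN f : lbm f -> lbm (fun x => - f x).
Proof. by move=> /(lbmZ (-1)); under eq_fun do rewrite mulN1r. Qed.

Lemma lbmB f g : lbm f -> lbm g -> lbm (fun x => f x - g x).
Proof. by move=> hf /lbmN; exact: lbmD. Qed.

Lemma lbm_mul_cos (t : R) f : lbm f -> lbm (fun x => f x * cos (t * x)).
Proof. by move=> hf; exact: lbmM hf (lbm_cos t). Qed.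

Lemma lbm_mul_sin (t : R) f : lbm f -> lbm (fun x => f x * sin (t * x)).
Proof. by move=> hf; exact: lbmM hf (lbm_sin t). Qed.

Lemma lbmZr (k : R) f : lbm f -> lbm (fun x => f x * k).
Proof. by move=> hf; exact: lbmM hf (lbm_cst k). Qed.

Lemma lbm_sum (n : nat) (F : nat -> R -> R) :
  (forall i, (i < n)%N -> lbm (F i)) -> lbm (fun x => \sum_(i < n) F i x).
Proof.
elim: n => [_|n IH hF].
  by under eq_fun do rewrite big_ord0; exact: lbm_cst.
under eq_fun do rewrite big_ord_recr /=.
by apply: lbmD; [apply: IH => i /ltnW; exact: hF|exact: hF].
Qed.

Lemma lbm_indic (A : set R) : measurable A -> lbm (\1_A : R -> R).
Proof.
move=> mA; apply/lbmP; split; first exact: measurable_indic.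
by move=> r; exists 1 => x _; rewrite indicE; case: (_ \in _); rewrite ?normr1 ?normr0.
Qed.

Lemma lbm_integrable a b f : lbm f -> mu.-integrable `[a, b] (EFin \o f).
Proof.
move=> /lbmP[mf bf]; apply: measurable_bounded_integrable => //.
- by rewrite [ltLHS]lebesgue_measure_itv/=; case: ifP => // _; rewrite -EFinB ltry.
- exact: measurable_funTS.
have [M HM] := bf (`|a| + `|b|); exists M; split; first exact: num_real.
move=> N MN x /=; rewrite in_itv/= => /andP[ax xb]; apply: le_trans (ltW MN).
apply: HM; have [x0|x0] := leP 0 x.
  rewrite ger0_norm// (le_trans xb)// (le_trans (ler_norm _))// lerDr//.
rewrite ltr0_norm// (@le_trans _ _ (- a)) ?lerN2//.
by rewrite (le_trans (ler_norm _))// normrN lerDl.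
Qed.

Lemma eq_itg a b f g : (forall x, a <= x <= b -> f x = g x) -> itg a b f = itg a b g.
Proof. by move=> fg; rewrite !itgE; apply: eq_Rintegral => x; rewrite inE/= in_itv/=; exact: fg. Qed.

Lemma itgD a b f g : lbm f -> lbm g ->
  itg a b (fun x => f x + g x) = itg a b f + itg a b g.
Proof. by move=> hf hg; rewrite !itgE; apply: RintegralD => //; exact: lbm_integrable. Qed.

Lemma itgZ a b (k : R) f : lbm f -> itg a b (fun x => k * f x) = k * itg a b f.
Proof. by move=> hf; rewrite !itgE; apply: RintegralZl => //; exact: lbm_integrable. Qed.

Lemma itgZr a b (k : R) f : lbm f -> itg a b (fun x => f x * k) = itg a b f * k.
Proof. by move=> hf; rewrite !itgE; apply: RintegralZr => //; exact: lbm_integrable. Qed.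

Lemma itgN a b f : lbm f -> itg a b (fun x => - f x) = - itg a b f.
Proof. by move=> hf; rewrite -mulN1r -itgZ//; apply: eq_itg => x _; rewrite mulN1r. Qed.

Lemma itgB a b f g : lbm f -> lbm g ->
  itg a b (fun x => f x - g x) = itg a b f - itg a b g.
Proof. by move=> hf hg; rewrite !itgE; apply: RintegralB => //; exact: lbm_integrable. Qed.

Lemma itg_cst a b (k : R) : a <= b -> itg a b (fun=> k) = k * (b - a).
Proof.
move=> ab; rewrite !itgE Rintegral_cst//= lebesgue_measure_itv/= lte_fin.
by case: ltgtP ab => // -> _; rewrite subrr.
Qed.

Lemma itg_sum a b (n : nat) (F : nat -> R -> R) :
  (forall i, (i < n)%N -> lbm (F i)) ->
  itg a b (fun x => \sum_(i < n) F i x) = \sum_(i < n) itg a b (F i).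
Proof.
elim: n => [_|n IH hF].
  rewrite big_ord0; rewrite !itgE; under eq_Rintegral do rewrite big_ord0.
  by rewrite Rintegral_cst//= mul0r.
rewrite big_ord_recr /= -IH; last by move=> i /ltnW; exact: hF.
rewrite -itgD; [|by apply: lbm_sum => i /ltnW; exact: hF|exact: hF].
by apply: eq_itg => x _; rewrite big_ord_recr.
Qed.

Lemma le_itg a b f g : lbm f -> lbm g -> (forall x, a <= x <= b -> f x <= g x) ->
  itg a b f <= itg a b g.
Proof.
move=> hf hg fg; by rewrite !itgE; apply: le_Rintegral => //; exact: lbm_integrable.
Qed.

Lemma itg_ge0 a b f : (forall x, a <= x <= b -> 0 <= f x) -> 0 <= itg a b f.
Proof. by move=> f0; rewrite !itgE; apply: Rintegral_ge0 => x /=; rewrite in_itv/=; exact: f0. Qed.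

Lemma itg_norm_le a b f M : a <= b -> lbm f ->
  (forall x, a <= x <= b -> `|f x| <= M) -> `|itg a b f| <= M * (b - a).
Proof.
move=> ab hf fM; rewrite -itg_cst// ler_norml -itgN; last exact: lbm_cst.
apply/andP; split; apply: le_itg => //; try exact: lbm_cst.
- by move=> x /fM; rewrite ler_norml => /andP[].
- by move=> x /fM; rewrite ler_norml => /andP[].
Qed.

Lemma itg_split a b c f : lbm f -> a <= b -> b <= c ->
  itg a c f = itg a b f + itg b c f.
Proof.
move=> hf ab bc; apply/eqP; rewrite addrC -subr_eq; apply/eqP.
rewrite !itgE Rintegral_itvB ?bnd_simp//; last exact: lbm_integrable.
rewrite Rintegral_itv_obnd_cbnd//.
by apply: integrableS (lbm_integrable b c hf) => //; apply: subset_itvr; rewrite bnd_simp.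
Qed.

Lemma itg_point a f : itg a a f = 0.
Proof. by rewrite !itgE set_itv1 Rintegral_set1. Qed.

Lemma itg_ftc a b f df : has_deriv f df -> continuous df -> a <= b ->
  itg a b df = f b - f a.
Proof.
move=> hf cf; rewrite le_eqVlt => /predU1P[->|ab].
  by rewrite itg_point subrr.
rewrite !itgE /Rintegral (@continuous_FTC2 _ df f)//.
- exact: continuous_subspaceT.
- split; first by move=> x _; have [] := hf x.
    by apply: cvg_at_right_filter; exact: has_deriv_continuous hf a.
  by apply: cvg_at_left_filter; exact: has_deriv_continuous hf b.
- by move=> x _; rewrite derive1E; have [_ ->] := hf x.
Qed.

Lemma itg_by_parts a b f g df dg : has_deriv f df -> has_deriv g dg ->
  continuous df -> continuous dg -> a <= b ->
  itg a b (fun x => df x * g x) = f b * g b - f a * g a - itg a b (fun x => f x * dg x).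
Proof.
move=> hf hg cf cg ab.
have cF := has_deriv_continuous hf; have cG := has_deriv_continuous hg.
rewrite -(itg_ftc (has_derivM hf hg))//; last first.
  by move=> x; apply: cvgD; apply: cvgM; [exact: cf|exact: cG|exact: cF|exact: cg].
by rewrite itgD ?addrK//; apply: lbmM; exact: lbm_continuous.
Qed.

Lemma itg_substN a b f : continuous f -> a <= b ->
  itg (- b) (- a) f = itg a b (fun x => f (- x)).
Proof.
move=> cf ab; rewrite !itgE /Rintegral integration_by_substitution_oppr//.
exact: continuous_subspaceT.
Qed.

Lemma itg_even (s : R) f : continuous f -> (forall x, f (- x) = f x) -> 0 <= s ->
  itg (- s) s f = 2 * itg 0 s f.
Proof.
move=> cf ef s0; rewrite (@itg_split _ 0)//; [|exact: lbm_continuous|by rewrite oppr_le0].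
rewrite -{1}oppr0 itg_substN//.
by rewrite (@eq_itg 0 s (fun x => f (- x)) f) ?mulr2n ?mulrDl ?mul1r.
Qed.

Lemma itg_shift a b (k : R) f : continuous f -> a <= b ->
  itg (a + k) (b + k) f = itg a b (fun x => f (x + k)).
Proof.
move=> cf ab; rewrite !itgE /Rintegral.
have dk : has_deriv (fun x : R => x + k) (fun=> 1).
  move=> x; have := has_derivD (@has_deriv_id R) (has_deriv_cst k) x.
  by rewrite addr0.
have dE : (fun x : R => x + k)^`() = cst 1.
  by apply/funext => x; rewrite derive1E; have [_ ->] := dk x.
rewrite (@integration_by_substitution_increasing _ (fun x => x + k) f)//.
- by congr fine; apply: eq_integral => x _; rewrite /= dE/= mulr1.
- by move=> x y _ _ xy; rewrite ltrD2r.
- by move=> x _; rewrite dE; exact: cst_continuous.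
- by rewrite dE; apply/cvg_ex; exists 1; exact: cvg_cst.
- by rewrite dE; apply/cvg_ex; exists 1; exact: cvg_cst.
- split; first by move=> x _; have [] := dk x.
    by apply: cvg_at_right_filter; exact: has_deriv_continuous dk a.
  by apply: cvg_at_left_filter; exact: has_deriv_continuous dk b.
- exact: continuous_subspaceT.
Qed.

End Integral.

(** * Fubini, differentiation under the integral sign, cosine and sine transforms *)

Section IntegralTransforms.
Local Open Scope classical_set_scope.
Variable R : realType.
Local Notation mu := (@lebesgue_measure R).
Local Notation lbm := (@locally_bounded_measurable R).
Implicit Types (f g u : R -> R) (a b c d M : R).

(** Boundedness is assumed on the rectangle only, so [h] is extended by zero outside it, and
    Fubini's theorem on the plane is applied to the extension. *)
Lemma itg_fubini a b c d M (h : R * R -> R) : measurable_fun setT h ->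
  (forall x y, a <= x <= b -> c <= y <= d -> `|h (x, y)| <= M) ->
  itg a b (fun x => itg c d (fun y => h (x, y))) =
  itg c d (fun y => itg a b (fun x => h (x, y))).
Proof.
move=> mh hM.
set A := `[a, b]; set B := `[c, d].
have mA : measurable (A : set (measurableTypeR R)) by exact: measurable_itv.
have mB : measurable (B : set (measurableTypeR R)) by exact: measurable_itv.
have AE x : A x -> a <= x <= b by rewrite /A/= in_itv.
have BE y : B y -> c <= y <= d by rewrite /B/= in_itv.
have finI (x y : R) : (mu `[x, y] < +oo)%E.
  by rewrite [ltLHS]lebesgue_measure_itv/=; case: ifP => // _; rewrite -EFinB ltry.
have bdd (D : set R) (g : R -> R) : (forall x, D x -> `|g x| <= M) -> [bounded g x | x in D].
  move=> gM; exists M; split; first exact: num_real.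
  by move=> N MN x /gM /le_trans; apply; exact: ltW.
have int1 x : A x -> mu.-integrable B (EFin \o (fun y => h (x, y))).
  move=> Ax; apply: measurable_bounded_integrable => //; first exact: finI.
    by apply: measurable_funTS; exact: measurable_fun_pair2.
  by apply: bdd => y By; apply: hM; [exact: AE|exact: BE].
have int2 y : B y -> mu.-integrable A (EFin \o (fun x => h (x, y))).
  move=> By; apply: measurable_bounded_integrable => //; first exact: finI.
    by apply: measurable_funTS; exact: measurable_fun_pair1.
  by apply: bdd => x Ax; apply: hM; [exact: AE|exact: BE].
have mAB : measurable (A `*` B) by exact: measurableX.
have intAB : (mu \x mu)%E.-integrable setT (EFin \o (h \_ (A `*` B))).
  rewrite -restrict_EFin; apply/integrable_restrict => //; rewrite setTI.
  apply: measurable_bounded_integrable => //.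
  - rewrite [ltLHS]product_measure1E//.
    apply: lte_mul_pinfty.
    + exact: measure_ge0.
    + by apply: fin_real; apply/andP; split; [exact: lt_le_trans (measure_ge0 _ _)|exact: finI].
    + exact: finI.
  - exact: measurable_funTS.
  - exists M; split; first exact: num_real.
    move=> N MN [x y] [/= Ax By]; apply: le_trans (ltW MN).
    by apply: hM; [exact: AE|exact: BE].
have := Fubini intAB.
have E1 x : (\int[mu]_y (EFin \o (h \_ (A `*` B))) (x, y) =
   ((fun x => (itg c d (fun y => h (x, y)))%:E) \_ A) x)%E.
  rewrite /patch; case: ifPn => [xA|xA].
    rewrite itgE /Rintegral fineK; last first.
      by apply: integrable_fin_num => //; apply: int1; rewrite inE in xA.
    rewrite [RHS]integral_mkcond; apply: eq_integral => y _ /=.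
    rewrite /patch in_setX xA/=; case: ifP => //.
  rewrite (eq_integral (cst 0%E)) ?integral0// => y _ /=.
  by rewrite /patch in_setX (negbTE xA).
have E2 y : (\int[mu]_x (EFin \o (h \_ (A `*` B))) (x, y) =
   ((fun y => (itg a b (fun x => h (x, y)))%:E) \_ B) y)%E.
  rewrite /patch; case: ifPn => [yB|yB].
    rewrite itgE /Rintegral fineK; last first.
      by apply: integrable_fin_num => //; apply: int2; rewrite inE in yB.
    rewrite [RHS]integral_mkcond; apply: eq_integral => x _ /=.
    by rewrite /patch in_setX yB andbT; case: ifP.
  rewrite (eq_integral (cst 0%E)) ?integral0// => x _ /=.
  by rewrite /patch in_setX (negbTE yB) andbF.
under eq_integral do rewrite E1.
under [X in _ = X -> _]eq_integral do rewrite E2.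
by rewrite -!integral_mkcond !itgE /Rintegral => ->.
Qed.

(** The kernels in view are cos(xy) and sin(xy), whose derivatives in x are at most |y| in absolute
    value. The dominating function |u(y) y| does not depend on x, so any neighbourhood of the point
    serves. *)
Lemma has_deriv_itg a b (k dk : R -> R -> R) u : lbm u ->
  (forall y, has_deriv (k ^~ y) (dk ^~ y)) ->
  (forall x, lbm (k x)) -> (forall x y, `|dk x y| <= `|y|) ->
  has_deriv (fun x => itg a b (fun y => u y * k x y))
            (fun x => itg a b (fun y => u y * dk x y)).
Proof.
move=> hu hk mk bk x0.
pose f x y := u y * k x y.
rewrite (_ : (fun x => _) = fun x => \int[mu]_(y in `[a, b]) f x y); last first.
  by apply/funext => x; rewrite itgE.
have dE x y : partial1of2 f x y = u y * dk x y.
  rewrite partial1of2E.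
  by have [_ ->] := has_derivZ (u y) (hk y) x.
have x0I : `]x0 - 1, x0 + 1[ x0 by rewrite /= in_itv/=; apply/andP; split; lra.
pose G y := `|u y * y|.
have intf x : `]x0 - 1, x0 + 1[ x -> mu.-integrable `[a, b] (EFin \o f x).
  by move=> _; apply: lbm_integrable; exact: lbmM.
have derf x y : `]x0 - 1, x0 + 1[ x -> `[a, b] y -> derivable (f ^~ y) x 1.
  by move=> _ _; have [] := has_derivZ (u y) (hk y) x.
have G0 y : 0 <= G y by exact: normr_ge0.
have intG : mu.-integrable `[a, b] (EFin \o G).
  by apply: integrable_norm; apply: lbm_integrable; apply: lbmM => //; exact: lbm_id.
have Gub x y : `]x0 - 1, x0 + 1[ x -> `[a, b] y -> `|partial1of2 f x y| <= G y.
  by move=> _ _; rewrite dE /G !normrM ler_wpM2l.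
have mB : measurable (`[a, b] : set (measurableTypeR R)) by [].
have D1 := derivable_under_integral mB x0I intf derf G0 intG Gub.
have D2 := differentiation_under_integral mB x0I intf derf G0 intG Gub.
apply: DeriveDef => //.
rewrite itgE -derive1E [LHS]D2; apply: eq_Rintegral => y _.
by rewrite -dE.
Qed.

Definition cos_tr a b u x := itg a b (fun y => u y * cos (x * y)).
Definition sin_tr a b u x := itg a b (fun y => u y * sin (x * y)).

Lemma has_deriv_cos_tr a b u : lbm u ->
  has_deriv (cos_tr a b u) (fun x => - sin_tr a b (fun y => y * u y) x).
Proof.
move=> hu; have hidu : lbm (fun y => y * u y) by apply: lbmM => //; exact: lbm_id.
have := @has_deriv_itg a b (fun x y => cos (x * y)) (fun x y => - (y * sin (x * y))) u hu.
move=> H; rewrite (_ : (fun x => - _) = fun x => itg a b (fun y => u y * - (y * sin (x * y)))).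
  apply: H.
  - move=> y x /=; rewrite (mulrC x y).
    rewrite (_ : (fun x => cos (x * y)) = fun x => cos (y * x)); first exact: has_deriv_cos.
    by apply/funext => z; rewrite mulrC.
  - exact: lbm_cos.
  - move=> x y; rewrite normrN normrM ler_piMr// ler_norml.
    by rewrite sin_geN1 sin_le1.
apply/funext => x; rewrite -itgN; last by apply: lbmM => //; exact: lbm_sin.
by apply: eq_itg => y _; ring.
Qed.

Lemma has_deriv_sin_tr a b u : lbm u ->
  has_deriv (sin_tr a b u) (cos_tr a b (fun y => y * u y)).
Proof.
move=> hu; have hidu : lbm (fun y => y * u y) by apply: lbmM => //; exact: lbm_id.
have := @has_deriv_itg a b (fun x y => sin (x * y)) (fun x y => y * cos (x * y)) u hu.
move=> H; rewrite (_ : cos_tr _ _ _ = fun x => itg a b (fun y => u y * (y * cos (x * y)))).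
  apply: H.
  - move=> y x /=; rewrite (mulrC x y).
    rewrite (_ : (fun x => sin (x * y)) = fun x => sin (y * x)); first exact: has_deriv_sin.
    by apply/funext => z; rewrite mulrC.
  - exact: lbm_sin.
  - move=> x y; rewrite normrM ler_piMr// ler_norml.
    by rewrite cos_geN1 cos_le1.
by apply/funext => x; apply: eq_itg => y _; ring.
Qed.

Lemma continuous_cos_tr a b u : lbm u -> continuous (cos_tr a b u).
Proof. by move=> /(has_deriv_cos_tr a b)/has_deriv_continuous. Qed.

Lemma continuous_sin_tr a b u : lbm u -> continuous (sin_tr a b u).
Proof. by move=> /(has_deriv_sin_tr a b)/has_deriv_continuous. Qed.

End IntegralTransforms.

(** * The operator Q and its quadratic form on the Fourier side *)

Section Operator.
Local Open Scope classical_set_scope.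
Variable R : realType.
Local Notation lbm := (@locally_bounded_measurable R).
Implicit Types (f g u : R -> R) (s : R).

(** Real part, and next imaginary part, of the integral of f(y) e^(ity) over [-1, 1]. *)
Definition fcos f := cos_tr (-1) 1 f.
Definition fsin f := sin_tr (-1) 1 f.
Definition ip f g := itg (-1) 1 (fun x => f x * g x).
(** This is <Q f, g> on the Fourier side, where positivity is visible. It comes from sin(s z)/(pi z)
    being 1/pi times the integral of cos(z t) over t in [0, s]; [sinc_fun] is the kernel in that
    form, with no separate value at z = 0. *)
Definition sinc_form s f g := pi^-1 * itg 0 s (fun t => fcos f t * fcos g t + fsin f t * fsin g t).
Definition sinc_fun s := fun x => pi^-1 * cos_tr 0 s (fun=> 1) x.

Lemma ipC f g : ip f g = ip g f.
Proof. by apply: eq_itg => x _; rewrite mulrC. Qed.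

Lemma ipDl f g u : lbm f -> lbm g -> lbm u -> ip (fun x => f x + g x) u = ip f u + ip g u.
Proof.
move=> hf hg hu; rewrite /ip -itgD; [|exact: lbmM..].
by apply: eq_itg => x _; rewrite mulrDl.
Qed.

Lemma ipZl (k : R) f u : lbm f -> lbm u -> ip (fun x => k * f x) u = k * ip f u.
Proof.
move=> hf hu; rewrite /ip -itgZ; last exact: lbmM.
by apply: eq_itg => x _; rewrite mulrA.
Qed.

Lemma ipDr f g u : lbm f -> lbm g -> lbm u -> ip u (fun x => f x + g x) = ip u f + ip u g.
Proof. by move=> hf hg hu; rewrite ipC ipDl// (ipC f) (ipC g). Qed.

Lemma ipZr (k : R) f u : lbm f -> lbm u -> ip u (fun x => k * f x) = k * ip u f.
Proof. by move=> hf hu; rewrite ipC ipZl// (ipC f). Qed.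

Lemma eq_ip f f' g g' : (forall x, -1 <= x <= 1 -> f x = f' x) ->
  (forall x, -1 <= x <= 1 -> g x = g' x) -> ip f g = ip f' g'.
Proof. by move=> h1 h2; apply: eq_itg => x hx; rewrite h1 ?h2. Qed.

Lemma ip0l f : ip (fun=> 0) f = 0.
Proof.
rewrite /ip (@eq_itg _ _ _ _ (fun=> 0)); last by move=> x _; rewrite mul0r.
by rewrite itg_cst ?mul0r//; lra.
Qed.

Lemma ip_ge0 f : 0 <= ip f f.
Proof. by apply: itg_ge0 => x _; rewrite -expr2 sqr_ge0. Qed.

Lemma continuous_sinc_fun s : continuous (sinc_fun s).
Proof.
by apply: has_deriv_continuous; apply: has_derivZ; apply: has_deriv_cos_tr; exact: lbm_cst.
Qed.

Lemma sinc_fun_bound s x : 0 <= s -> `|sinc_fun s x| <= s / pi.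
Proof.
move=> s0; rewrite normrM ger0_norm ?invr_ge0 ?pi_ge0// mulrC ler_wpM2r ?invr_ge0 ?pi_ge0//.
rewrite -[leRHS]mul1r -[X in 1 * X]subr0; apply: itg_norm_le => //.
  by apply: lbmM; [exact: lbm_cst|exact: lbm_cos].
by move=> t _; rewrite mul1r ler_norml cos_geN1 cos_le1.
Qed.

Lemma sinc_fun_lip s x y : 0 <= s -> `|sinc_fun s x - sinc_fun s y| <= s ^+ 2 / pi * `|x - y|.
Proof.
move=> s0.
have hd : has_deriv (sinc_fun s) (fun x => pi^-1 * - sin_tr 0 s (fun y => y * 1) x).
  by apply: has_derivZ; apply: has_deriv_cos_tr; exact: lbm_cst.
wlog xy : x y / y <= x.
  move=> H; have [|/ltW] := leP y x; first exact: H.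
  by rewrite distrC (distrC x); exact: H.
have [c _ ->] := has_deriv_mvt hd xy.
rewrite normrM ler_wpM2r// normrM normrN ger0_norm ?invr_ge0 ?pi_ge0// mulrC.
rewrite ler_wpM2r ?invr_ge0 ?pi_ge0// expr2 -[X in _ * X]subr0.
apply: itg_norm_le => //.
  by apply: lbmM; [apply: lbmM; [exact: lbm_id|exact: lbm_cst]|exact: lbm_sin].
move=> t /andP[t0 ts]; rewrite mulr1 normrM (ger0_norm t0).
by rewrite -[leRHS]mulr1 ler_pM// ler_norml sin_geN1 sin_le1.
Qed.

Lemma sinc_kernelE s x y : 0 <= s -> sinc_kernel s x y = sinc_fun s (y - x).
Proof.
move=> s0; rewrite /sinc_kernel /sinc_fun /cos_tr.
have [->|yx] := eqVneq y x.
  rewrite subrr mulrC; congr (_ * _).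
  rewrite (@eq_itg _ 0 s _ (fun=> 1)); first by rewrite itg_cst// mul1r subr0.
  by move=> t _; rewrite mul0r cos0 mulr1.
have yx0 : y - x != 0 by rewrite subr_eq0.
have hd := has_derivZ (y - x)^-1 (has_deriv_sin (y - x)).
rewrite (@eq_itg _ 0 s _ (fun t => (y - x)^-1 * ((y - x) * cos ((y - x) * t)))); last first.
  by move=> t _; rewrite mulKf// mul1r.
rewrite (itg_ftc hd)//; last first.
  apply: has_deriv_continuous; apply: has_derivZ; apply: has_derivZ; exact: has_deriv_cos.
by rewrite mulr0 sin0 mulr0 subr0 (mulrC _ s) invfM; ring.
Qed.

Lemma sinc_opE s f x : 0 <= s ->
  sinc_op s f x = itg (-1) 1 (fun y => sinc_fun s (y - x) * f y).
Proof. by move=> s0; rewrite itgE; apply: eq_Rintegral => y _; rewrite sinc_kernelE. Qed.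

Lemma lbm_kernel s x : lbm (fun y => sinc_fun s (y - x)).
Proof.
apply: lbm_continuous => y; apply: (@continuous_comp _ _ _ (fun y => y - x)).
  by apply: cvgB; [exact: cvg_id|exact: cvg_cst].
exact: continuous_sinc_fun.
Qed.

Lemma measurable_two_cos f : measurable_fun setT f ->
  measurable_fun setT (fun z : R * R => f z.1 * cos (z.2 * z.1)).
Proof.
move=> mf; apply: measurable_funM; first by apply: measurableT_comp => //; exact: measurable_fst.
apply: measurableT_comp; first by apply: continuous_measurable_fun; exact: continuous_cos.
by apply: measurable_funM; [exact: measurable_snd|exact: measurable_fst].
Qed.

Lemma measurable_two_sin f : measurable_fun setT f ->
  measurable_fun setT (fun z : R * R => f z.1 * sin (z.2 * z.1)).
Proof.
move=> mf; apply: measurable_funM; first by apply: measurableT_comp => //; exact: measurable_fst.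
apply: measurableT_comp; first by apply: continuous_measurable_fun; exact: continuous_sin.
by apply: measurable_funM; [exact: measurable_snd|exact: measurable_fst].
Qed.

Lemma lbm_bound11 f : lbm f -> exists2 M, 0 <= M & forall x, -1 <= x <= 1 -> `|f x| <= M.
Proof.
move=> /lbmP[_ /(_ 1)[M HM]]; exists M; first by apply: le_trans (normr_ge0 (f 0)) (HM 0 _); rewrite normr0.
by move=> x hx; apply: HM; rewrite ler_norml.
Qed.

Lemma sinc_op_fourier s f x : 0 <= s -> lbm f ->
  sinc_op s f x = pi^-1 * itg 0 s (fun t => fcos f t * cos (x * t) + fsin f t * sin (x * t)).
Proof.
move=> s0 hf; rewrite sinc_opE//.
have [M M0 HM] := lbm_bound11 hf.
(* The addition formula separates x from y in cos((y - x) t), so that integrating in y first yields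
   the transforms of [f]. *)
pose h (z : R * R) := f z.1 * cos (z.2 * z.1) * cos (x * z.2) + f z.1 * sin (z.2 * z.1) * sin (x * z.2).
have hE y t : h (y, t) = f y * cos ((y - x) * t).
  by rewrite /h/= mulrBl cosB (mulrC t y); ring.
rewrite (@eq_itg _ _ _ _ (fun y => pi^-1 * itg 0 s (fun t => h (y, t)))); last first.
  move=> y _; rewrite /sinc_fun -mulrA; congr (_ * _).
  rewrite mulrC /cos_tr -itgZ; first by apply: eq_itg => t _; rewrite hE mul1r.
  by apply: lbmM; [exact: lbm_cst|exact: lbm_cos].
have mc : measurable_fun setT (fun z : R * R => cos (x * z.2)).
  apply: (@measurableT_comp _ _ _ _ _ _ (fun t => cos (x * t))); last exact: measurable_snd.
  exact: lbm_measurable (lbm_cos x).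
have ms : measurable_fun setT (fun z : R * R => sin (x * z.2)).
  apply: (@measurableT_comp _ _ _ _ _ _ (fun t => sin (x * t))); last exact: measurable_snd.
  exact: lbm_measurable (lbm_sin x).
have mh : measurable_fun setT h.
  by apply: measurable_funD; apply: measurable_funM => //;
    [exact: measurable_two_cos (lbm_measurable hf)|exact: measurable_two_sin (lbm_measurable hf)].
have hM y t : -1 <= y <= 1 -> 0 <= t <= s -> `|h (y, t)| <= M.
  move=> hy _; rewrite hE normrM -[leRHS]mulr1 ler_pM ?HM//.
  by rewrite ler_norml cos_geN1 cos_le1.
have fub := itg_fubini mh hM.
have E t : itg (-1) 1 (fun y => h (y, t)) = fcos f t * cos (x * t) + fsin f t * sin (x * t).
  rewrite /h /fcos /fsin /cos_tr /sin_tr /= itgD.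
    by rewrite (itgZr _ _ _ (lbm_mul_cos t hf)) (itgZr _ _ _ (lbm_mul_sin t hf)).
  - exact: lbmZr (lbm_mul_cos t hf).
  - exact: lbmZr (lbm_mul_sin t hf).
have lbmE : lbm (fun y => itg 0 s (fun t => h (y, t))).
  rewrite (_ : (fun y => _) = fun y => f y * cos_tr 0 s (fun=> 1) (y - x)).
    apply: lbmM => //; apply: lbm_continuous => y.
    apply: (@continuous_comp _ _ _ (fun y => y - x)).
      by apply: cvgB; [exact: cvg_id|exact: cvg_cst].
    by apply: continuous_cos_tr; exact: lbm_cst.
  apply/funext => y; rewrite /cos_tr -itgZ; first by apply: eq_itg => t _; rewrite hE mul1r.
  by apply: lbmM; [exact: lbm_cst|exact: lbm_cos].
rewrite itgZ// fub; congr (_ * _); apply: eq_itg => t _; exact: E.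
Qed.

Lemma lbm_fcos f : lbm f -> lbm (fcos f).
Proof. by move=> hf; apply: lbm_continuous; exact: continuous_cos_tr. Qed.

Lemma lbm_fsin f : lbm f -> lbm (fsin f).
Proof. by move=> hf; apply: lbm_continuous; exact: continuous_sin_tr. Qed.

Lemma sinc_op_tr s f : 0 <= s -> lbm f ->
  sinc_op s f = fun x => pi^-1 * (cos_tr 0 s (fcos f) x + sin_tr 0 s (fsin f) x).
Proof.
move=> s0 hf; apply/funext => x; rewrite sinc_op_fourier// itgD//.
  by apply: lbmM; [exact: lbm_fcos|exact: lbm_cos].
by apply: lbmM; [exact: lbm_fsin|exact: lbm_sin].
Qed.

(** Although [f] is only measurable, the frequencies are confined to [0, s], which makes its image
    differentiable. Eigenfunctions for nonzero eigenvalues inherit this. *)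
Lemma has_deriv_sinc_op s f : 0 <= s -> lbm f -> has_deriv (sinc_op s f)
  (fun x => pi^-1 * (- sin_tr 0 s (fun t => t * fcos f t) x + cos_tr 0 s (fun t => t * fsin f t) x)).
Proof.
move=> s0 hf; rewrite sinc_op_tr//; apply: has_derivZ; apply: has_derivD.
  by apply: has_deriv_cos_tr; exact: lbm_fcos.
by apply: has_deriv_sin_tr; exact: lbm_fsin.
Qed.

Lemma lbm_sinc_op s f : 0 <= s -> lbm f -> lbm (sinc_op s f).
Proof. by move=> s0 hf; exact: lbm_deriv (has_deriv_sinc_op s0 hf). Qed.

Lemma ip_sinc_op s f g : 0 <= s -> lbm f -> lbm g -> ip (sinc_op s f) g = sinc_form s f g.
Proof.
move=> s0 hf hg; rewrite /sinc_form.
have [M M0 HM] := lbm_bound11 hg.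
have /lbmP[_ /(_ s)[Nc HNc]] := lbm_fcos hf.
have /lbmP[_ /(_ s)[Ns HNs]] := lbm_fsin hf.
pose h (z : R * R) := g z.1 * cos (z.2 * z.1) * fcos f z.2 + g z.1 * sin (z.2 * z.1) * fsin f z.2.
have mc : measurable_fun setT (fun z : R * R => fcos f z.2).
  apply: (@measurableT_comp _ _ _ _ _ _ (fcos f)); last exact: measurable_snd.
  exact: lbm_measurable (lbm_fcos hf).
have ms : measurable_fun setT (fun z : R * R => fsin f z.2).
  apply: (@measurableT_comp _ _ _ _ _ _ (fsin f)); last exact: measurable_snd.
  exact: lbm_measurable (lbm_fsin hf).
have mh : measurable_fun setT h.
  by apply: measurable_funD; apply: measurable_funM => //;
    [exact: measurable_two_cos (lbm_measurable hg)|exact: measurable_two_sin (lbm_measurable hg)].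
have hM y t : -1 <= y <= 1 -> 0 <= t <= s -> `|h (y, t)| <= M * 1 * Nc + M * 1 * Ns.
  move=> hy /andP[t0 ts]; rewrite /h/= (le_trans (ler_normD _ _))// lerD// !normrM ler_pM//.

  - by rewrite ler_pM ?HM// ler_norml cos_geN1 cos_le1.
  - by apply: HNc; rewrite ger0_norm.  - by rewrite ler_pM ?HM// ler_norml sin_geN1 sin_le1.
  - by apply: HNs; rewrite ger0_norm.
have fub := itg_fubini mh hM.
have E t : itg (-1) 1 (fun y => h (y, t)) = fcos f t * fcos g t + fsin f t * fsin g t.
  rewrite /h [fcos g]/fcos [fsin g]/fsin /cos_tr /sin_tr /= itgD.
    rewrite (itgZr _ _ _ (lbm_mul_cos t hg)) (itgZr _ _ _ (lbm_mul_sin t hg)).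
    by rewrite mulrC (mulrC (fsin f t)).
  - exact: lbmZr (lbm_mul_cos t hg).
  - exact: lbmZr (lbm_mul_sin t hg).
have lc x : lbm (fun t => fcos f t * cos (x * t) + fsin f t * sin (x * t)).
  by apply: lbmD; [apply: lbmM; [exact: lbm_fcos|exact: lbm_cos]
                  |apply: lbmM; [exact: lbm_fsin|exact: lbm_sin]].
have E2 x : sinc_op s f x * g x = pi^-1 * itg 0 s (fun t => h (x, t)).
  rewrite sinc_op_fourier// -mulrA; congr (_ * _); rewrite mulrC -itgZ//.
  by apply: eq_itg => t _; rewrite /h/= (mulrC t x); ring.
(* The partial integral inherits its regularity from [sinc_op s f], to which [E2] relates it. *)
have lh : lbm (fun x => itg 0 s (fun t => h (x, t))).
  rewrite (_ : (fun x => _) = fun x => pi * (sinc_op s f x * g x)).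
    by apply: lbmZ; apply: lbmM => //; exact: lbm_sinc_op.
  by apply/funext => x; rewrite E2 mulVKf// gt_eqF// pi_gt0.
rewrite /ip (@eq_itg _ _ _ _ _ (fun x _ => E2 x)) itgZ// fub.
by congr (_ * _); apply: eq_itg => t _; exact: E.
Qed.

Lemma sinc_formC s f g : sinc_form s f g = sinc_form s g f.
Proof. by congr (_ * _); apply: eq_itg => t _; rewrite mulrC (mulrC (fsin _ _)). Qed.

Lemma ip_sinc_op_sym s f g : 0 <= s -> lbm f -> lbm g ->
  ip (sinc_op s f) g = ip f (sinc_op s g).
Proof. by move=> s0 hf hg; rewrite (ipC f) !ip_sinc_op// sinc_formC. Qed.

Lemma sinc_form_ge0 s f : 0 <= sinc_form s f f.
Proof.
rewrite mulr_ge0 ?invr_ge0 ?pi_ge0//; apply: itg_ge0 => t _.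
by rewrite -!expr2 addr_ge0 ?sqr_ge0.
Qed.

Lemma sinc_opD s f g : 0 <= s -> lbm f -> lbm g ->
  sinc_op s (fun x => f x + g x) = fun x => sinc_op s f x + sinc_op s g x.
Proof.
move=> s0 hf hg; apply/funext => x; rewrite !sinc_opE// -itgD.
- by apply: eq_itg => y _; rewrite mulrDr.
- by apply: lbmM => //; exact: lbm_kernel.
- by apply: lbmM => //; exact: lbm_kernel.
Qed.

Lemma sinc_opZ s (k : R) f : 0 <= s -> lbm f ->
  sinc_op s (fun x => k * f x) = fun x => k * sinc_op s f x.
Proof.
move=> s0 hf; apply/funext => x; rewrite !sinc_opE// -itgZ.
- by apply: eq_itg => y _; rewrite mulrCA.
- by apply: lbmM => //; exact: lbm_kernel.
Qed.

End Operator.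

(** * Bessel's inequality and the bound Q <= Id *)

Section Bessel.
Local Open Scope classical_set_scope.
Variable R : realType.
Local Notation lbm := (@locally_bounded_measurable R).
Implicit Types (f g u : R -> R) (s t : R).

Let lerN11 : (-1 : R) <= 1. Proof. lra. Qed.

Lemma sin_natmul_pi (n : nat) : sin (n%:R * pi) = 0 :> R.
Proof.
elim: n => [|n IH]; first by rewrite mul0r sin0.
by rewrite -natr1 mulrDl mul1r sinD IH sinpi mul0r mulr0 addr0.
Qed.

Lemma itg_cos (w : R) : w != 0 -> itg (-1) 1 (fun y => cos (w * y)) = 2 * sin w / w.
Proof.
move=> w0; have hd := has_derivZ w^-1 (has_deriv_sin w).
rewrite (@eq_itg _ _ _ _ (fun y => w^-1 * (w * cos (w * y)))); last first.
  by move=> y _; rewrite mulKf.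
rewrite (itg_ftc hd); last lra; last first.
  by apply: has_deriv_continuous; apply: has_derivZ; apply: has_derivZ; exact: has_deriv_cos.
by rewrite mulrN1 sinN mulr1; ring.
Qed.

Lemma itg_sin (w : R) : itg (-1) 1 (fun y => sin (w * y)) = 0.
Proof.
have [->|w0] := eqVneq w 0.
  rewrite (@eq_itg _ _ _ _ (fun=> 0)); last by move=> y _; rewrite mul0r sin0.
  by rewrite itg_cst ?mul0r// lerN11.
have hd := has_derivZ (- w^-1) (has_deriv_cos w).
rewrite (@eq_itg _ _ _ _ (fun y => - w^-1 * - (w * sin (w * y)))); last first.
  by move=> y _; rewrite mulrNN mulKf.
rewrite (itg_ftc hd); last lra; last first.
  apply: has_deriv_continuous; apply: has_derivZ; apply: has_derivN; apply: has_derivZ.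
  exact: has_deriv_sin.
by rewrite mulrN1 cosN mulr1; ring.
Qed.

Let H f t := fcos f t ^+ 2 + fsin f t ^+ 2.

(* Bessel's inequality for the orthogonal exponentials e^{i (t + k pi) y} on
   [-1, 1], written with the real and imaginary parts of the projection of f. *)
Lemma bessel_trig f t (K : nat) : lbm f ->
  \sum_(k < K) H f (t + k%:R * pi) <= 2 * ip f f.
Proof.
move=> hf.
pose tk (k : nat) : R := t + k%:R * pi.
pose c k := fcos f (tk k); pose d k := fsin f (tk k).
(* [U k] and [V k] are the real and imaginary parts of F(t_k) e^(-i t_k y), where F is [fcos f] + i
   [fsin f]. *)
pose U k y := c k * cos (tk k * y) + d k * sin (tk k * y).
pose V k y := d k * cos (tk k * y) - c k * sin (tk k * y).
have lU k : lbm (U k) by apply: lbmD; apply: lbmZ; [exact: lbm_cos|exact: lbm_sin].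
have lV k : lbm (V k) by apply: lbmB; apply: lbmZ; [exact: lbm_cos|exact: lbm_sin].
pose u y := \sum_(k < K) U k y; pose v y := \sum_(k < K) V k y.
have lu : lbm u by apply: lbm_sum.
have lv : lbm v by apply: lbm_sum.
have fU k : ip f (U k) = H f (tk k).
  rewrite /ip (@eq_itg _ _ _ _ (fun y => c k * (f y * cos (tk k * y)) + d k * (f y * sin (tk k * y)))).
    rewrite itgD ?itgZ; rewrite /H ?expr2//.
    - by apply: lbmM => //; exact: lbm_sin.
    - by apply: lbmM => //; exact: lbm_cos.
    - by apply: lbmZ; apply: lbmM => //; exact: lbm_cos.
    - by apply: lbmZ; apply: lbmM => //; exact: lbm_sin.
  by move=> y _; rewrite /U; ring.
have fu : ip f u = \sum_(k < K) H f (tk k).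
  rewrite /ip (@eq_itg _ _ _ _ (fun y => \sum_(k < K) f y * U k y)); last first.
    by move=> y _; rewrite /u mulr_sumr.
  rewrite (@itg_sum _ _ _ K (fun k y => f y * U k y)); last by move=> k _; exact: lbmM.
  by apply: eq_bigr => k _; exact: fU.
have UV (k l : nat) : itg (-1) 1 (fun y => U k y * U l y + V k y * V l y) =
    if k == l then 2 * H f (tk k) else 0.
  rewrite (@eq_itg _ _ _ _ (fun y => (c k * c l + d k * d l) * cos ((tk k - tk l) * y)
      + (d k * c l - c k * d l) * sin ((tk k - tk l) * y))); last first.
    by move=> y _; rewrite (mulrBl y (tk k)) cosB sinB /U /V; ring.
  rewrite itgD; [|by apply: lbmZ; exact: lbm_cos|by apply: lbmZ; exact: lbm_sin].
  rewrite !itgZ; [|exact: lbm_sin|exact: lbm_cos].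
  rewrite itg_sin mulr0 addr0; case: eqVneq => [->|kl].
    rewrite subrr (@eq_itg _ _ _ _ (fun=> 1)); last by move=> y _; rewrite mul0r cos0.
    by rewrite itg_cst// /H /c /d; ring.
  have E : tk k - tk l = k%:R * pi - l%:R * pi by rewrite /tk; ring.
  rewrite itg_cos; first by rewrite E sinB !sin_natmul_pi; ring.
  rewrite E -mulrBl mulf_neq0//; first by rewrite subr_eq0 eqr_nat.
  by rewrite gt_eqF// pi_gt0.
have uv : itg (-1) 1 (fun y => u y * u y + v y * v y) = 2 * \sum_(k < K) H f (tk k).
  rewrite (@eq_itg _ _ _ _ (fun y => \sum_(k < K) \sum_(l < K) (U k y * U l y + V k y * V l y))).
    rewrite (@itg_sum _ _ _ K (fun k y => \sum_(l < K) (U k y * U l y + V k y * V l y))); last first.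
      move=> k _; apply: (@lbm_sum _ K (fun l y => U k y * U l y + V k y * V l y)) => l _.
      by apply: lbmD; exact: lbmM.
    rewrite mulr_sumr; apply: eq_bigr => k _.
    rewrite (@itg_sum _ _ _ K (fun l y => U k y * U l y + V k y * V l y)); last first.
      by move=> l _; apply: lbmD; exact: lbmM.
    rewrite (bigD1 k)//= UV eqxx big1 ?addr0// => l lk.
    by rewrite UV eq_sym (inj_eq val_inj) (negbTE lk).
  move=> y _; rewrite /u /v !big_distrlr /= -big_split /=; apply: eq_bigr => k _.
  by rewrite -big_split.
(* Squared distance from [f] to its projection, whose real and imaginary parts are u/2 and v/2; the
   factor 1/2 is the inverse of the length of [-1, 1]. *)
have : 0 <= itg (-1) 1 (fun y => (f y - 2^-1 * u y) * (f y - 2^-1 * u y)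
                               + (2^-1 * v y) * (2^-1 * v y)).
  by apply: itg_ge0 => y _; rewrite -!expr2 addr_ge0 ?sqr_ge0.
rewrite (@eq_itg _ _ _ _ (fun y => (f y * f y - f y * u y) + 4^-1 * (u y * u y + v y * v y))).
  rewrite itgD; [|by apply: lbmB; exact: lbmM|by apply: lbmZ; apply: lbmD; exact: lbmM].
  rewrite itgZ; last by apply: lbmD; exact: lbmM.
  rewrite uv itgB; [|exact: lbmM..].
  rewrite -/(ip f f) -/(ip f u) fu; rewrite -/(tk _); lra.
by move=> y _; field.
Qed.

Lemma continuous_power f : lbm f -> continuous (H f).
Proof.
move=> hf; have h1 := has_deriv_cos_tr (-1) 1 hf; have h2 := has_deriv_sin_tr (-1) 1 hf.
exact: has_deriv_continuous (has_derivD (has_derivM h1 h1) (has_derivM h2 h2)).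
Qed.

(** Integrating [bessel_trig] over t in a window of length pi bounds the integral of |F|^2 over K
    consecutive windows by 2 pi <f, f>, whatever K. Here K is such that the windows starting at -s
    reach s, and evenness makes the integral over [0, s] half of that over [-s, s]. *)
Lemma sinc_form_le s f : 0 <= s -> lbm f -> sinc_form s f f <= ip f f.
Proof.
move=> s0 hf; rewrite /sinc_form mulrC ler_pdivrMr ?pi_gt0//.
rewrite (@eq_itg _ _ _ _ (H f)); last by move=> t _; rewrite -!expr2.
have cH := continuous_power hf.
have lH : lbm (H f) := lbm_continuous cH.
have evenH t : H f (- t) = H f t.
  rewrite /H; have -> : fcos f (- t) = fcos f t.
    by apply: eq_itg => y _; rewrite mulNr cosN.
  have E : fsin f (- t) = - fsin f t.
    rewrite /fsin/sin_tr -itgN; last exact: lbm_mul_sin.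
    by apply: eq_itg => y _; rewrite mulNr sinN mulrN.
  by rewrite E sqrrN.
have p0 := pi_gt0 R.
have cHs (k : R) : continuous (fun t => H f (t + k)).
  move=> t; apply: (@continuous_comp _ _ _ (fun t => t + k)); last exact: cH.
  by apply: cvgD; [exact: cvg_id|exact: cvg_cst].
have win (K : nat) : itg (- s) (- s + K%:R * pi) (H f) =
    itg (- s) (- s + pi) (fun t => \sum_(k < K) H f (t + k%:R * pi)).
  elim: K => [|K IH].
    rewrite mul0r addr0 itg_point (@eq_itg _ _ _ _ (fun=> 0)); last by move=> t _; rewrite big_ord0.
    by rewrite itg_cst ?mul0r//; lra.
  rewrite (@itg_split _ _ (- s + K%:R * pi))//; last 2 first.
  - by rewrite lerDl mulr_ge0// ltW.
  - by rewrite lerD2l ler_pM2r// ler_nat.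
  rewrite IH -natr1 (_ : - s + (K%:R + 1) * pi = - s + pi + K%:R * pi); last ring.
  rewrite itg_shift//; last lra.
  rewrite -itgD.
  - by apply: eq_itg => t _; rewrite big_ord_recr.
  - by apply: (@lbm_sum _ K (fun k t => H f (t + k%:R * pi))) => k _; exact: lbm_continuous.
  - exact: lbm_continuous.
pose K := (Num.truncn (2 * s / pi)).+1.
have Ks : 2 * s <= K%:R * pi.
  rewrite -ler_pdivrMr//; apply: ltW.
  by rewrite /K truncnS_gt.
have main : itg (- s) (- s + K%:R * pi) (H f) <= 2 * ip f f * pi.
  rewrite win (_ : 2 * ip f f * pi = itg (- s) (- s + pi) (fun=> 2 * ip f f)); last first.
    by rewrite itg_cst; lra.
  apply: le_itg; last by move=> t _; exact: bessel_trig.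
  - by apply: (@lbm_sum _ K (fun k t => H f (t + k%:R * pi))) => k _; exact: lbm_continuous.
  - exact: lbm_cst.
rewrite (@itg_split _ _ s) in main => //; [|lra|lra].
rewrite itg_even// in main.
have : 0 <= itg s (- s + K%:R * pi) (H f).
  by apply: itg_ge0 => t _; rewrite addr_ge0 ?sqr_ge0.
lra.
Qed.

End Bessel.

(** * Simplicity of the positive eigenvalues *)

Section Simplicity.
Local Open Scope classical_set_scope.
Variable R : realType.
Local Notation lbm := (@locally_bounded_measurable R).
Implicit Types (f g h u : R -> R) (t x : R).
Variables (s l : R).
Hypotheses (s0 : 0 < s) (l0 : 0 < l).
Let s0' := ltW s0.

Let lerN11 : (-1 : R) <= 1. Proof. lra. Qed.

(** The equation is imposed at every real x, not almost everywhere on [-1, 1]: [sinc_op s f] is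
    defined on the whole line, and this selects the smooth representative. *)
Definition eigenfun f := lbm f /\ sinc_op s f = fun x => l * f x.

Lemma eigenfunD f g : eigenfun f -> eigenfun g -> eigenfun (fun x => f x + g x).
Proof.
move=> [lf ef] [lg eg]; split; first exact: lbmD.
by rewrite sinc_opD// ef eg; apply/funext => x; rewrite mulrDr.
Qed.

Lemma eigenfunZ (k : R) f : eigenfun f -> eigenfun (fun x => k * f x).
Proof.
move=> [lf ef]; split; first exact: lbmZ.
by rewrite sinc_opZ// ef; apply/funext => x; rewrite mulrCA.
Qed.

(** The derivative of l^-1 Q f. It sees [f] only through its transforms at frequencies in [0, s],
    which gives a bound in terms of the sup norm of [f] on [-1, 1]. *)
Definition eigen_deriv f x := l^-1 * (pi^-1 *
  (- sin_tr 0 s (fun t => t * fcos f t) x + cos_tr 0 s (fun t => t * fsin f t) x)).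

Lemma lbm_id_fcos f : lbm f -> lbm (fun t => t * fcos f t).
Proof. by move=> hf; exact: lbmM (@lbm_id R) (lbm_fcos hf). Qed.

Lemma lbm_id_fsin f : lbm f -> lbm (fun t => t * fsin f t).
Proof. by move=> hf; exact: lbmM (@lbm_id R) (lbm_fsin hf). Qed.

Lemma eigenfun_deriv f : eigenfun f -> has_deriv f (eigen_deriv f).
Proof.
move=> [lf ef]; have := has_derivZ l^-1 (has_deriv_sinc_op s0' lf).
by rewrite ef; under eq_fun do rewrite mulKf ?gt_eqF//.
Qed.

Lemma continuous_eigen_deriv f : lbm f -> continuous (eigen_deriv f).
Proof.
move=> lf; apply: has_deriv_continuous; apply: has_derivZ; apply: has_derivZ.
apply: has_derivD; first by apply: has_derivN; apply: has_deriv_sin_tr; exact: lbm_id_fcos.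
by apply: has_deriv_cos_tr; exact: lbm_id_fsin.
Qed.

Lemma lbm_eigen_deriv f : lbm f -> lbm (eigen_deriv f).
Proof. by move=> lf; apply: lbm_continuous; exact: continuous_eigen_deriv. Qed.

Lemma continuous_cosM t : continuous (fun y => - (t * sin (t * y))).
Proof.
by apply: has_deriv_continuous; apply: has_derivN; apply: has_derivZ; exact: has_deriv_sin.
Qed.

Lemma continuous_sinM t : continuous (fun y => t * cos (t * y)).
Proof. by apply: has_deriv_continuous; apply: has_derivZ; exact: has_deriv_cos. Qed.

(** The boundary term is the obstruction to d/dx commuting with Q; it disappears when [f] vanishes
    at both endpoints. *)
Lemma fcos_deriv f df t : has_deriv f df -> continuous df ->
  fcos df t = (f 1 - f (-1)) * cos t + t * fsin f t.
Proof.
move=> hf cf; rewrite /fcos/cos_tr (itg_by_parts hf (has_deriv_cos t) cf (@continuous_cosM t))//.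
rewrite /fsin/sin_tr -itgZ; last exact: lbm_mul_sin (lbm_deriv hf).
rewrite -[X in _ - X]opprK -itgN; last first.
  by apply: lbmM (lbm_deriv hf) _; apply: lbm_continuous; exact: continuous_cosM.
rewrite mulr1 mulrN1 cosN opprK; congr (_ + _); first by ring.
by apply: eq_itg => y _; ring.
Qed.

Lemma fsin_deriv f df t : has_deriv f df -> continuous df ->
  fsin df t = (f 1 + f (-1)) * sin t - t * fcos f t.
Proof.
move=> hf cf; rewrite /fsin/sin_tr (itg_by_parts hf (has_deriv_sin t) cf (@continuous_sinM t))//.
rewrite /fcos/cos_tr -itgZ; last exact: lbm_mul_cos (lbm_deriv hf).
rewrite mulr1 mulrN1 sinN; congr (_ - _); first by ring.
by apply: eq_itg => y _; ring.
Qed.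

(* Both sides come from evaluating <Q f', f>: on the Fourier side it is
   l (f(1)^2 - f(-1)^2), while <f', Q f> = l <f', f> is half of that. *)
Lemma eigenfun_endpoints f : eigenfun f -> f 1 ^+ 2 = f (-1) ^+ 2.
Proof.
move=> ef; have [lf Qf] := ef.
have hd := eigenfun_deriv ef; have cd := continuous_eigen_deriv lf.
set df := eigen_deriv f in hd cd.
have ld : lbm df := lbm_continuous cd.
have E1 : ip (sinc_op s df) f = l * ((f 1 ^+ 2 - f (-1) ^+ 2) / 2).
  rewrite ip_sinc_op_sym// Qf ipZr//; congr (_ * _).
  have hff := has_derivZ 2^-1 (has_derivM hd hd).
  rewrite /ip (@eq_itg _ _ _ _ (fun x => 2^-1 * (df x * f x + f x * df x))); last first.
    by move=> x _; field.
  rewrite (itg_ftc hff)//; first by rewrite -!expr2; lra.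
  have cf := has_deriv_continuous hd.
  move=> x; apply: cvgM; first exact: cvg_cst.
  by apply: cvgD; apply: cvgM; [exact: cd|exact: cf|exact: cf|exact: cd].
have Q1 : sinc_op s f 1 = pi^-1 * itg 0 s (fun t => fcos f t * cos t + fsin f t * sin t).
  rewrite sinc_op_fourier//; congr (_ * _); apply: eq_itg => t _.
  by rewrite mul1r.
have QN1 : sinc_op s f (-1) = pi^-1 * itg 0 s (fun t => fcos f t * cos t - fsin f t * sin t).
  rewrite sinc_op_fourier//; congr (_ * _); apply: eq_itg => t _.
  by rewrite mulN1r cosN sinN mulrN.
have lc : lbm (fun t => fcos f t * cos t).
  by apply: lbmM; [exact: lbm_fcos|apply: lbm_continuous; exact: continuous_cos].
have ls : lbm (fun t => fsin f t * sin t).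
  by apply: lbmM; [exact: lbm_fsin|apply: lbm_continuous; exact: continuous_sin].
rewrite itgD// in Q1; rewrite itgB// in QN1.
(* The products t [fcos f t] [fsin f t] coming from the two integrations by parts cancel. Only
   boundary terms remain, and [Q1] and [QN1] evaluate them. *)
have E2 : ip (sinc_op s df) f = (f 1 - f (-1)) * (pi^-1 * itg 0 s (fun t => fcos f t * cos t))
    + (f 1 + f (-1)) * (pi^-1 * itg 0 s (fun t => fsin f t * sin t)).
  rewrite ip_sinc_op// /sinc_form (@eq_itg _ _ _ _ (fun t =>
    (f 1 - f (-1)) * (fcos f t * cos t) + (f 1 + f (-1)) * (fsin f t * sin t))); last first.
    by move=> t _; rewrite (fcos_deriv _ hd cd) (fsin_deriv _ hd cd); ring.
  rewrite itgD; [|exact: lbmZ|exact: lbmZ].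
  by rewrite !itgZ//; ring.
rewrite Qf in Q1 QN1.
set X := pi^-1 * itg 0 s (fun t => fcos f t * cos t) in E2.
set Y := pi^-1 * itg 0 s (fun t => fsin f t * sin t) in E2.
have EX : X = l * (f 1 + f (-1)) / 2 by rewrite /X; move: Q1 QN1; rewrite mulrDr mulrBr; lra.
have EY : Y = l * (f 1 - f (-1)) / 2 by rewrite /Y; move: Q1 QN1; rewrite mulrDr mulrBr; lra.
have : l * (f 1 ^+ 2 - f (-1) ^+ 2) = l * ((f 1 ^+ 2 - f (-1) ^+ 2) / 2).
  by rewrite -E1 E2 EX EY; field.
move/(mulfI (lt0r_neq0 l0)); lra.
Qed.

Definition eigenfun0 h := [/\ eigenfun h, h 1 = 0 & h (-1) = 0].

(** Without boundary terms, d/dx acts on the transforms as multiplication by the frequency, hence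
    commutes with Q. *)
Lemma eigenfun0_deriv_eigen h : eigenfun0 h -> eigenfun (eigen_deriv h).
Proof.
move=> [eh h1 hN1]; have [lh Qh] := eh.
have hd := eigenfun_deriv eh; have cd := continuous_eigen_deriv lh.
split; first exact: lbm_eigen_deriv.
have ld := lbm_eigen_deriv lh.
rewrite sinc_op_tr//; apply/funext => x.
rewrite /eigen_deriv mulVKf ?gt_eqF//; congr (_ * _); rewrite addrC; congr (_ + _).
  rewrite /sin_tr -itgN; last exact: lbm_mul_sin (lbm_id_fcos lh).
  by apply: eq_itg => t _; rewrite (fsin_deriv _ hd cd) h1 hN1; ring.
by apply: eq_itg => t _; rewrite (fcos_deriv _ hd cd) h1 hN1; ring.
Qed.

(* The commutator of Q with the dilation x d/dx has rank two; its quadratic form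
   at an eigenfunction vanishing at the endpoints is a sum of two squares, which
   must therefore both be zero. *)
Lemma eigenfun0_dilation h : eigenfun0 h -> eigenfun (fun x => x * eigen_deriv h x).
Proof.
move=> [eh h1 hN1]; have [lh Qh] := eh.
have hd := eigenfun_deriv eh; have cd := continuous_eigen_deriv lh.
have ld := lbm_eigen_deriv lh.
set g := fun x => _.
have lg : lbm g by exact: lbmM (@lbm_id R) ld.
have hxh : has_deriv (fun y => y * h y) (fun y => h y + g y).
  move=> y; have := has_derivM (@has_deriv_id R) hd y.
  by rewrite mul1r.
have cxh : continuous (fun y => h y + g y).
  move=> y; apply: cvgD; first exact: (has_deriv_continuous hd).
  by apply: cvgM; [exact: cvg_id|exact: cd].
have lxh : lbm (fun y => y * h y) := lbm_deriv hxh.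
(* Integration by parts for x h(x): on the Fourier side, x d/dx becomes minus the derivative of t
   times the transform. *)
have cosg t : fcos h t - t * fsin (fun y => y * h y) t = - fcos g t.
  have := fcos_deriv t hxh cxh; rewrite h1 hN1 !mulr0 subrr mul0r add0r => <-.
  rewrite /fcos/cos_tr; under [X in _ - itg _ _ X]eq_fun do rewrite mulrDl.
  by rewrite itgD; [ring|exact: lbm_mul_cos|exact: lbm_mul_cos].
have sing t : fsin h t + t * fcos (fun y => y * h y) t = - fsin g t.
  have := fsin_deriv t hxh cxh; rewrite h1 hN1 !mulr0 addr0 mul0r add0r => E.
  rewrite -[X in _ + X]opprK -E.
  rewrite /fsin/sin_tr; under [X in _ - itg _ _ X]eq_fun do rewrite mulrDl.
  by rewrite itgD; [ring|exact: lbm_mul_sin|exact: lbm_mul_sin].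
have dcos : has_deriv (fun t => t * fcos h t) (fun t => - fcos g t).
  move=> t; rewrite -cosg.
  have := has_derivM (@has_deriv_id R) (has_deriv_cos_tr (-1) 1 lh) t.
  by rewrite mul1r mulrN.
have dsin : has_deriv (fun t => t * fsin h t) (fun t => - fsin g t).
  move=> t; rewrite -sing.
  have := has_derivM (@has_deriv_id R) (has_deriv_sin_tr (-1) 1 lh) t.
  by rewrite mul1r.
have ccg := continuous_cos_tr (a := -1) (b := 1) lg.
have csg := continuous_sin_tr (a := -1) (b := 1) lg.
have lcg := lbm_fcos lg; have lsg := lbm_fsin lg.
(* Integrating the derivative [D] over [0, s] leaves a boundary term at t = s, which is the rank two
   commutator. *)
have key x : l * g x = s / pi * (fcos h s * cos (x * s) + fsin h s * sin (x * s)) + sinc_op s g x.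
  have D := has_derivD (has_derivM dcos (has_deriv_cos x)) (has_derivM dsin (has_deriv_sin x)).
  have cc := has_deriv_continuous (has_deriv_cos x).
  have cs := has_deriv_continuous (has_deriv_sin x).
  have := itg_ftc D; move=> /(_ 0 s); rewrite /= !mul0r addr0 subr0 => /(_ _ s0')E.
  rewrite sinc_op_fourier//.
  have -> : l * g x = pi^-1 * itg 0 s (fun t => x * (- (t * fcos h t * sin (x * t)) + t * fsin h t * cos (x * t))).
    rewrite /g /eigen_deriv /sin_tr /cos_tr -itgN; last exact: lbm_mul_sin (lbm_id_fcos lh).
    rewrite -itgD; last 2 first.
    - by apply: lbmN; exact: lbm_mul_sin (lbm_id_fcos lh).
    - exact: lbm_mul_cos (lbm_id_fsin lh).
    rewrite itgZ; first by (set X := itg _ _ _; move: (pi^-1) => p; field; exact: lt0r_neq0).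
    apply: lbmD; first by apply: lbmN; exact: lbm_mul_sin (lbm_id_fcos lh).
    exact: lbm_mul_cos (lbm_id_fsin lh).
  have -> : s / pi * (fcos h s * cos (x * s) + fsin h s * sin (x * s)) =
     pi^-1 * (s * fcos h s * cos (x * s) + s * fsin h s * sin (x * s)) by ring.
  rewrite -E; last first.
    move=> t; apply: cvgD; apply: cvgD.
    - by apply: cvgM; [apply: cvgN; exact: ccg|exact: cc].
    - by apply: cvgM; [exact: (has_deriv_continuous dcos)|exact: continuous_cosM].
    - by apply: cvgM; [apply: cvgN; exact: csg|exact: cs].
    - by apply: cvgM; [exact: (has_deriv_continuous dsin)|exact: continuous_sinM].
  rewrite -mulrDr -itgD.
  - by congr (_ * _); apply: eq_itg => t _; ring.
  - apply: lbmD; apply: lbmD.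
    + exact: lbm_mul_cos (lbmN lcg).
    + apply: lbmM (lbm_deriv dcos) _; apply: lbm_continuous; exact: continuous_cosM.
    + exact: lbm_mul_sin (lbmN lsg).
    + apply: lbmM (lbm_deriv dsin) _; apply: lbm_continuous; exact: continuous_sinM.
  - by apply: lbmD; [exact: lbm_mul_cos|exact: lbm_mul_sin].
(* When [key] is paired with [h], both l <g, h> and <Q g, h> = <g, Q h> have the same value, so the
   boundary term is orthogonal to [h]. *)
have E0 : s / pi * (fcos h s ^+ 2 + fsin h s ^+ 2) = 0.
  have lQ := lbm_sinc_op s0' lg.
  have lcs : lbm (fun x => s / pi * (fcos h s * cos (x * s) + fsin h s * sin (x * s))).
    apply: lbmZ; under eq_fun do rewrite (mulrC _ s).
    by apply: lbmD; apply: lbmZ; [exact: lbm_cos|exact: lbm_sin].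
  have E1 : ip (sinc_op s g) h = l * ip g h by rewrite ip_sinc_op_sym// Qh ipZr.
  have := ipZl l lg lh; rewrite (eq_ip (fun x _ => key x) (fun x _ => erefl (h x))).
  rewrite ipDl// E1 => /(canRL (addrK _)); rewrite subrr.
  suff -> : ip (fun x => s / pi * (fcos h s * cos (x * s) + fsin h s * sin (x * s))) h =
     s / pi * (fcos h s ^+ 2 + fsin h s ^+ 2) by [].
  rewrite /ip (@eq_itg _ _ _ _ (fun x => s / pi * (fcos h s * (h x * cos (s * x)) + fsin h s * (h x * sin (s * x))))).
    have lhc := lbm_mul_cos s lh; have lhs := lbm_mul_sin s lh.
    rewrite itgZ; last by apply: lbmD; apply: lbmZ.
    by rewrite itgD; [|exact: lbmZ|exact: lbmZ]; rewrite !itgZ// -!expr2.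
  by move=> x _; rewrite (mulrC x s); ring.
have sp : 0 < s / pi by rewrite divr_gt0// pi_gt0.
have : fcos h s ^+ 2 + fsin h s ^+ 2 = 0.
  by apply: (mulfI (lt0r_neq0 sp)); rewrite mulr0.
move/eqP; rewrite paddr_eq0 ?sqr_ge0// !sqrf_eq0 => /andP[/eqP c0 /eqP d0].
split=> //; apply/funext => x; rewrite key c0 d0 !mul0r addr0 mulr0 add0r//.
Qed.

(** The endpoint identity is applied to the eigenfunctions h' + x h' and h' - x h': each vanishes at
    one endpoint and equals 2 h' at the other, which forces h' to vanish there. *)
Lemma eigenfun0_deriv h : eigenfun0 h -> eigenfun0 (eigen_deriv h).
Proof.
move=> eh; have e1 := eigenfun0_deriv_eigen eh; have e2 := eigenfun0_dilation eh.
split=> //.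
- have := eigenfun_endpoints (eigenfunD e1 e2) => /=.
  rewrite mul1r mulN1r subrr expr0n/= => /eqP; rewrite sqrf_eq0 => /eqP; lra.
- have := eigenfun_endpoints (eigenfunD e1 (eigenfunZ (-1) e2)) => /=.
  rewrite mul1r !mulN1r opprK subrr expr0n/= => /esym/eqP; rewrite sqrf_eq0 => /eqP; lra.
Qed.

Let L : R := 4 * s ^+ 2 / (pi * l).

(** The constant L = 4 s^2 / (pi l) accounts for two integrals over [0, s], with frequencies at most
    s and transforms at most 2 M. *)
Lemma eigen_deriv_bound f M x : lbm f -> (forall y, -1 <= y <= 1 -> `|f y| <= M) ->
  `|eigen_deriv f x| <= L * M.
Proof.
move=> lf fM.
have M0 : 0 <= M by apply: le_trans (fM 1 _); rewrite ?normr_ge0//; apply/andP; split.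
have cb t : `|fcos f t| <= M * 2.
  rewrite (_ : (2 : R) = 1 - -1); last lra.
  apply: itg_norm_le; [by []|exact: lbm_mul_cos|] => y /fM fy.
  by rewrite normrM -[leRHS]mulr1 ler_pM// ler_norml cos_geN1 cos_le1.
have sb t : `|fsin f t| <= M * 2.
  rewrite (_ : (2 : R) = 1 - -1); last lra.
  apply: itg_norm_le; [by []|exact: lbm_mul_sin|] => y /fM fy.
  by rewrite normrM -[leRHS]mulr1 ler_pM// ler_norml sin_geN1 sin_le1.
have b1 : `|sin_tr 0 s (fun t => t * fcos f t) x| <= s * (M * 2) * (s - 0).
  apply: itg_norm_le; [by []|exact: lbm_mul_sin (lbm_id_fcos lf)|] => t /andP[t0 ts].
  rewrite normrM -[leRHS]mulr1 ler_pM//; last by rewrite ler_norml sin_geN1 sin_le1.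
  by rewrite normrM ler_pM// ger0_norm.
have b2 : `|cos_tr 0 s (fun t => t * fsin f t) x| <= s * (M * 2) * (s - 0).
  apply: itg_norm_le; [by []|exact: lbm_mul_cos (lbm_id_fsin lf)|] => t /andP[t0 ts].
  rewrite normrM -[leRHS]mulr1 ler_pM//; last by rewrite ler_norml cos_geN1 cos_le1.
  by rewrite normrM ler_pM// ger0_norm.
have pl : 0 < pi * l :> R by rewrite mulr_gt0// pi_gt0.
rewrite /eigen_deriv mulrA normrM ger0_norm; last by rewrite -invfM invr_ge0 ltW// mulrC.
rewrite /L (_ : 4 * s ^+ 2 / (pi * l) * M = l^-1 * pi^-1 * (4 * s ^+ 2 * M)); last first.
  by rewrite invfM; ring.
rewrite ler_wpM2l//; first by rewrite -invfM invr_ge0 ltW// mulrC.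
by rewrite (le_trans (ler_normD _ _))// normrN; move: b1 b2; rewrite subr0 expr2; lra.
Qed.

Let L0 : 0 < L.
Proof. by rewrite divr_gt0 ?mulr_gt0 ?pi_gt0 ?exprn_gt0. Qed.

(** The derivative of [h] is again in the space and bounded by L M, so the previous stage applies to
    it. Integrating the weight exp(2 L (x + 1)) from -1, where [h] vanishes, yields 1/(2L) against
    the factor L: one half is gained at each stage. *)
Lemma eigenfun0_decay (k : nat) h M : eigenfun0 h ->
  (forall y, -1 <= y <= 1 -> `|h y| <= M) ->
  forall x, -1 <= x <= 1 -> `|h x| <= M / 2 ^+ k * expR (2 * L * (x + 1)).
Proof.
elim: k h M => [|k IH] h M eh hM x /andP[x1 x2].
  rewrite expr0 divr1 (le_trans (hM x _)) ?x1// ler_peMr//.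
    by apply: le_trans (hM x _); rewrite ?x1.
  rewrite -[leLHS]expR0 ler_expR; apply: mulr_ge0; last lra.
  by apply: mulr_ge0 => //; exact: ltW L0.
have [[lh Qh] h1 hN1] := eh.
have M0 : 0 <= M by apply: le_trans (hM 1 _); rewrite ?normr_ge0//; apply/andP; split.
have [eh0 _ _] := eh; have hd := eigenfun_deriv eh0.
have {}IH := IH _ _ (eigenfun0_deriv eh) (fun y _ => eigen_deriv_bound y lh hM).
pose G y := M / 2 ^+ k.+1 * expR (2 * L * (y + 1)).
have hG : has_deriv G (fun y => L * M / 2 ^+ k * expR (2 * L * (y + 1))).
  have h2 : has_deriv (fun y : R => 2 * L * (y + 1)) (fun y => 2 * L * (1 + 0)).
    by apply: has_derivZ; apply: has_derivD; [exact: has_deriv_id|exact: has_deriv_cst].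
  move=> y; apply: (is_derive_eq (has_derivZ (M / 2 ^+ k.+1) (has_deriv_comp (@is_derive_expR R) h2) y)).
  rewrite addr0 mulr1 exprS; move: L (expR _) => K X; field.
  by rewrite expf_neq0.
have G0 : 0 <= G (-1) by rewrite mulr_ge0 ?divr_ge0 ?exprn_ge0 ?expR_ge0.
have hx : -1 <= x <= 1 by rewrite x1.
rewrite ler_norml; apply/andP; split.
  have := has_deriv_le (has_derivN hG) hd x1.
  rewrite hN1 /G; move: G0; rewrite /G => G0 /(_ _)H.
  have {}H := H _.
  suff : - (M / 2 ^+ k.+1 * expR (2 * L * (x + 1))) - - (M / 2 ^+ k.+1 * expR (2 * L * (-1 + 1))) <= h x - 0 by lra.
  apply: H => y /andP[y1 y2]; have /IH : -1 <= y <= 1 by rewrite y1 (le_trans y2).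
  by rewrite ler_norml => /andP[].
have := has_deriv_le hd hG x1; rewrite hN1 /G; move: G0; rewrite /G => G0 H.
suff : h x - 0 <= M / 2 ^+ k.+1 * expR (2 * L * (x + 1)) - M / 2 ^+ k.+1 * expR (2 * L * (-1 + 1)) by lra.
apply: H => y /andP[y1 y2]; have /IH : -1 <= y <= 1 by rewrite y1 (le_trans y2).
by rewrite ler_norml => /andP[].
Qed.

Lemma eigenfun0_eq0 h x : eigenfun0 h -> -1 <= x <= 1 -> h x = 0.
Proof.
move=> eh hx; have [[lh _] _ _] := eh.
have [M M0 hM] := lbm_bound11 lh.
have := fun k => eigenfun0_decay k eh hM hx.
set B := expR _ => H.
apply/eqP; rewrite -normr_le0 leNgt; apply/negP => hp.
have C0 : 0 <= M * B by rewrite mulr_ge0 ?expR_ge0.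
have [k kE] : exists k : nat, M * B / `|h x| < k%:R.
  by exists (Num.truncn (M * B / `|h x|)).+1; rewrite truncnS_gt.
have := H k; apply/negP; rewrite -ltNge.
rewrite mulrAC ltr_pdivrMr ?exprn_gt0// [ltRHS]mulrC.
rewrite ltr_pdivrMr// in kE; apply: lt_le_trans kE _; rewrite ler_wpM2r//.
by rewrite -natrX ler_nat ltnW// ltn_expl.
Qed.

(** The combination g(1) f - f(1) g vanishes at 1, then at -1 by the endpoint identity, hence on
    [-1, 1]. Its product with [f] is g(1) <f, f>, so g(1) = 0, and the same argument shows that [g]
    is zero. *)
Lemma eigenvalue_simple f g : eigenfun f -> eigenfun g ->
  ip f g = 0 -> ip f f != 0 -> ip g g = 0.
Proof.
move=> ef eg fg f0; have [lf _] := ef; have [lg _] := eg.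
have vanish u : eigenfun u -> u 1 = 0 -> forall x, -1 <= x <= 1 -> u x = 0.
  move=> eu u1 x hx; apply: eigenfun0_eq0 hx; split=> //.
  by apply/eqP; rewrite -sqrf_eq0 -eigenfun_endpoints// u1 expr0n.
have eh := eigenfunD (eigenfunZ (g 1) ef) (eigenfunZ (- f 1) eg).
have h0 := vanish _ eh; have {}h0 := h0 _.
have g1 : g 1 = 0.
  have : ip (fun x => g 1 * f x + - f 1 * g x) f = 0.
    rewrite (@eq_ip _ _ (fun=> 0) _ f)//; last first.
      by apply: h0; ring.
    by rewrite /ip (@eq_itg _ _ _ _ (fun=> 0)) ?itg_cst ?mul0r// => x _; rewrite mul0r.
  rewrite ipDl; [|exact: lbmZ|exact: lbmZ|by []].
  rewrite !ipZl// (ipC g) fg mulr0 addr0 => /eqP; rewrite mulf_eq0 (negbTE f0) orbF.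
  by move/eqP.
have g0 := vanish _ eg g1.
by rewrite /ip (@eq_itg _ _ _ _ (fun=> 0)) ?itg_cst ?mul0r// => x /g0 ->; rewrite mul0r.
Qed.

End Simplicity.

(** * Sup norm and Lipschitz bounds for Q *)

Section OperatorBounds.
Local Open Scope classical_set_scope.
Variable R : realType.
Local Notation mu := (@lebesgue_measure R).
Local Notation lbm := (@locally_bounded_measurable R).
Implicit Types (f g h u : R -> R) (x y s : R).

Lemma bounded_on11 (h : R -> R) (M : R) : (forall x, -1 <= x <= 1 -> `|h x| <= M) ->
  [bounded h x | x in `[(-1 : R), 1]].
Proof.
move=> hM; exists M; split; first exact: num_real.
by move=> N MN x /=; rewrite in_itv/= => /hM /le_trans; apply; exact: ltW.
Qed.

Lemma integrable_mul11 (h f : R -> R) (M : R) : lbm h ->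
  (forall x, -1 <= x <= 1 -> `|h x| <= M) ->
  mu.-integrable `[(-1 : R), 1] (EFin \o f) ->
  mu.-integrable `[(-1 : R), 1] (EFin \o (fun x => h x * f x)).
Proof.
move=> lh hM fi; have mD : measurable (`[(-1 : R), 1] : set (measurableTypeR R)) by [].
have mh : measurable_fun (`[(-1 : R), 1] : set (measurableTypeR R)) h.
  by apply: measurable_funTS; exact: lbm_measurable.
exact: (integrableMr mD mh (bounded_on11 hM) fi).
Qed.

Lemma norm_itg_mul11 (h f : R -> R) (M : R) : lbm h ->
  (forall x, -1 <= x <= 1 -> `|h x| <= M) ->
  mu.-integrable `[(-1 : R), 1] (EFin \o f) ->
  `|itg (-1) 1 (fun x => h x * f x)| <= M * itg (-1) 1 (fun x => `|f x|).
Proof.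
move=> lh hM fi; have mD : measurable (`[(-1 : R), 1] : set (measurableTypeR R)) by [].
have hfi := integrable_mul11 lh hM fi.
have nfi : mu.-integrable `[(-1 : R), 1] (EFin \o (fun x => `|f x|)) by exact: (integrable_norm fi).
rewrite !itgE; apply: (le_trans (le_normr_Rintegral mD hfi)).
rewrite -RintegralZl//; apply: le_Rintegral => //.
- exact: (integrable_norm hfi).
- have lM : lbm (fun=> M) := lbm_cst M.
  by apply: (@integrable_mul11 (fun=> M) (fun x => `|f x|) `|M|).
by move=> x /=; rewrite in_itv/= => /hM hx; rewrite normrM ler_wpM2r.
Qed.

Lemma sinc_op_bound s f x : 0 <= s ->
  mu.-integrable `[(-1 : R), 1] (EFin \o f) ->
  `|sinc_op s f x| <= s / pi * itg (-1) 1 (fun y => `|f y|).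
Proof.
move=> s0 fi; rewrite sinc_opE//; apply: norm_itg_mul11 => //.
  exact: lbm_kernel.
by move=> y _; exact: sinc_fun_bound.
Qed.

Lemma sinc_op_lip s f x y : 0 <= s ->
  mu.-integrable `[(-1 : R), 1] (EFin \o f) ->
  `|sinc_op s f x - sinc_op s f y| <=
    s ^+ 2 / pi * `|x - y| * itg (-1) 1 (fun y => `|f y|).
Proof.
move=> s0 fi; rewrite !sinc_opE//.
have ki z := integrable_mul11 (lbm_kernel s z) (fun y _ => sinc_fun_bound (y - z) s0) fi.
rewrite -[X in `|X|](_ : itg (-1) 1 (fun z => (sinc_fun s (z - x) - sinc_fun s (z - y)) * f z) = _).
  apply: norm_itg_mul11 => //; first by apply: lbmB; exact: lbm_kernel.
  move=> z _; apply: le_trans (sinc_fun_lip _ _ s0) _.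
  by rewrite (_ : z - x - (z - y) = y - x) 1?distrC//; ring.
rewrite !itgE -RintegralB//.
by apply: eq_Rintegral => z _; rewrite mulrBl.
Qed.

(** A substitute for Cauchy-Schwarz: pointwise |f| <= d/2 + f^2/(2d), integrated over a segment of
    length 2. This gives 3d/2, rounded up to 2d. *)
Lemma itg_norm_le_ip f (d : R) : lbm f -> 0 < d -> ip f f <= d ^+ 2 ->
  itg (-1) 1 (fun x => `|f x|) <= 2 * d.
Proof.
move=> lf d0 fd.
have lff : lbm (fun x => f x * f x) by exact: lbmM.
have labs : lbm (fun x => `|f x|).
  apply/lbmP; split; first by apply: measurableT_comp => //; exact: lbm_measurable.
  move=> r; have /lbmP[_ /(_ r)[M HM]] := lf.
  by exists M => x /HM; rewrite normr_id.
apply: (@le_trans _ _ (itg (-1) 1 (fun x => d / 2 + (2 * d)^-1 * (f x * f x)))).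
  apply: le_itg => //; first by apply: lbmD; [exact: lbm_cst|exact: lbmZ].
  move=> x _; rewrite -expr2 -real_normK ?num_real//.
  rewrite -subr_ge0 (_ : _ - _ = (2 * d)^-1 * (d - `|f x|) ^+ 2); last first.
    by move: (`|f x|) => z; field; rewrite gt_eqF.
  by rewrite mulr_ge0 ?sqr_ge0// invr_ge0 mulr_ge0// ltW.
rewrite itgD; [|exact: lbm_cst|exact: lbmZ].
rewrite itg_cst; last lra.
rewrite itgZ//.
have : (2 * d)^-1 * ip f f <= (2 * d)^-1 * d ^+ 2.
  by rewrite ler_wpM2l// invr_ge0 mulr_ge0// ltW.
rewrite (_ : (2 * d)^-1 * d ^+ 2 = d / 2); last by field; rewrite gt_eqF.
rewrite /ip; move: (itg _ _ _) => z; lra.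
Qed.

End OperatorBounds.

(** * Limits along an ultrafilter *)

Section UltraLimit.
Local Open Scope classical_set_scope.
Variable R : realType.
Implicit Types (F : nat -> R -> R) (g : R -> R) (G : set_system nat).

Lemma ultra_bounded_cvg (G : set_system nat) (u : nat -> R) (B : R) : UltraFilter G ->
  (forall n, `|u n| <= B) -> exists l : R, u n @[n --> G] --> l.
Proof.
move=> UG uB.
have uI : fmap u G `[- B, B].
  have : G setT by exact: filterT.
  by rewrite /fmap /=; apply: filterS => n _ /=; rewrite in_itv/= -ler_norml; exact: uB.
have [l [_ cl]] := @segment_compact R (- B) B (fmap u G) _ uI.
exists l => V Vl; rewrite /fmap /=.
have [//|nV] := in_ultra_setVsetC (u @^-1` V) UG.
by have [x [nVx Vx]] := cl (~` V) V nV Vl.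
Qed.

(* A weak form of the Arzela-Ascoli theorem, which avoids the extraction of a
   subsequence: the pointwise limit is taken along an ultrafilter. *)
Lemma ascoli_limit F (L B : R) : 0 <= L ->
  (forall n x, `|F n x| <= B) -> (forall n x y, `|F n x - F n y| <= L * `|x - y|) ->
  exists g, (forall x y, `|g x - g y| <= L * `|x - y|) /\
    forall (e : R) (N : nat) (x0 : R), 0 < e ->
      exists2 n, (N <= n)%N & `|F n x0 - g x0| <= e /\
        forall x, -1 <= x <= 1 -> `|F n x - g x| <= e.
Proof.
move=> L0 FB FL.
have [G [UG ooG]] := ultraFilterLemma (@eventually_filter).
have /choice[g Fg] : forall x, exists l : R, F n x @[n --> G] --> l.
  by move=> x; exact: ultra_bounded_cvg (fun n => FB n x).
have PG : ProperFilter G by exact: ultra_proper.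
have close e x : 0 < e -> \forall n \near G, `|g x - F n x| < e.
  by move=> e0; have /cvgrPdist_lt := Fg x; exact.
have gL x y : `|g x - g y| <= L * `|x - y|.
  apply/ler_addgt0Pr => e e0.
  have e2 : 0 < e / 2 by rewrite divr_gt0.
  have [n [h1 h2]] := filter_ex (filterI (close _ x e2) (close _ y e2)).
  have := FL n x y.
  rewrite (_ : g x - g y = (g x - F n x) + (F n x - F n y) - (g y - F n y)); last ring.
  move=> h3; apply: le_trans (ler_normB _ _) _.
  have := ler_normD (g x - F n x) (F n x - F n y); lra.
exists g; split=> // e N x0 e0.
(* Mesh of a finite grid on [-1, 1]: between grid points the Lipschitz bound costs at most e/3 for
   [F n] and for [g]. The summand 1 covers the case L = 0. *)
pose d := e / (3 * (L + 1)).
have d0 : 0 < d by rewrite divr_gt0// mulr_gt0// ltr_wpDl.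
pose K := (Num.truncn (2 / d)).+1.
have e3 : 0 < e / 3 by rewrite divr_gt0.
have near1 : \forall n \near G, forall k : 'I_K, `|g (-1 + k%:R * d) - F n (-1 + k%:R * d)| < e / 3.
  by apply: filter_forall => k; exact: close.
have near2 : \forall n \near G, (N <= n)%N by apply: ooG; exists N.
(* [x0] is handled apart because it may lie outside [-1, 1], where no uniform closeness is claimed;
   the eigenvalue equation is wanted on the whole line. *)
have [n [[n1 n2] n3]] := filter_ex (filterI (filterI near1 near2) (close _ x0 e0)).
exists n => //; split; first by rewrite distrC ltW.
move=> x /andP[x1 x2].
pose k := Num.truncn ((x + 1) / d).
have xd0 : 0 <= (x + 1) / d by apply: divr_ge0; [lra|exact: ltW].
have /andP[k1 k2] := truncn_itv xd0.
rewrite ler_pdivlMr// in k1; rewrite ltr_pdivrMr// in k2.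
have kK : (k < K)%N.
  rewrite ltnS; apply: le_truncn; rewrite ler_pM2r ?invr_gt0//; lra.
have /= Hk := n1 (Ordinal kK).
set y := -1 + k%:R * d in Hk.
have xy : `|x - y| <= d.
  by rewrite ler_norml /y; rewrite -natr1 mulrDl mul1r in k2; apply/andP; split; lra.
have Ld : L * `|x - y| <= e / 3.
  apply: (@le_trans _ _ ((L + 1) * d)); first by apply: ler_pM => //; lra.
  by rewrite /d le_eqVlt; apply/orP; left; apply/eqP; field; rewrite gt_eqF// ltr_wpDl.
have h1 := FL n x y; have h2 := gL y x; rewrite (distrC y) in h2.
rewrite (_ : F n x - g x = (F n x - F n y) - (g y - F n y) + (g y - g x)); last ring.
apply: le_trans (ler_normD _ _) _.
have := ler_normB (F n x - F n y) (g y - F n y); lra.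
Qed.

End UltraLimit.

(** * Eigenfunctions by successive maximization *)

Section Spectral.
Local Open Scope classical_set_scope.
Variable R : realType.
Local Notation lbm := (@locally_bounded_measurable R).
Implicit Types (f g h u : R -> R) (x y t : R).
Variable s : R.
Hypothesis s0 : 0 < s.
Let s0' := ltW s0.

Lemma ip_quad f u t : lbm f -> lbm u ->
  ip (fun x => f x + t * u x) (fun x => f x + t * u x) =
  ip f f + 2 * t * ip f u + t ^+ 2 * ip u u.
Proof.
move=> lf lu; have ltu := lbmZ t lu; have lftu := lbmD lf ltu.
rewrite ipDl// !ipDr// !ipZl// !ipZr// (ipC u f); ring.
Qed.

Lemma sinc_form_quad f u t : lbm f -> lbm u ->
  sinc_form s (fun x => f x + t * u x) (fun x => f x + t * u x) =
  sinc_form s f f + 2 * t * sinc_form s f u + t ^+ 2 * sinc_form s u u.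
Proof.
move=> lf lu; have ltu := lbmZ t lu; have lftu := lbmD lf ltu.
have lQf := lbm_sinc_op s0' lf; have lQu := lbm_sinc_op s0' lu.
have lQtu := lbmZ t lQu.
rewrite -(ip_sinc_op s0' lftu lftu) sinc_opD// sinc_opZ//.
rewrite ipDl// !ipDr// !ipZl// !ipZr// !ip_sinc_op// (sinc_formC s u f); ring.
Qed.

Section Maximizer.
Variables (j : nat) (psi : nat -> R -> R) (e : nat -> R).
Hypothesis psi_eigen : forall i, (i < j)%N ->
  lbm (psi i) /\ sinc_op s (psi i) = fun x => e i * psi i x.

Definition orth_psi f := lbm f /\ forall i, (i < j)%N -> ip f (psi i) = 0.

Lemma orth_psiD f g : orth_psi f -> orth_psi g -> orth_psi (fun x => f x + g x).
Proof.
move=> [lf of_] [lg og]; split; first exact: lbmD.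
by move=> i ij; rewrite ipDl ?of_ ?og ?addr0//; have [] := psi_eigen ij.
Qed.

Lemma orth_psiZ (k : R) f : orth_psi f -> orth_psi (fun x => k * f x).
Proof.
move=> [lf of_]; split; first exact: lbmZ.
by move=> i ij; rewrite ipZl ?of_ ?mulr0//; have [] := psi_eigen ij.
Qed.

Lemma orth_psi_op f : orth_psi f -> orth_psi (sinc_op s f).
Proof.
move=> [lf of_]; split; first exact: lbm_sinc_op.
move=> i ij; have [li Qi] := psi_eigen ij.
by rewrite ip_sinc_op_sym// Qi ipZr// of_// mulr0.
Qed.

(** With [<= 1] rather than an equality, the zero function makes the set nonempty without any
    knowledge of the orthogonal complement. *)
Let A : set R := [set r | exists f, [/\ orth_psi f, ip f f <= 1 & r = sinc_form s f f]].
Definition rayleigh_sup : R := sup A.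
Let m := rayleigh_sup.

Let orth0 : orth_psi (fun=> 0).
Proof.
split; first exact: lbm_cst.
by move=> i _; rewrite ip0l.
Qed.

Let A_has_sup : has_sup A.
Proof.
split.
  exists (sinc_form s (fun=> 0) (fun=> 0)); exists (fun=> 0); split=> //.
  by rewrite ip0l ler01.
exists 1 => r [f [[lf _] f1 ->]]; exact: le_trans (sinc_form_le s0' lf) f1.
Qed.

Lemma rayleigh_sup_ge0 : 0 <= m.
Proof.
have [[r Ar] _] := A_has_sup.
have := sup_upper_bound A_has_sup Ar; apply: le_trans.
by move: Ar => [f [_ _ ->]]; exact: sinc_form_ge0.
Qed.

Lemma rayleigh_le f : orth_psi f -> sinc_form s f f <= m * ip f f.
Proof.
move=> of_; have [lf _] := of_.
have [f0|f0] := eqVneq (ip f f) 0.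
  by rewrite f0 mulr0 -f0 sinc_form_le.
have fp : 0 < ip f f by rewrite lt0r f0 ip_ge0.
set r := Num.sqrt (ip f f).
have rE : r ^+ 2 = ip f f by rewrite sqr_sqrtr// ltW.
have rp : 0 < r by rewrite sqrtr_gt0.
have := sup_upper_bound A_has_sup; rewrite -/rayleigh_sup -/m.
move=> /(_ (sinc_form s (fun x => r^-1 * f x) (fun x => r^-1 * f x))) H.
have l1 := lbmZ r^-1 lf.
have E : sinc_form s (fun x => r^-1 * f x) (fun x => r^-1 * f x) = (ip f f)^-1 * sinc_form s f f.
  rewrite -ip_sinc_op// sinc_opZ// ipZl ?ipZr//; last exact: lbm_sinc_op.
    by rewrite ip_sinc_op// mulrA -rE expr2 invfM.
  exact: lbm_sinc_op.
rewrite E in H.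
rewrite mulrC -ler_pdivrMl//; apply: H.
exists (fun x => r^-1 * f x); split; [exact: orth_psiZ| |by rewrite E].
by rewrite ipZl// ipZr// mulrA -invfM -expr2 rE mulVf.
Qed.

(** Maximality is tested on f + u/m with u = Q f - m f. As <Q f, u> - m <f, u> = <u, u>, the linear
    term gains 2 <u, u>/m and the quadratic one costs at most <u, u>/m. Along a maximizing sequence
    the residual therefore tends to zero. *)
Lemma rayleigh_residual f : 0 < m -> orth_psi f -> ip f f <= 1 ->
  ip (fun x => sinc_op s f x - m * f x) (fun x => sinc_op s f x - m * f x)
  <= m * (m - sinc_form s f f).
Proof.
move=> m0 of_ f1; have [lf _] := of_.
have lQ := lbm_sinc_op s0' lf.
pose u x := sinc_op s f x + (- m) * f x.
rewrite (@eq_ip _ _ u _ u); last 2 first.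
- by move=> x _; rewrite /u mulNr.
- by move=> x _; rewrite /u mulNr.
have ou : orth_psi u by apply: orth_psiD; [exact: orth_psi_op|exact: orth_psiZ].
have [lu _] := ou.
have := rayleigh_le (orth_psiD of_ (orth_psiZ m^-1 ou)).
rewrite ip_quad// sinc_form_quad//.
have E : sinc_form s f u - m * ip f u = ip u u.
  by rewrite -ip_sinc_op// {4}/u ipDl// ?ipZl// ?mulNr//; exact: lbmZ.
have uu := sinc_form_ge0 s u.
have m2 : 0 <= m^-1 ^+ 2 * sinc_form s u u by rewrite mulr_ge0// sqr_ge0.
have mf : m * ip f f <= m by rewrite -[leRHS]mulr1 ler_wpM2l// ltW.
rewrite !mulrDr.
have -> : m * (m^-1 ^+ 2 * ip u u) = m^-1 * ip u u by field; rewrite gt_eqF.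
have -> : m * (2 * m^-1 * ip f u) = 2 * m^-1 * (m * ip f u) by ring.
have -> : m * ip f u = sinc_form s f u - ip u u by rewrite -E; ring.
rewrite mulrBr => H.
have {}H : m^-1 * ip u u <= m - sinc_form s f f by lra.
by rewrite -mulrDr -ler_pdivrMl.
Qed.

(** The maximizing sequence itself need not converge, but its images under Q are equi-Lipschitz and
    have a limit point [g], uniform on [-1, 1]. Since Q F_n and m F_n are close, [g] is an
    eigenfunction, normalized at the end. *)
Lemma rayleigh_attained : 0 < m ->
  exists g, [/\ orth_psi g, sinc_op s g = (fun x => m * g x) & ip g g = 1].
Proof.
move=> m0.
have /choice[F HF] : forall n : nat, exists f, [/\ orth_psi f, ip f f <= 1 &
    m - n.+1%:R^-1 < sinc_form s f f].
  move=> n; have n0 : 0 < n.+1%:R^-1 :> R by rewrite invr_gt0.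
  have [r [f [of_ f1 ->]] Hr] := sup_adherent n0 A_has_sup.
  by exists f; split.
have resid f := @rayleigh_residual f m0.
clearbody m.
have oF n : orth_psi (F n) by have [] := HF n.
have lF n : lbm (F n) by have [] := oF n.
have F1 n : ip (F n) (F n) <= 1 by have [] := HF n.
have HF3 n : m - n.+1%:R^-1 < sinc_form s (F n) (F n) by have [] := HF n.
have aF n : itg (-1) 1 (fun x => `|F n x|) <= 2.
  by rewrite -[leRHS]mulr1; apply: itg_norm_le_ip; rewrite ?expr1n.
have iF n := lbm_integrable (-1) 1 (lF n).
pose G n := sinc_op s (F n).
have lG n : lbm (G n) := lbm_sinc_op s0' (lF n).
have sp : 0 < s / pi by rewrite divr_gt0// pi_gt0.
have GB n x : `|G n x| <= s / pi * 2.
  by apply: le_trans (sinc_op_bound _ s0' (iF n)) _; rewrite ler_wpM2l// ltW.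
have L0 : 0 <= s ^+ 2 / pi * 2 by rewrite mulr_ge0// divr_ge0 ?sqr_ge0 ?pi_ge0.
have GL n x y : `|G n x - G n y| <= s ^+ 2 / pi * 2 * `|x - y|.
  apply: le_trans (sinc_op_lip _ _ s0' (iF n)) _.
  by rewrite mulrAC ler_wpM2r// ler_wpM2l// divr_ge0 ?sqr_ge0 ?pi_ge0.
have [g [gL gG]] := ascoli_limit L0 GB GL.
have cg : continuous g.
  move=> x; apply/cvgrPdist_lt => r r0.
  have L1 : 0 < s ^+ 2 / pi * 2 + 1 by rewrite ltr_wpDl.
  have d0 : 0 < (s ^+ 2 / pi * 2 + 1)^-1 * r by rewrite mulr_gt0// invr_gt0.
  have /cvgrPdist_lt/(_ _ d0) cx : y @[y --> x] --> x by exact: cvg_id.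
  near=> y; apply: le_lt_trans (gL x y) _.
  apply: (@le_lt_trans _ _ ((s ^+ 2 / pi * 2 + 1) * `|x - y|)).
    by rewrite ler_wpM2r//; lra.
  by rewrite -ltr_pdivlMl//; near: y; exact: cx.
have lg : lbm g := lbm_continuous cg.
have approx r x0 : 0 < r -> exists n, [/\ m / 2 <= sinc_form s (F n) (F n),
    ip (fun x => G n x - m * F n x) (fun x => G n x - m * F n x) <= r ^+ 2,
    `|G n x0 - g x0| <= r & forall x, -1 <= x <= 1 -> `|G n x - g x| <= r].
  move=> r0.
  pose N := (Num.truncn (m / r ^+ 2 + 2 / m)).+1.
  have HN : m / r ^+ 2 + 2 / m < N%:R by rewrite truncnS_gt.
  have mr0 : 0 <= m / r ^+ 2 by rewrite divr_ge0 ?sqr_ge0// ltW.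
  have m20 : 0 < 2 / m by rewrite divr_gt0.
  have [n Nn [g0 gx]] := gG r N x0 r0.
  have nN : N%:R <= n.+1%:R :> R by rewrite ler_nat; exact: leqW.
  have n1 : n.+1%:R^-1 <= m / 2.
    rewrite -[m / 2]invrK invf_div lef_pV2 ?posrE ?ltr0n//.
    by apply: le_trans nN; apply: le_trans (ltW HN); rewrite lerDr.
  have n2 : m * n.+1%:R^-1 <= r ^+ 2.
    rewrite ler_pdivrMr ?ltr0n// -ler_pdivrMl ?exprn_gt0// mulrC.
    by apply: le_trans nN; apply: le_trans (ltW HN); rewrite lerDl ltW.
  have n3 := HF3 n; clearbody N.
  exists n; split=> //.
    by move: n1 n3; move: (n.+1%:R^-1) => v n1 n3; lra.
  apply: le_trans (resid _ (oF n) (F1 n)) _.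
  apply: le_trans n2; apply: ler_wpM2l; first exact: ltW.
  by move: n3; move: (n.+1%:R^-1) => v n3; lra.
have Qg x0 : sinc_op s g x0 = m * g x0.
  apply/eqP; rewrite -subr_eq0 -normr_le0; apply/ler_addgt0Pr => r r0; rewrite add0r.
  (* Q g - m g is the sum of Q(g - G n), Q(G n - m F n) and m (G n - g); [C] adds up the constants
     of these three errors. *)
  pose C := s / pi * 2 + s / pi * 2 + m.
  have C0 : 0 < C by rewrite /C; lra.
  have rC : 0 < r / C by rewrite divr_gt0.
  have [n [_ n2 n3 n4]] := approx _ x0 rC.
  have lgG : lbm (fun x => g x - G n x) by exact: lbmB.
  have lGF : lbm (fun x => G n x - m * F n x) by apply: lbmB => //; exact: lbmZ.
  have h1 : `|sinc_op s (fun x => g x - G n x) x0| <= s / pi * (r / C * 2).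
    apply: le_trans (sinc_op_bound _ s0' (lbm_integrable (-1) 1 lgG)) _.
    rewrite ler_wpM2l ?(ltW sp)//.
    rewrite (_ : r / C * 2 = itg (-1) 1 (fun=> r / C)); last by rewrite itg_cst; lra.
    apply: le_itg; [|exact: lbm_cst|by move=> x /n4; rewrite distrC].
    have /lbmP[m1 m2] := lgG; apply/lbmP; split; first exact: measurableT_comp.
    by move=> a; have [M HM] := m2 a; exists M => x /HM; rewrite normr_id.
  have h2 : `|sinc_op s (fun x => G n x - m * F n x) x0| <= s / pi * (2 * (r / C)).
    apply: le_trans (sinc_op_bound _ s0' (lbm_integrable (-1) 1 lGF)) _.
    by rewrite ler_wpM2l ?(ltW sp)//; apply: itg_norm_le_ip.
  have E1 : sinc_op s (fun x => g x - G n x) x0 = sinc_op s g x0 - sinc_op s (G n) x0.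
    have := sinc_opD s0' lg (lbmZ (-1) (lG n)); rewrite sinc_opZ// => /(congr1 (@^~ x0)) /=.
    rewrite mulN1r => <-; congr (sinc_op s _ x0); apply/funext => x; by rewrite mulN1r.
  have E2 : sinc_op s (fun x => G n x - m * F n x) x0 = sinc_op s (G n) x0 - m * G n x0.
    have := sinc_opD s0' (lG n) (lbmZ (- m) (lF n)); rewrite sinc_opZ// => /(congr1 (@^~ x0)) /=.
    rewrite mulNr => <-; congr (sinc_op s _ x0); apply/funext => x; by rewrite mulNr.
  rewrite (_ : sinc_op s g x0 - m * g x0 = sinc_op s (fun x => g x - G n x) x0
    + sinc_op s (fun x => G n x - m * F n x) x0 + m * (G n x0 - g x0)); last by rewrite E1 E2; ring.
  have h3 : `|m * (G n x0 - g x0)| <= m * (r / C).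
    by rewrite normrM (gtr0_norm m0) ler_wpM2l// ltW.
  have rE : r = s / pi * (r / C * 2) + s / pi * (2 * (r / C)) + m * (r / C).
    rewrite [LHS](_ : r = C * (r / C)); last by rewrite mulrC divfK// gt_eqF.
    by rewrite {1}/C; ring.
  rewrite [leRHS]rE; apply: le_trans (ler_normD _ _) _; rewrite lerD//.
  by apply: le_trans (ler_normD _ _) _; rewrite lerD.
have og : orth_psi g.
  split=> // i ij; have [li _] := psi_eigen ij.
  apply/eqP; rewrite -normr_le0; apply/ler_addgt0Pr => r r0; rewrite add0r.
  have [B B0 HB] := lbm_bound11 li.
  have BB : 0 < 2 * (B + 1) by rewrite mulr_gt0// ltr_wpDl.
  have rB : 0 < r / (2 * (B + 1)) by rewrite divr_gt0.
  have [n [_ _ _ n4]] := approx _ 0 rB.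
  have [_ /(_ i ij) oGi] := orth_psi_op (oF n).
  have lgG : lbm (fun x => g x - G n x) by exact: lbmB.
  have -> : ip g (psi i) = itg (-1) 1 (fun x => (g x - G n x) * psi i x).
    rewrite -[LHS]subr0 -oGi /ip -itgB; [|exact: lbmM lg li|exact: lbmM (lG n) li].
    by apply: eq_itg => x _; rewrite mulrBl.
  have rE : r = r / (2 * (B + 1)) * (B + 1) * (1 - -1).
    by field; rewrite !gt_eqF// ltr_wpDl.
  rewrite [leRHS]rE; apply: itg_norm_le; [lra|exact: lbmM|].
  move=> x hx; rewrite normrM ler_pM//; first by rewrite distrC n4.
  by rewrite (le_trans (HB _ hx))//; lra.
(* The limit is not null: m/2 <= <G n, F n> <= <G n, G n>/m + (m/4) <F n, F n> forces <G n, G n> >=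
   m^2/4, which an error of m/8 in sup norm cannot destroy. *)
have gp : 0 < ip g g.
  have m8 : 0 < m / 8 by rewrite divr_gt0.
  have [n [n1 _ _ n4]] := approx _ 0 m8.
  have f1 := F1 n.
  have lGG : lbm (fun x => G n x * G n x) by exact: lbmM.
  have lFF : lbm (fun x => F n x * F n x) by exact: lbmM.
  have lgg : lbm (fun x => g x * g x) by exact: lbmM.
  have h1 : sinc_form s (F n) (F n) <= m^-1 * ip (G n) (G n) + m / 4 * ip (F n) (F n).
    rewrite -ip_sinc_op// /ip -!itgZ// -itgD; [|exact: lbmZ|exact: lbmZ].
    apply: le_itg; [exact: lbmM (lG n) (lF n)|by apply: lbmD; exact: lbmZ|].
    move=> x _; rewrite -subr_ge0 -/(G n).
    rewrite (_ : _ - _ = m^-1 * (G n x - m / 2 * F n x) ^+ 2); last by field; rewrite gt_eqF.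
    by rewrite mulr_ge0 ?sqr_ge0// invr_ge0 ltW.
  have h2 : ip (G n) (G n) <= 2 * ip g g + 2 * (m / 8) ^+ 2 * (1 - -1).
    rewrite /ip -itgZ// -itg_cst; last lra.
    rewrite -itgD; [|exact: lbmZ|exact: lbm_cst].
    apply: le_itg => //; first by apply: lbmD; [exact: lbmZ|exact: lbm_cst].
    move=> x /n4 hx; have : (G n x - g x) ^+ 2 <= (m / 8) ^+ 2.
      by rewrite -(real_normK (num_real (_ - _))) lerXn2r ?nnegrE// ltW.
    have := sqr_ge0 (G n x - 2 * g x); rewrite !expr2; lra.
  have h3 : m / 4 * ip (F n) (F n) <= m / 4 by rewrite ler_piMr//; lra.
  have h4 : m / 4 <= m^-1 * ip (G n) (G n) by lra.
  have h5 : m ^+ 2 / 4 <= ip (G n) (G n) by rewrite ler_pdivlMl// in h4; rewrite expr2; lra.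
  have m2 : 0 < m ^+ 2 by rewrite exprn_gt0.
  have := h2; rewrite expr_div_n; lra.
pose r := Num.sqrt (ip g g).
have rE : r ^+ 2 = ip g g by rewrite sqr_sqrtr// ltW.
have rp : 0 < r by rewrite sqrtr_gt0.
exists (fun x => r^-1 * g x); split.
- exact: orth_psiZ.
- rewrite sinc_opZ//; apply/funext => x; rewrite Qg; ring.
- rewrite ipZl ?ipZr//; last exact: lbmZ.
  by rewrite mulrA -invfM -expr2 rE mulVf// gt_eqF.
Unshelve. all: by end_near.
Qed.

End Maximizer.

(* When the supremum vanishes, the list is continued by null vectors: this way no
   injectivity of the operator is needed. *)
Definition spectral_list (n : nat) (e : nat -> R) (psi : nat -> R -> R) :=
  [/\ forall j, (j < n)%N -> lbm (psi j) /\ sinc_op s (psi j) = fun x => e j * psi j x,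
      forall j, (j < n)%N -> 0 <= e j /\ ip (psi j) (psi j) = (0 < e j)%R%:R,
      forall i j, (i < j < n)%N -> ip (psi j) (psi i) = 0 &
      forall j f, (j < n)%N -> orth_psi j psi f -> sinc_form s f f <= e j * ip f f].

Lemma spectral_list_exists n : exists e psi, spectral_list n e psi.
Proof.
elim: n => [|n [e [psi [H1 H2 H3 H4]]]]; first by exists (fun=> 0), (fun _ _ => 0); split=> // i j /andP[].
pose m := rayleigh_sup n psi.
have m0 : 0 <= m by exact: rayleigh_sup_ge0.
have [g [og Qg gg]] : exists g, [/\ orth_psi n psi g,
    sinc_op s g = (fun x => m * g x) & ip g g = (0 < m)%R%:R].
  have [mp|] := ltP 0 m; first exact: (rayleigh_attained H1).
  move=> mn; have -> : m = 0 by lra.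
  exists (fun=> 0); split; [|apply/funext => x|exact: ip0l].
    by split; [exact: lbm_cst|move=> i _; exact: ip0l].
  rewrite sinc_opE// mul0r (@eq_itg _ _ _ _ (fun=> 0)); last by move=> y _; rewrite mulr0.
  by rewrite itg_cst ?mul0r//; lra.
pose e' j := if (j < n)%N then e j else m.
pose psi' j := if (j < n)%N then psi j else g.
have ole j f : (j <= n)%N -> orth_psi j psi' f -> orth_psi j psi f.
  move=> jn [lf of_]; split=> // i ij; have := of_ i ij.
  by rewrite /psi' (leq_trans ij jn).
exists e', psi'; split.
- move=> j; rewrite ltnS leq_eqVlt /e' /psi' => /predU1P[->|jn].
    by rewrite ltnn; split=> //; have [] := og.
  by rewrite jn; exact: H1.
- move=> j; rewrite ltnS leq_eqVlt /e' /psi' => /predU1P[->|jn]; first by rewrite ltnn.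
  by rewrite jn; exact: H2.
- move=> i j /andP[ij]; rewrite ltnS leq_eqVlt /psi' => /predU1P[jn|jn].
    by rewrite jn ltnn -{1}jn ij; have [_] := og; apply; rewrite -jn.
  by rewrite jn (ltn_trans ij jn); apply: H3; rewrite ij.
- move=> j f; rewrite ltnS leq_eqVlt /e' => /predU1P[->|jn] of_.
    by rewrite ltnn; apply: (rayleigh_le H1); exact: ole (leqnn n) of_.
  by rewrite jn; apply: H4 => //; exact: ole (ltnW jn) of_.
Qed.

End Spectral.

(** * The eigenvalues of the statement *)

Section Eigenvalues.
Local Open Scope classical_set_scope.
Variable R : realType.
Local Notation mu := (@lebesgue_measure R).
Local Notation m11 := (@lebesgue_m11 R).
Local Notation lbm := (@locally_bounded_measurable R).
Local Notation I11 := (`[(-1 : R), 1] : set (measurableTypeR R)).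
Implicit Types (f g h u : R -> R) (x y t : R).

Let mI : measurable I11. Proof. exact: measurable_itv. Qed.

Lemma lebesgue_m11E (A : set R) : m11 A = mu (A `&` I11). Proof. by []. Qed.

Lemma integral_m11 (f : R -> \bar R) :
  (\int[m11]_(x in I11) f x = \int[mu]_(x in I11) f x)%E.
Proof. by apply: eq_measure_integral => A mA AI; rewrite lebesgue_m11E setIidl. Qed.

Lemma ae_m11 (P : R -> Prop) :
  (\forall x \ae m11, P x) <-> (\forall x \ae mu, I11 x -> P x).
Proof.
split=> -[N [mN N0 PN]].
  exists (N `&` I11); split; [exact: measurableI|exact: N0|].
  by move=> x /= /not_implyP[Ix nP]; split=> //; exact: PN.
exists (N `|` ~` I11); split.
- by apply: measurableU => //; exact: measurableC.
- rewrite lebesgue_m11E setIUl setICl setU0.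
  by apply: (subset_measure0 _ mN _ N0) => //; exact: measurableI.
- move=> x /= nP; have [Ix|] := pselect (I11 x); last by right.
  by left; apply: PN => /= /(_ Ix).
Qed.

Lemma ae_imp2 (P Q S : R -> Prop) : (forall x, P x -> Q x -> S x) ->
  {ae mu, forall x, P x} -> {ae mu, forall x, Q x} -> {ae mu, forall x, S x}.
Proof.
move=> PQS hP hQ; apply: negligibleS (negligibleU hP hQ) => x /= nS.
by have [Px|nP] := pselect (P x); [right => Qx; apply: nS; exact: PQS|left].
Qed.

Lemma lebesgue_m11_fin : m11 setT \is a fin_num.
Proof.
rewrite lebesgue_m11E setTI; apply: fin_real.
rewrite (lt_le_trans _ (measure_ge0 _ _))//=.
by rewrite [ltLHS]lebesgue_measure_itv/=; case: ifP => // _; rewrite -EFinB ltry.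
Qed.

Lemma Lfun_m11_integrable f : f \in Lfun m11 2%:E -> mu.-integrable I11 (EFin \o f).
Proof.
move=> /(Lfun_subset12 lebesgue_m11_fin)/Lfun1_integrable/(integrableS measurableT mI (@subsetT _ _)).
move=> /integrableP[mf fi]; apply/integrableP; split=> //.
by rewrite -integral_m11.
Qed.

Lemma Lfun_m11_bounded f (M : R) : measurable_fun [set: R] f -> (forall x, `|f x| <= M) ->
  f \in Lfun m11 2%:E.
Proof.
move=> mf fM; rewrite inE/=; apply/andP; split; rewrite inE//=.
rewrite /finite_norm unlock poweR_lty//.
have mf2 : measurable_fun [set: measurableTypeR R] (fun x => `|f x| `^ 2).
  apply: (measurableT_comp (measurable_powR _)) => //.
  exact: measurableT_comp.
have /integrable_lty : m11.-integrable setT (EFin \o (fun x => `|f x| `^ 2)).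
  apply: measurable_bounded_integrable => //.
    by move: lebesgue_m11_fin; rewrite ge0_fin_numE.
  exists (M ^+ 2); split; first exact: num_real.
  move=> N MN x _; apply: le_trans (ltW MN).
  by rewrite powR_mulrn// normrX normr_id lerXn2r// nnegrE// (le_trans _ (fM x)).
by apply.
Qed.

Lemma ip_eq0_ae f : lbm f -> ip f f = 0 -> {ae mu, forall x, I11 x -> f x = 0}.
Proof.
move=> lf; have lff : lbm (fun x => f x * f x) by exact: lbmM.
rewrite /ip itgE => ff0.
have := lbm_integrable (-1) 1 lff => ffi.
pose F := EFin \o (fun x => f x * f x).
have mff : measurable_fun I11 F := measurable_int _ ffi.
have /(ae_eq_integral_abs mu mI mff) : (\int[mu]_(x in I11) `|F x| = 0)%E.
  transitivity (\int[mu]_(x in I11) F x)%E.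
    by apply: eq_integral => x _; rewrite gee0_abs// /F/= lee_fin -expr2 sqr_ge0.
  rewrite -[LHS]fineK; last exact: integrable_fin_num.
  by congr EFin.
apply: filterS => x H Ix; have /= := H Ix => -[] /eqP.
by rewrite mulf_eq0 orbb => /eqP.
Qed.

Variable s : R.
Hypothesis s0 : 0 < s.
Let s0' := ltW s0.

Lemma lbm_sinc_op_integrable f : mu.-integrable I11 (EFin \o f) -> lbm (sinc_op s f).
Proof.
move=> fi; apply: lbm_continuous => x.
set L := s ^+ 2 / pi * itg (-1) 1 (fun y => `|f y|).
have L0 : 0 <= L.
  rewrite mulr_ge0//; first by rewrite divr_ge0 ?sqr_ge0 ?pi_ge0.
  by apply: itg_ge0 => y _.
apply/cvgrPdist_lt => r r0.
have L1 : 0 < L + 1 by rewrite ltr_wpDl.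
have d0 : 0 < (L + 1)^-1 * r by rewrite mulr_gt0// invr_gt0.
have /cvgrPdist_lt/(_ _ d0) cx : y @[y --> x] --> x by exact: cvg_id.
near=> y; apply: le_lt_trans (sinc_op_lip x y s0' fi) _.
rewrite mulrAC -/L.
apply: (@le_lt_trans _ _ ((L + 1) * `|x - y|)).
  by rewrite ler_wpM2r//; lra.
by rewrite -ltr_pdivlMl//; near: y; exact: cx.
Unshelve. all: by end_near.
Qed.

Lemma sinc_op_ae f g : mu.-integrable I11 (EFin \o f) -> lbm g ->
  {ae mu, forall x, I11 x -> f x = g x} -> sinc_op s f = sinc_op s g.
Proof.
move=> fi lg fg; apply/funext => x; rewrite !sinc_opE// !itgE; congr fine.
have gi := lbm_integrable (-1) 1 lg.
have b := fun y (_ : -1 <= y <= 1) => sinc_fun_bound (y - x) s0'.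
apply: ae_eq_integral => //.
- exact: measurable_int (integrable_mul11 (lbm_kernel s x) b fi).
- exact: measurable_int (integrable_mul11 (lbm_kernel s x) b gi).
by apply: (ae_imp2 _ fg fg) => y H _ Iy; rewrite H.
Qed.

(** An eigenfunction is given as an arbitrary L^2 representative. For nonzero [l] it is replaced by
    l^-1 Q f, continuous and almost everywhere equal to it on [-1, 1], to which 0 <= Q <= Id
    applies. *)
Lemma sinc_eigenvalue_bounds l : is_sinc_eigenvalue s l -> 0 <= l <= 1.
Proof.
move=> [f [f2 fn0 Qf]].
have fi := Lfun_m11_integrable f2.
have [->|l0] := eqVneq l 0; first by rewrite lexx ler01.
have lQ := lbm_sinc_op_integrable fi.
pose g x := l^-1 * sinc_op s f x.
have lg : lbm g by exact: lbmZ.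
have fg : {ae mu, forall x, I11 x -> f x = g x}.
  have /ae_m11 := Qf; apply: filterS => x H Ix.
  by rewrite /g (H Ix I) mulKf.
have Qg : sinc_op s g = fun x => l * g x.
  by rewrite -(sinc_op_ae fi lg fg); apply/funext => x; rewrite /g mulVKf.
have gp : 0 < ip g g.
  rewrite lt0r ip_ge0 andbT; apply/negP => /eqP g0; apply: fn0.
  apply/ae_m11; apply: ae_imp2 fg (ip_eq0_ae lg g0) => x H1 H2 Ix _.
  by rewrite (H1 Ix) (H2 Ix).
have E : l * ip g g = sinc_form s g g by rewrite -ip_sinc_op// Qg ipZl.
apply/andP; split.
  by rewrite -(pmulr_lge0 _ gp) E sinc_form_ge0.
by rewrite -(ler_pM2r gp) E mul1r sinc_form_le.
Qed.

(** Membership in L^2 is obtained from a bound valid on the whole line, which the equation f = l^-1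
    Q f provides. *)
Lemma eigenfun_is_eigenvalue l f : l != 0 -> eigenfun s l f -> ip f f != 0 ->
  is_sinc_eigenvalue s l.
Proof.
move=> l0 [lf Qf] f0; exists f; split.
- have fi := lbm_integrable (-1) 1 lf.
  apply: (@Lfun_m11_bounded _ (`|l|^-1 * (s / pi * itg (-1) 1 (fun y => `|f y|)))).
    exact: lbm_measurable.
  move=> x; rewrite ler_pdivlMl ?normr_gt0// -normrM.
  by have := sinc_op_bound x s0' fi; rewrite Qf.
- move=> /ae_m11 fae; move/negP: f0; apply; apply/eqP.
  rewrite /ip itgE /Rintegral.
  have lff : lbm (fun x => f x * f x) by exact: lbmM.
  rewrite (@ae_eq_integral _ _ _ mu I11 (cst 0%E)) ?integral0//.
    exact: measurable_int (lbm_integrable (-1) 1 lff).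
  by apply: (ae_imp2 _ fae fae) => x H _ Ix; rewrite /= (H Ix I)/= mul0r.
- by rewrite Qf; apply: aeW => x.
Qed.

(** The supremum of the empty set is 0, so these bounds presuppose no existence of eigenvalues. *)
Let sup01 (A : set R) : (forall l, A l -> is_sinc_eigenvalue s l) -> 0 <= sup A <= 1.
Proof.
move=> HA; have [[l Al]|A0] := pselect (A !=set0); last first.
  suff -> : A = set0 by rewrite sup0 lexx ler01.
  by apply/seteqP; split=> // x Ax; apply: A0; exists x.
have ubA : ubound A 1 by move=> x /HA/sinc_eigenvalue_bounds/andP[].
apply/andP; split; last by apply: ge_sup => //; exists l.
have /andP[l0 _] := sinc_eigenvalue_bounds (HA _ Al).
by apply: le_trans l0 _; apply: ub_le_sup => //; exists 1.
Qed.

Lemma sinc_eigenvalue01 n : 0 <= sinc_eigenvalue s n <= 1.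
Proof. by case: n => [|n] /=; apply: sup01 => // l []. Qed.

(** By induction: a positive e_{j+1} is an eigenvalue, strictly below e_j by simplicity, hence
    strictly below the j-th eigenvalue of the statement, so it competes in the supremum defining the
    next one. If e_{j+1} = 0, nonnegativity suffices. *)
Lemma sinc_eigenvalue_ge n e psi : spectral_list s n e psi ->
  forall j, (j < n)%N -> e j <= sinc_eigenvalue s j.
Proof.
move=> [H1 H2 H3 H4].
have eig j : (j < n)%N -> 0 < e j -> is_sinc_eigenvalue s (e j).
  move=> jn ej; have [_] := H2 j jn; rewrite ej => pj.
  apply: (@eigenfun_is_eigenvalue _ (psi j)); [exact: lt0r_neq0|exact: H1|].
  by rewrite pj oner_neq0.
have ub A : (forall l, A l -> is_sinc_eigenvalue s l) -> has_ubound A.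
  by move=> HA; exists 1 => x /HA/sinc_eigenvalue_bounds/andP[].
elim=> [|j IH] jn.
  have [e0 _] := H2 0%N jn; move: e0; rewrite le_eqVlt => /predU1P[<-|e0].
    by have /andP[] := sinc_eigenvalue01 0.
  by apply: ub_le_sup; [exact: ub|exact: eig].
have jn' := ltnW jn.
have [e0 p1] := H2 j.+1 jn; move: e0; rewrite le_eqVlt => /predU1P[<-|e0].
  by have /andP[] := sinc_eigenvalue01 j.+1.
rewrite e0 in p1.
have [lj1 Qj1] := H1 _ jn; have [lj Qj] := H1 _ jn'.
have ejj : e j.+1 <= e j.
  have := H4 j (psi j.+1) jn'; rewrite -ip_sinc_op// Qj1 ipZl// p1 !mulr1; apply.
  by split=> // i ij; apply: H3; rewrite jn (ltn_trans ij).
have ej : 0 < e j by exact: lt_le_trans ejj.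
have pj : ip (psi j) (psi j) = 1 by have [_] := H2 j jn'; rewrite ej.
have ne : e j.+1 != e j.
  apply/eqP => E; have Ej1 : eigenfun s (e j) (psi j.+1) by split=> //; rewrite Qj1 E.
  have j0 : ip (psi j) (psi j.+1) = 0 by rewrite ipC; apply: H3; rewrite jn ltnSn.
  have := eigenvalue_simple s0 ej (H1 _ jn') Ej1 j0; rewrite p1 pj => /(_ (oner_neq0 _))/eqP.
  by rewrite oner_eq0.
rewrite /=; apply: ub_le_sup; first by apply: ub => l [].
split; first exact: eig.
by apply: lt_le_trans (IH jn'); rewrite lt_neqAle ne.
Qed.

Lemma fredholm_det_le N : fredholm_det s <= \prod_(n < N) (1 - sinc_eigenvalue s n).
Proof.
rewrite /fredholm_det; set u := fun N : nat => _.
have f01 n : 0 <= 1 - sinc_eigenvalue s n <= 1.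
  by have /andP[a b] := sinc_eigenvalue01 n; apply/andP; split; lra.
have u0 n : 0 <= u n by apply: prodr_ge0 => i _; have /andP[] := f01 i.
have ud : nonincreasing_seq u.
  apply/nonincreasing_seqP => n; rewrite /u big_ord_recr /=.
  by have /andP[a b] := f01 n; exact: ler_piMr (u0 n) b.
have cu : cvgn u by apply: nonincreasing_is_cvgn => //; exists 0 => _ [n _ <-].
exact: (nonincreasing_cvgn_ge ud cu).
Qed.

End Eigenvalues.

(** * Determinants of positive semidefinite matrices *)

Section PositiveSemidefinite.
Variable R : realFieldType.
Implicit Types n : nat.

Definition psd n (A : 'M[R]_n) := A^T = A /\ forall x : 'rV[R]_n, 0 <= (x *m A *m x^T) 0 0.

Lemma psdD n (A B : 'M[R]_n) : psd A -> psd B -> psd (A + B).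
Proof.
move=> [sA pA] [sB pB]; split; first by rewrite linearD /= sA sB.
by move=> x; rewrite mulmxDr mulmxDl mxE addr_ge0.
Qed.

Lemma psdZ n (k : R) (A : 'M[R]_n) : 0 <= k -> psd A -> psd (k *: A).
Proof.
move=> k0 [sA pA]; split; first by rewrite linearZ /= sA.
by move=> x; rewrite -scalemxAr -scalemxAl mxE mulr_ge0.
Qed.

Lemma psd_outer n (v : 'rV[R]_n) : psd (v^T *m v).
Proof.
split; first by rewrite trmx_mul trmxK.
move=> x; rewrite mulmxA -mulmxA (_ : v *m x^T = (x *m v^T)^T); last by rewrite trmx_mul trmxK.
by rewrite mxE big_ord1 [_^T _ _]mxE -expr2 sqr_ge0.
Qed.

Lemma psd0 n : psd (0 : 'M[R]_n).
Proof. by split; [rewrite linear0|move=> x; rewrite mulmx0 mul0mx mxE]. Qed.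

Lemma psd_sum n (I : Type) (r : seq I) (P : pred I) (F : I -> 'M[R]_n) :
  (forall i, P i -> psd (F i)) -> psd (\sum_(i <- r | P i) F i).
Proof.
by move=> HF; apply: (big_ind (fun A => psd A)) => //; [exact: psd0|exact: psdD].
Qed.

Lemma delta_form n (A : 'M[R]_n) i : (delta_mx 0 i *m A *m (delta_mx 0 i)^T) (0 : 'I_1) (0 : 'I_1) = A i i.
Proof. by rewrite -rowE trmx_delta -colE !mxE. Qed.

Lemma delta_dot n (v : 'rV[R]_n) i : (v *m (delta_mx 0 i)^T) 0 (0 : 'I_1) = v 0 i.
Proof. by rewrite trmx_delta -colE !mxE. Qed.

Lemma psd_diag_ge0 n (A : 'M[R]_n) i : psd A -> 0 <= A i i.
Proof.
by move=> [_ /(_ (delta_mx 0 i))]; rewrite delta_form.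
Qed.

Lemma psd_block n (a : R) (v : 'rV[R]_n) (H : 'M[R]_n) (t : R) (y : 'rV[R]_n) :
  psd (block_mx a%:M v v^T H : 'M[R]_(1 + n)) ->
  0 <= t ^+ 2 * a + 2 * t * (v *m y^T) 0 0 + (y *m H *m y^T) 0 0.
Proof.
move=> [_ /(_ (row_mx t%:M y))].
rewrite mul_row_block tr_row_mx mul_row_col tr_scalar_mx.
rewrite !mulmxDl -!scalar_mxM !mul_scalar_mx.
rewrite (_ : y *m v^T = (v *m y^T)^T); last by rewrite trmx_mul trmxK.
rewrite !mul_mx_scalar -scalemxAl !mxE eqxx mulr1n.
set z := \sum_(j < n) _; set w := \sum_(j < n) _.
by congr (0 <= _); ring.
Qed.

Lemma det_schur n (a : R) (v : 'rV[R]_n) (u : 'cV[R]_n) (H : 'M[R]_n) : a != 0 ->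
  \det (block_mx a%:M v u H : 'M[R]_(1 + n)) = a * \det (H - a^-1 *: (u *m v)).
Proof.
move=> a0.
have -> : (block_mx a%:M v u H : 'M[R]_(1 + n)) =
    block_mx 1%:M 0 (a^-1 *: u) 1%:M *m block_mx a%:M v 0 (H - a^-1 *: (u *m v)).
  rewrite mulmx_block !mul1mx !mul0mx !addr0 mul_mx_scalar scalerA mulfV// scale1r.
  by rewrite -scalemxAl addrC subrK.
by rewrite det_mulmx det_lblock !det1 !mul1r det_ublock det_scalar1.
Qed.

(** Hadamard's inequality by induction: the Schur complement of the first entry is again positive
    semidefinite, and its diagonal entries are at most those of the lower block. *)
Lemma psd_det n (A : 'M[R]_n) : psd A -> 0 <= \det A <= \prod_i A i i.
Proof.
elim: n A => [|n IH] A pA; first by rewrite det_mx00 big_ord0 ler01 lexx.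
have [sA _] := pA.
pose B : 'M[R]_(1 + n) := A; pose a : R := ulsubmx B 0 0; pose v := ursubmx B; pose H := drsubmx B.
have EB : B = block_mx a%:M v v^T H.
  rewrite -[LHS]submxK; congr block_mx; last by rewrite /v trmx_ursub sA.
  by apply/matrixP => i j; rewrite !ord1 [RHS]mxE eqxx.
have pB : psd (block_mx a%:M v v^T H : 'M[R]_(1 + n)) by rewrite -EB.
have sH : H^T = H by rewrite /H trmx_drsub sA.
have Eprod : \prod_i A i i = a * \prod_i H i i.
  have -> : \prod_(i < n.+1) A i i = \prod_(i < 1 + n) B i i by [].
  rewrite big_split_ord big_ord1 EB block_mxEul mxE eqxx; congr (_ * _).
  by apply: eq_bigr => i _; rewrite block_mxEdr.
have a0 : 0 <= a.
  by have := psd_block 1 0 pB; rewrite linear0 !mulmx0 !mxE expr1n mulr0 mul1r !addr0.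
have H0 i : 0 <= H i i.
  have := psd_block 0 (delta_mx 0 i) pB.
  by rewrite expr0n/= !mulr0 !mul0r !add0r delta_form.
have -> : \det A = \det (block_mx a%:M v v^T H : 'M[R]_(1 + n)) by rewrite -EB.
move: a0; rewrite le_eqVlt => /predU1P[a0|a0].
  have v0 : v = 0.
    apply/rowP => i; rewrite [RHS]mxE; apply/eqP/negPn/negP => vi.
    (* With a = 0 the form is affine in [t]; this value would make it equal to -1. *)
    pose t := - (H i i + 1) / (2 * v 0 i).
    have := psd_block t (delta_mx 0 i) pB.
    rewrite -a0 mulr0 add0r delta_form delta_dot.
    rewrite (_ : 2 * t * v 0 i = - (H i i + 1)); first lra.
    by rewrite /t; field.
  rewrite Eprod -a0 !mul0r v0 det_lblock det_scalar1.
  by rewrite mul0r lexx.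
rewrite Eprod det_schur ?gt_eqF//.
set S := H - _.
have pS : psd S.
  split; first by rewrite /S linearB linearZ /= trmx_mul trmxK sH.
  (* This first coordinate minimizes the form, and the minimum is the form of the Schur complement
     at [y]. *)
  move=> y; have := psd_block (- (a^-1 * (v *m y^T) 0 0)) y pB.
  have mx1B (P Q : 'M[R]_1) : (P - a^-1 *: Q) 0 0 = P 0 0 - a^-1 * Q 0 0 by rewrite !mxE.
  rewrite /S mulmxBr mulmxBl -scalemxAr -scalemxAl mx1B.
  have -> : (y *m (v^T *m v) *m y^T) 0 0 = ((v *m y^T) 0 0) ^+ 2.
    rewrite mulmxA -mulmxA (_ : y *m v^T = (v *m y^T)^T); last by rewrite trmx_mul trmxK.
    by rewrite mxE big_ord1 mxE expr2.
  set z := (v *m y^T) 0 0; set w := (y *m H *m y^T) 0 0.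
  by move=> hz; apply: le_trans hz _; rewrite le_eqVlt; apply/orP; left; apply/eqP; field; rewrite gt_eqF.
have /andP[S0 SP] := IH _ pS.
rewrite mulr_ge0 ?(ltW a0)//= ler_pM2l//.
apply: le_trans SP _; apply: ler_prod => i _.
rewrite (psd_diag_ge0 _ pS) /S !mxE big_ord1 !mxE.
by rewrite gerBl mulr_ge0 ?invr_ge0 ?(ltW a0)// -expr2 sqr_ge0.
Qed.

(** det(G - k v^T v) is the determinant of [G] bordered by the row (1, k v) and the column (1, v^T),
    hence affine in k. Its value at t c interpolates between those at 0 and c, the latter being
    nonnegative. *)
Lemma det_rank1_ge n (G : 'M[R]_n) (v : 'rV[R]_n) (c t : R) :
  psd (G - c *: (v^T *m v)) -> 0 <= t <= 1 ->
  (1 - t) * \det G <= \det (G - (t * c) *: (v^T *m v)).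
Proof.
move=> /psd_det/andP[D0 _] /andP[t0 t1].
have lin2 (b1 b2 : R) (X Y : 'rV[R]_(1 + n)) j : (b1 *: X + b2 *: Y) 0 j = b1 * X 0 j + b2 * Y 0 j.
  by rewrite !mxE.
have rowij (A : 'M[R]_(1 + n)) (i j : 'I_(1 + n)) : row i A 0 j = A i j by rewrite mxE.
have row'ij (A : 'M[R]_(1 + n)) (i : 'I_(1 + n)) (k : 'I_n) (j : 'I_(1 + n)) :
  (row' i A : 'M[R]_(n, 1 + n)) k j = A (lift i k) j.
  by rewrite mxE.
pose M (k : R) : 'M[R]_(1 + n) := block_mx 1%:M (k *: v) v^T G.
have detM k : \det (M k) = \det (G - k *: (v^T *m v)).
  by rewrite /M det_schur ?oner_neq0// mul1r invr1 scale1r -scalemxAr.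
have -> : \det (G - (t * c) *: (v^T *m v)) = (1 - t) * \det G + t * \det (G - c *: (v^T *m v)).
  rewrite -!detM.
  have -> : \det G = \det (M 0) by rewrite detM scale0r subr0.
  apply: (@determinant_multilinear _ _ _ _ _ (lshift n 0)).
  - apply/rowP => j; rewrite lin2 !rowij.
    case: (split_ordP j) => k ->.
      by rewrite !block_mxEul !mxE; ring.
    by rewrite !block_mxEur !mxE; ring.
  - apply/matrixP => i j; rewrite !row'ij.
    have [k ->] : exists k, lift (lshift n (0 : 'I_1)) i = rshift 1 k.
      by exists i; apply/val_inj.
    by case: (split_ordP j) => l ->; rewrite ?block_mxEdl ?block_mxEdr.
  - apply/matrixP => i j; rewrite !row'ij.
    have [k ->] : exists k, lift (lshift n (0 : 'I_1)) i = rshift 1 k.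
      by exists i; apply/val_inj.
    by case: (split_ordP j) => l ->; rewrite ?block_mxEdl ?block_mxEdr.
by rewrite lerDl mulr_ge0.
Qed.

(** The rank one terms are removed one at a time. At each stage the full multiple m of [V K] could
    be subtracted without losing semidefiniteness, so removing the fraction 1 - d_K/m of it costs at
    most a factor d_K/m. *)
Lemma det_downdate n (G : 'M[R]_n) (N : nat) (v : nat -> 'rV[R]_n) (d : nat -> R) (m : R) :
  psd (G - \sum_(k < N) (v k)^T *m v k) -> 0 < m -> (forall k, (k < N)%N -> 0 <= d k <= m) ->
  psd (m *: G - \sum_(k < N) (m - d k) *: ((v k)^T *m v k)) /\
  (\prod_(k < N) (d k / m)) * \det (m *: G) <=
    \det (m *: G - \sum_(k < N) (m - d k) *: ((v k)^T *m v k)).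
Proof.
move=> pG m0 dm.
have m0' := ltW m0.
pose V k := (v k)^T *m v k.
have pV k : psd (V k) by exact: psd_outer.
have pGK K : (K <= N)%N -> psd (G - \sum_(0 <= k < K) V k).
  move=> KN; have -> : G - \sum_(0 <= k < K) V k =
      (G - \sum_(k < N) V k) + \sum_(K <= k < N) V k.
    by rewrite -(big_mkord xpredT V) (big_cat_nat _ KN)//= opprD addrA subrK.
  by apply: psdD => //; apply: psd_sum.
pose D K := m *: G - \sum_(0 <= k < K) (m - d k) *: V k.
have DE K : D K = m *: (G - \sum_(0 <= k < K) V k) + \sum_(0 <= k < K) d k *: V k.
  rewrite /D scalerBr scaler_sumr -addrA; congr (_ + _).
  rewrite -sumrN -sumrN -big_split; apply: eq_bigr => k _.
  by rewrite scalerBl opprB addrC.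
have pd K : (K <= N)%N -> psd (\sum_(0 <= k < K) d k *: V k).
  move=> KN; rewrite big_mkord; apply: psd_sum => k _; apply: psdZ => //.
  by have /andP[] := dm k (leq_trans (ltn_ord k) KN).
have DN : D N = m *: G - \sum_(k < N) (m - d k) *: V k by rewrite /D big_mkord.
rewrite -DN; split; first by rewrite DE; apply: psdD; [apply: psdZ => //; exact: pGK|exact: pd].
have detD K : (K <= N)%N -> (\prod_(k < K) (d k / m)) * \det (m *: G) <= \det (D K).
  elim: K => [_|K IH KN]; first by rewrite /D big_geq// subr0 big_ord0 mul1r.
  have /andP[d0 d1] := dm K KN.
  have -> : D K.+1 = D K - ((1 - d K / m) * m) *: V K.
    rewrite /D big_nat_recr//= opprD addrA; congr (_ - _ *: _).
    by field; rewrite gt_eqF.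
  have pK : psd (D K - m *: V K).
    have -> : D K - m *: V K = m *: (G - \sum_(0 <= k < K.+1) V k) + \sum_(0 <= k < K) d k *: V k.
      by rewrite DE big_nat_recr//= opprD addrA [in RHS]scalerBr addrAC.
    by apply: psdD; [apply: psdZ => //; exact: pGK|apply: pd; exact: ltnW].
  apply: le_trans (det_rank1_ge pK _); last first.
    rewrite subr_ge0 ler_pdivrMr// mul1r d1 /= gerBl.
    by rewrite divr_ge0.
  rewrite big_ord_recr /= subKr mulrAC [leLHS]mulrC.
  by apply: ler_wpM2l; [exact: divr_ge0|exact: IH (ltnW KN)].
exact: detD.
Qed.

End PositiveSemidefinite.

(** * Gram determinants against products of eigenvalues of Id - Q *)

Section GramDeterminant.
Variable R : realType.
Local Notation lbm := (@locally_bounded_measurable R).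
Implicit Types (f g h u : R -> R) (x y t : R).
Variable s : R.
Hypothesis s0 : 0 < s.
Let s0' := ltW s0.

Lemma lbm_bigsum (I : Type) (r : seq I) (F : I -> R -> R) :
  (forall i, lbm (F i)) -> lbm (fun x => \sum_(i <- r) F i x).
Proof.
move=> hF; elim: r => [|i r IH].
  by under eq_fun do rewrite big_nil; exact: lbm_cst.
by under eq_fun do rewrite big_cons; exact: lbmD.
Qed.

Lemma ip_bigsuml (I : Type) (r : seq I) (F : I -> R -> R) h :
  (forall i, lbm (F i)) -> lbm h ->
  ip (fun x => \sum_(i <- r) F i x) h = \sum_(i <- r) ip (F i) h.
Proof.
move=> hF lh; elim: r => [|i r IH].
  by rewrite big_nil; under eq_fun do rewrite big_nil; exact: ip0l.
rewrite big_cons -IH -ipDl//; last exact: lbm_bigsum.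
by congr (ip _ h); apply/funext => x; rewrite big_cons.
Qed.

(** Otherwise the square norm of f + t u would be a nonconstant affine function of t, and take
    negative values. *)
Lemma ip_null f u : lbm f -> lbm u -> ip u u = 0 -> ip f u = 0.
Proof.
move=> lf lu u0; apply/eqP/negPn/negP => fu.
have := ip_ge0 (fun x => f x + (- (ip f f + 1) / (2 * ip f u)) * u x).
rewrite ip_quad// u0 mulr0 addr0.
rewrite (_ : 2 * _ * _ = - (ip f f + 1)); first lra.
by field.
Qed.

Section Bound.
Variables (N : nat) (e : nat -> R) (psi : nat -> R -> R).
Hypothesis sl : spectral_list s N e psi.

Lemma spectral_list_le1 k : (k < N)%N -> 0 <= e k <= 1.
Proof.
have [H1 H2 H3 H4] := sl => kN; have [e0 p] := H2 k kN; rewrite e0 /=.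
move: e0; rewrite le_eqVlt => /predU1P[<-|e0]; first exact: ler01.
have [lk Qk] := H1 k kN.
have := sinc_form_le s0' lk; rewrite -ip_sinc_op// Qk ipZl// p e0 mulr1n mulr1.
by [].
Qed.

Lemma spectral_list_mono j k : (j <= k < N)%N -> e k <= e j.
Proof.
have [H1 H2 H3 H4] := sl => /andP[jk kN].
move: jk; rewrite leq_eqVlt => /predU1P[->//|jk].
have jN := ltn_trans jk kN.
have [e0 p] := H2 k kN; have [ej0 _] := H2 j jN.
move: e0; rewrite le_eqVlt => /predU1P[<-//|e0].
have [lk Qk] := H1 k kN; rewrite e0 in p.
have := H4 j (psi k) jN; rewrite -ip_sinc_op// Qk ipZl// p !mulr1; apply.
by split=> // i ij; apply: H3; rewrite kN (ltn_trans ij jk).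
Qed.

Fixpoint residual f (K : nat) : R -> R :=
  if K is k.+1 then fun x => residual f k x + (- ip f (psi k)) * psi k x else f.

Lemma residualP f K : lbm f -> (K <= N)%N ->
  [/\ lbm (residual f K),
      forall j, (j < N)%N -> ip (residual f K) (psi j) = if (j < K)%N then 0 else ip f (psi j),
      ip (residual f K) (residual f K) = ip f f - \sum_(k < K) ip f (psi k) ^+ 2 &
      sinc_form s (residual f K) (residual f K) =
        sinc_form s f f - \sum_(k < K) e k * ip f (psi k) ^+ 2].
Proof.
have [H1 H2 H3 H4] := sl => lf; elim: K => [_|K IH KN].
  by rewrite !big_ord0 !subr0; split=> // j _; rewrite ltn0.
have [lr ro rr rf] := IH (ltnW KN).
have [lK QK] := H1 K KN; have [eK pK] := H2 K KN.
set c := ip f (psi K).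
have rK : ip (residual f K) (psi K) = c by rewrite ro// ltnn.
(* Either [psi K] is normalized, or it is a null vector and then c = 0. *)
have cp : c ^+ 2 * ip (psi K) (psi K) = c ^+ 2.
  move: pK; case: ltP => [_ ->|_ p0]; first by rewrite mulr1.
  by rewrite /c (ip_null lf lK p0) expr0n mul0r.
split.
- by apply: lbmD => //; exact: lbmZ.
- move=> j jN /=; have [lj _] := H1 j jN.
  rewrite ipDl//; last exact: lbmZ.
  rewrite ipZl// ro// ltnS (leq_eqVlt j K) -/c; case: ltngtP => /= [jK|jK|->].
  + by rewrite add0r (H3 j K) ?mulr0// jK.
  + by rewrite (ipC (psi K)) (H3 K j) ?mulr0 ?addr0// jK.
  + case: (ltP 0 (e K)) pK => [_ ->|_ p0]; first by rewrite mulr1 subrr.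
    by rewrite p0 mulr0 addr0 (ip_null lf lK p0).
- rewrite /= ip_quad// rK -/c rr big_ord_recr /= -/c sqrrN cp; ring.
- rewrite /= sinc_form_quad// rf big_ord_recr /= -/c.
  have -> : sinc_form s (residual f K) (psi K) = e K * c.
    by rewrite sinc_formC -ip_sinc_op// QK ipZl// ipC rK.
  have -> : sinc_form s (psi K) (psi K) = e K * ip (psi K) (psi K).
    by rewrite -ip_sinc_op// QK ipZl.
  by rewrite sqrrN (mulrCA (c ^+ 2)) cp; ring.
Qed.

Lemma spectral_list_bessel f : lbm f -> \sum_(k < N) ip f (psi k) ^+ 2 <= ip f f.
Proof.
move=> lf; have [_ _ E _] := residualP lf (leqnn N).
by have := ip_ge0 (residual f N); rewrite E subr_ge0.
Qed.

(** Maximality at the last index is applied to the residual, which is orthogonal to all N vectors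
    and a fortiori to the first N - 1. *)
Lemma spectral_list_form_le f : lbm f -> (0 < N)%N ->
  sinc_form s f f <= e N.-1 * ip f f + \sum_(k < N) (e k - e N.-1) * ip f (psi k) ^+ 2.
Proof.
have [H1 H2 H3 H4] := sl => lf N0; have [lr ro rr rf] := residualP lf (leqnn N).
have NN : (N.-1 < N)%N by rewrite prednK.
have := H4 N.-1 (residual f N) NN; rewrite rr rf => H.
have {}H := H _.
have := H; rewrite mulrBr mulr_sumr => {}H.
rewrite (_ : \sum_(k < N) (e k - e N.-1) * ip f (psi k) ^+ 2 =
  \sum_(k < N) e k * ip f (psi k) ^+ 2 - \sum_(k < N) e N.-1 * ip f (psi k) ^+ 2); last first.
  by rewrite -sumrB; apply: eq_bigr => k _; rewrite mulrBl.
suff : sinc_form s f f - \sum_(k < N) e k * ip f (psi k) ^+ 2 <=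
  e N.-1 * ip f f - \sum_(k < N) e N.-1 * ip f (psi k) ^+ 2 by lra.
apply: H; split=> // j jN; rewrite ro ?(ltn_trans jN NN)//.
Qed.

(* Combines Hadamard's inequality for the form ||f||^2 - <Q f, f> with the fact
   that compressing to an N-dimensional space cannot lower the product of the N
   smallest eigenvalues of that form. *)
Lemma det_gram_le (g : 'I_N -> R -> R) : (forall i, lbm (g i)) ->
  (\prod_(k < N) (1 - e k)) * \det (\matrix_(i, j) ip (g i) (g j)) <=
  \prod_i (ip (g i) (g i) - sinc_form s (g i) (g i)).
Proof.
move=> lg; have [H1 H2 H3 H4] := sl.
have A0 i : 0 <= ip (g i) (g i) - sinc_form s (g i) (g i).
  by rewrite subr_ge0 sinc_form_le.
case: (posnP N) => [N0|N0].
  by move: g lg A0; rewrite N0 => g lg A0; rewrite !big_ord0 det_mx00 mulr1.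
(* The largest of the N factors, and a lower bound of the form Id - Q on the complement of the list.
   If it is zero, so is the left-hand side. *)
pose m := 1 - e N.-1.
have NN : (N.-1 < N)%N by rewrite prednK.
have em k : (k < N)%N -> 0 <= 1 - e k <= m.
  move=> kN; have /andP[a b] := spectral_list_le1 kN.
  rewrite subr_ge0 b /m lerD2l lerN2; apply: spectral_list_mono.
  by rewrite NN andbT -ltnS prednK.
have m0 : 0 <= m by have /andP[a b] := em _ NN; exact: a.
move: m0; rewrite le_eqVlt => /predU1P[m0|m0].
  rewrite (bigD1 (Ordinal NN))//= -/m -m0 !mul0r.
  by apply: prodr_ge0 => i _.
pose v (k : nat) : 'rV[R]_N := \row_i ip (g i) (psi k).
pose G : 'M[R]_N := \matrix_(i, j) ip (g i) (g j).
have vv k i j : ((v k)^T *m v k) i j = ip (g i) (psi k) * ip (g j) (psi k).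
  by rewrite mxE big_ord1 !mxE.
have pG : psd (G - \sum_(k < N) (v k)^T *m v k).
  split.
    rewrite linearB /= linear_sum /=; congr (_ - _).
      by apply/matrixP => i j; rewrite !mxE ipC.
    by apply: eq_bigr => k _; rewrite trmx_mul trmxK.
  move=> x; pose f y := \sum_i x 0 i * g i y.
  have lxg i : lbm (fun y => x 0 i * g i y) by exact: lbmZ.
  have lf : lbm f by exact: lbm_bigsum.
  have ipf h : lbm h -> ip f h = \sum_i x 0 i * ip (g i) h.
    move=> lh; rewrite /f ip_bigsuml//; apply: eq_bigr => i _; exact: ipZl.
  have Ef : (x *m G *m x^T) 0 0 = ip f f.
    rewrite mxE ipf//; apply: eq_bigr => j _.
    rewrite ipC ipf// !mxE mulrC; congr (_ * _); apply: eq_bigr => i _.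
    by rewrite mxE.
  have Ev k : (k < N)%N -> (x *m ((v k)^T *m v k) *m x^T) 0 0 = ip f (psi k) ^+ 2.
    move=> kN; have [lk _] := H1 k kN.
    rewrite mulmxA -mulmxA (_ : v k *m x^T = (x *m (v k)^T)^T); last by rewrite trmx_mul trmxK.
    rewrite mxE big_ord1 [_^T _ _]mxE -expr2 ipf//; congr (_ ^+ 2).
    by rewrite mxE; apply: eq_bigr => i _; rewrite !mxE.
  rewrite mulmxBr mulmxBl mulmx_sumr mulmx_suml.
  have mxB (P Q : 'M[R]_1) : (P - Q) 0 0 = P 0 0 - Q 0 0 by rewrite !mxE.
  rewrite mxB Ef summxE subr_ge0 (eq_bigr (fun k : 'I_N => ip f (psi k) ^+ 2)).
    exact: spectral_list_bessel.
  by move=> k _; rewrite Ev.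
have [pD dD] := det_downdate pG m0 em.
(* [D] is the matrix of the form obtained from Id - Q when Q is replaced, off the listed vectors, by
   e_{N-1} times the identity. This only lowers the form, hence its diagonal entries. *)
set D := _ - _ in pD dD.
have /andP[_ hD] := psd_det pD.
have -> : \prod_(k < N) (1 - e k) * \det G = \prod_(k < N) ((1 - e k) / m) * \det (m *: G).
  rewrite detZ big_split /= prodr_const card_ord exprVn mulrA; congr (_ * _).
  by rewrite divfK// expf_neq0// gt_eqF.
apply: le_trans dD _; apply: le_trans hD _; apply: ler_prod => i _.
rewrite (psd_diag_ge0 _ pD) /=.
have -> : D i i = m * ip (g i) (g i) - \sum_(k < N) (m - (1 - e k)) * ip (g i) (psi k) ^+ 2.
  rewrite /D mxE [(- _ : 'M[R]_N) i i]mxE summxE mxE mxE; congr (_ - _).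
  by apply: eq_bigr => k _; rewrite mxE vv expr2.
have -> : \sum_(k < N) (m - (1 - e k)) * ip (g i) (psi k) ^+ 2 =
    \sum_(k < N) (e k - e N.-1) * ip (g i) (psi k) ^+ 2.
  by apply: eq_bigr => k _; congr (_ * _); rewrite /m; ring.
have := spectral_list_form_le (lg i) N0.
rewrite /m mulrBl mul1r; lra.
Qed.

End Bound.
End GramDeterminant.

(** * Changes of variable *)

Section Substitution.
Local Open Scope classical_set_scope.
Variable R : realType.
Local Notation lbm := (@locally_bounded_measurable R).

Lemma itg_subst (a b : R) (f F dF : R -> R) : has_deriv F dF -> continuous dF ->
  continuous f -> a <= b ->
  (forall x y, a <= x <= b -> a <= y <= b -> x < y -> F x < F y) ->
  itg (F a) (F b) f = itg a b (fun x => f (F x) * dF x).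
Proof.
move=> hF cdF cf ab Fi; rewrite !itgE /Rintegral.
have dE : F^`() = dF by apply/funext => x; rewrite derive1E; have [_ ->] := hF x.
rewrite (@integration_by_substitution_increasing _ F f)//.
- by congr fine; apply: eq_integral => x _; rewrite /= dE.
- by move=> x _; rewrite dE; exact: cdF.
- by rewrite dE; apply/cvg_ex; exists (dF a); apply: cvg_at_right_filter; exact: cdF.
- by rewrite dE; apply/cvg_ex; exists (dF b); apply: cvg_at_left_filter; exact: cdF.
- split; first by move=> x _; have [] := hF x.
    by apply: cvg_at_right_filter; exact: has_deriv_continuous hF a.
  by apply: cvg_at_left_filter; exact: has_deriv_continuous hF b.
- exact: continuous_subspaceT.
Qed.

Lemma itg_scale (s k : R) f : continuous f -> 0 < k -> 0 <= s ->
  itg 0 s (fun t => f (k * t)) = k^-1 * itg 0 (k * s) f.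
Proof.
move=> cf k0 s0.
have hF : has_deriv (fun t => k * t) (fun=> k * 1) := has_derivZ k (@has_deriv_id R).
have cF := has_deriv_continuous hF.
have lfk : lbm (fun t => f (k * t)).
  by apply: lbm_continuous => t; apply: continuous_comp; [exact: cF|exact: cf].
have ck : continuous (fun _ : R => k * 1) by move=> x; exact: cvg_cst.
have incr x y : 0 <= x <= s -> 0 <= y <= s -> x < y -> k * x < k * y.
  by move=> _ _ xy; rewrite ltr_pM2l.
have := itg_subst hF ck cf s0 incr.
by rewrite mulr0 mulr1 itgZr// => ->; rewrite mulrC mulfK// gt_eqF.
Qed.

End Substitution.

(** * Even step functions and their transforms *)

Section StepFunctions.
Local Open Scope classical_set_scope.
Variable R : realType.
Local Notation lbm := (@locally_bounded_measurable R).

Definition step (a b x : R) : R := (a <= x < b)%R%:R.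

Lemma step_indic (a b : R) : step a b = \1_(`[a, b[).
Proof. by apply/funext => x; rewrite indicE /step mem_setE in_itv. Qed.

Lemma lbm_step (a b : R) : lbm (step a b).
Proof. by rewrite step_indic; apply: lbm_indic; exact: measurable_itv. Qed.

Lemma itg_step (a b : R) f : lbm f -> -1 <= a -> a <= b -> b <= 1 ->
  itg (-1) 1 (fun x => step a b x * f x) = itg a b f.
Proof.
move=> lf a1 ab b1; rewrite !itgE.
have sub : `[a, b[ `<=` `[(-1 : R), 1].
  move=> x /=; rewrite !in_itv/= => /andP[ax xb].
  by rewrite (le_trans a1 ax) (le_trans (ltW xb) b1).
rewrite (_ : (fun x => _) = (f \_ `[a, b[)); last first.
  apply/funext => x; rewrite /step patchE mem_setE in_itv/=.
  by case: ifP; rewrite ?mul1r ?mul0r.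
rewrite -Rintegral_mkcondr setIidr// Rintegral_itv_bndo_bndc//.
by apply: integrableS (lbm_integrable a b lf) => //; apply: subset_itvl; rewrite bnd_simp.
Qed.

Variable m : nat.
Hypothesis m0 : (0 < m)%N.
Let w : R := m%:R^-1.

Let w0 : 0 < w. Proof. by rewrite invr_gt0 ltr0n. Qed.

(** Indicator of j w <= |x| < (j + 1) w, up to endpoints. Half-open pieces make the products of
    distinct steps vanish everywhere, not just almost everywhere. *)
Definition even_step (j : nat) (x : R) : R :=
  step (j%:R * w) (j.+1%:R * w) x + step (- (j.+1%:R * w)) (- (j%:R * w)) x.

Lemma lbm_even_step j : lbm (even_step j).
Proof. by apply: lbmD; exact: lbm_step. Qed.

Let jw_le j : (j <= m)%N -> j%:R * w <= 1.
Proof. by move=> jm; rewrite ler_pdivrMr ?ltr0n// mul1r ler_nat. Qed.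

Let jw_ge0 j : 0 <= j%:R * w.
Proof. by rewrite mulr_ge0 ?(ltW w0). Qed.

Let jw_lt i j : (i < j)%N -> i%:R * w < j%:R * w.
Proof. by move=> ij; rewrite ltr_pM2r// ltr_nat. Qed.

Lemma itg_even_step j (f : R -> R) : continuous f -> (forall x, f (- x) = f x) -> (j < m)%N ->
  itg (-1) 1 (fun x => even_step j x * f x) = 2 * itg (j%:R * w) (j.+1%:R * w) f.
Proof.
move=> cf ef jm; have lf := lbm_continuous cf.
have a0 := jw_ge0 j; have b1 := jw_le jm; have ab := ltW (jw_lt (ltnSn j)).
rewrite (@eq_itg _ _ _ _ (fun x => step (j%:R * w) (j.+1%:R * w) x * f x
   + step (- (j.+1%:R * w)) (- (j%:R * w)) x * f x)); last first.
  by move=> x _; rewrite mulrDl.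
rewrite itgD; [|exact: lbmM (lbm_step _ _) lf..].
rewrite !itg_step//; try lra.
rewrite itg_substN// (@eq_itg _ _ _ (fun x => f (- x)) f)//.
by ring.
Qed.

Lemma even_stepM i j x : even_step i x * even_step j x = (i == j)%:R * even_step j x.
Proof.
have disj (a b c d : R) : b <= c -> step a b x * step c d x = 0.
  move=> bc; rewrite /step; case: (boolP (a <= x < b)) => [/andP[_ xb]|_]; last by rewrite mul0r.
  by rewrite leNgt (lt_le_trans xb bc) mulr0.
have disj' (a b c d : R) : d <= a -> step a b x * step c d x = 0.
  by move=> da; rewrite mulrC disj.
have idem (a b : R) : step a b x * step a b x = step a b x.
  by rewrite /step; case: (_ && _); rewrite ?mul1r ?mul0r.
have ai := jw_ge0 i; have aj := jw_ge0 j.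
have bi := ltW (jw_lt (ltnSn i)); have bj := ltW (jw_lt (ltnSn j)).
rewrite /even_step !(mulrDl, mulrDr); case: ltngtP => [ij|ij|->].
- have h : i.+1%:R * w <= j%:R * w by rewrite ler_pM2r// ler_nat.
  rewrite disj// disj'; last by lra.
  rewrite disj; last by lra.
  by rewrite disj' ?lerN2// !mul0r !addr0.
- have h : j.+1%:R * w <= i%:R * w by rewrite ler_pM2r// ler_nat.
  rewrite disj'// disj'; last by lra.
  rewrite disj; last by lra.
  by rewrite disj ?lerN2// !mul0r !addr0.
- rewrite !idem disj'; last by lra.
  rewrite disj; last by lra.
  by rewrite ?eqxx !mul1r addr0 add0r.
Qed.

Lemma ip_even_step i j : (j < m)%N -> ip (even_step i) (even_step j) = (i == j)%:R * (2 * w).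
Proof.
move=> jm; rewrite /ip (@eq_itg _ _ _ _ (fun x => (i == j)%:R * (even_step j x * 1))); last first.
  by move=> x _; rewrite even_stepM mulr1.
rewrite itgZ; last by apply: lbmZr; exact: lbm_even_step.
rewrite (itg_even_step (f := fun=> 1))//; last exact: cst_continuous.
rewrite itg_cst; last exact: ltW (jw_lt (ltnSn j)).
by rewrite -natr1; congr (_ * _); ring.
Qed.

(** The odd frequencies come from the midpoints (j + 1/2) w of the steps; the factor t on the left
    avoids dividing by zero. *)
Lemma fcos_even_step j (t : R) : (j < m)%N ->
  t * fcos (even_step j) t = 4 * sin (w / 2 * t) * cos ((2 * j + 1)%:R * (w / 2 * t)).
Proof.
move=> jm; rewrite /fcos /cos_tr itg_even_step//; last 2 first.
- exact: has_deriv_continuous (has_deriv_cos t).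
- by move=> x; rewrite mulrN cosN.
have lc := lbm_cos t.
rewrite mulrCA -itgZ// (itg_ftc (has_deriv_sin t)); last 2 first.
- by apply: has_deriv_continuous; apply: has_derivZ; exact: has_deriv_cos.
- exact: ltW (jw_lt (ltnSn j)).
set u := w / 2 * t; set v := (2 * j + 1)%:R * u.
have -> : t * (j.+1%:R * w) = v + u by rewrite /v /u natrD natrM -natr1; field.
have -> : t * (j%:R * w) = v - u by rewrite /v /u natrD natrM; field.
by rewrite sinD sinB; ring.
Qed.

Lemma fcos_even_step0 j : (j < m)%N -> fcos (even_step j) 0 = 2 * w.
Proof.
move=> jm; rewrite /fcos /cos_tr (@eq_itg _ _ _ _ (fun x => even_step j x * 1)); last first.
  by move=> x _; rewrite mul0r cos0.
rewrite (itg_even_step (f := fun=> 1))//; last exact: cst_continuous.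
rewrite itg_cst; last exact: ltW (jw_lt (ltnSn j)).
by rewrite -natr1; ring.
Qed.

End StepFunctions.

(** * Odd Chebyshev polynomials and their cosine coefficients *)

Section Chebyshev.
Local Open Scope classical_set_scope.
Variable R : realType.
Implicit Types (z x y t : R).

(** The pairs (T_{2i+1}, T_{2i+3}), by the recurrence T_{n+2} = 2 T_2 T_n - T_{n-2}, which stays
    within odd degrees; 4 z^2 - 2 is 2 T_2(z). *)
Fixpoint cheb_pair z (i : nat) : R * R :=
  if i is k.+1 then let: (p, q) := cheb_pair z k in (q, (4 * z ^+ 2 - 2) * q - p)
  else (z, (4 * z ^+ 2 - 3) * z).

(* The odd Chebyshev polynomial T_{2i+1}. *)
Definition cheb_odd i z := (cheb_pair z i).1.

Lemma cheb_odd0 z : cheb_odd 0 z = z. Proof. by []. Qed.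
Lemma cheb_odd1 z : cheb_odd 1 z = (4 * z ^+ 2 - 3) * z. Proof. by []. Qed.
Lemma cheb_oddSS i z :
  cheb_odd i.+2 z = (4 * z ^+ 2 - 2) * cheb_odd i.+1 z - cheb_odd i z.
Proof. by rewrite /cheb_odd /=; case: (cheb_pair z i). Qed.

Lemma cheb_odd_ind (P : nat -> Prop) : P 0%N -> P 1%N ->
  (forall i, P i -> P i.+1 -> P i.+2) -> forall i, P i.
Proof.
move=> P0 P1 PS i; suff : P i /\ P i.+1 by case.
by elim: i => [//|i [Pi Pi1]]; split=> //; exact: PS.
Qed.

Lemma cheb_odd_cos i x : cheb_odd i (cos x) = cos ((2 * i + 1)%:R * x).
Proof.
elim/cheb_odd_ind: i => [|| i IH IH1].
- by rewrite cheb_odd0 mul1r.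
- rewrite cheb_odd1 (_ : (2 * 1 + 1)%:R * x = x + x + x); last by rewrite natrD natrM; ring.
  have h := cos2Dsin2 x; rewrite !cosD sinD.
  have -> : (cos x * cos x - sin x * sin x) * cos x - (sin x * cos x + cos x * sin x) * sin x =
     cos x ^+ 3 - 3 * cos x * sin x ^+ 2 by ring.
  have -> : sin x ^+ 2 = 1 - cos x ^+ 2 by rewrite -h; ring.
  by ring.
- rewrite cheb_oddSS IH IH1.
  set y := (2 * i.+1 + 1)%:R * x.
  have -> : (2 * i.+2 + 1)%:R * x = y + (x + x) by rewrite /y !natrD !natrM -!natr1; ring.
  have -> : (2 * i + 1)%:R * x = y - (x + x) by rewrite /y !natrD !natrM -!natr1; ring.
  rewrite cosB cosD !cosD.
  have h := cos2Dsin2 x.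
  have -> : sin x * sin x = 1 - cos x ^+ 2 by rewrite -expr2 -h; ring.
  by ring.
Qed.

Lemma cheb_odd_hyperbolic i r : r != 0 ->
  cheb_odd i ((r + r^-1) / 2) = (r ^+ (2 * i + 1) + r^-1 ^+ (2 * i + 1)) / 2.
Proof.
move=> r0; elim/cheb_odd_ind: i => [||i IH IH1].
- by rewrite cheb_odd0 !expr1.
- by rewrite cheb_odd1 (_ : (2 * 1 + 1)%N = 3%N)//; field.
- rewrite cheb_oddSS IH IH1.
  have -> : (2 * i.+2 + 1 = (2 * i + 1).+4)%N by rewrite !mulnS.
  have -> : (2 * i.+1 + 1 = (2 * i + 1).+2)%N by rewrite !mulnS.
  move: (2 * i + 1)%N => n.
  by rewrite !exprS; field.
Qed.

(** With p = z + sqrt(z^2 - 1) >= 1, z is (p + 1/p)/2 and T_n(z) is (p^n + p^-n)/2, at most p^n. *)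
Lemma cheb_odd_bound i z r : 1 <= z -> z + Num.sqrt (z ^+ 2 - 1) <= r ->
  0 <= cheb_odd i z <= r ^+ (2 * i + 1).
Proof.
move=> z1; set q := Num.sqrt _ => zr.
have q2 : q ^+ 2 = z ^+ 2 - 1 by rewrite sqr_sqrtr// subr_ge0 exprn_ege1.
have q0 : 0 <= q by exact: sqrtr_ge0.
set p := z + q in zr.
have p1 : 1 <= p by rewrite /p; lra.
have p0 : 0 < p by lra.
have pi : p^-1 = z - q.
  apply: (mulfI (lt0r_neq0 p0)); rewrite mulfV ?gt_eqF// /p.
  by rewrite mulrC -subr_sqr q2; ring.
have -> : z = (p + p^-1) / 2 by rewrite pi /p; field.
rewrite cheb_odd_hyperbolic ?gt_eqF//.
have h1 : p ^+ (2 * i + 1) <= r ^+ (2 * i + 1) by rewrite lerXn2r// nnegrE; lra.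
have h2 : 1 <= p ^+ (2 * i + 1) by exact: exprn_ege1.
have h3 : 0 <= p^-1 ^+ (2 * i + 1) by rewrite exprn_ge0// invr_ge0 ltW.
have h4 : p^-1 ^+ (2 * i + 1) <= 1 by rewrite exprn_ile1 ?invr_ge0 ?(ltW p0)// invf_le1.
apply/andP; split; lra.
Qed.

Variable k : R.
Hypothesis k0 : k != 0.

(* [cheb_coef i j] is the coefficient of cos((2j+1) x) in T_{2i+1}(cos x / k). *)
Fixpoint cheb_coef_pair (i : nat) : (nat -> R) * (nat -> R) :=
  let L (u : nat -> R) (j : nat) := k ^- 2 * ((if j is l.+1 then u l else u 0%N) + u j.+1)
     + (2 * k ^- 2 - 2) * u j in
  if i is l.+1 then let: (u, v) := cheb_coef_pair l in (v, fun j => L v j - u j)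
  else let u j := if j == 0%N then k^-1 else 0 in (u, fun j => L u j - u j).
Definition cheb_coef i := (cheb_coef_pair i).1.

(** Multiplication of an odd cosine series by the factor 4 (cos x / k)^2 - 2 of the recurrence, read
    on coefficients: it contains 2 cos(2x), which shifts j both ways. At j = 0 the frequency -1
    folds back to 1, whence [u 0%N]. *)
Let L (u : nat -> R) (j : nat) := k ^- 2 * ((if j is l.+1 then u l else u 0%N) + u j.+1)
     + (2 * k ^- 2 - 2) * u j.

Lemma cheb_coef0 : cheb_coef 0 = fun j => if j == 0%N then k^-1 else 0. Proof. by []. Qed.
Lemma cheb_coef1 : cheb_coef 1 = fun j => L (cheb_coef 0) j - cheb_coef 0 j. Proof. by []. Qed.
Lemma cheb_coefSS i : cheb_coef i.+2 = fun j => L (cheb_coef i.+1) j - cheb_coef i j.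
Proof. by rewrite /cheb_coef /=; case: (cheb_coef_pair i). Qed.

Lemma cheb_coef_gt i : forall j, (i < j)%N -> cheb_coef i j = 0.
Proof.
elim/cheb_odd_ind: i => [||i IH IH1] [|j] //.
- by rewrite cheb_coef1 /L cheb_coef0 /=; case: j => // j _ /=; ring.
- move=> ij; rewrite cheb_coefSS /L /= (IH j.+1) ?(ltnW (ltnW ij))//.
  by rewrite (IH1 j)// (IH1 j.+2) ?(leqW (ltnW ij))// (IH1 j.+1) ?(ltnW ij)//; ring.
Qed.

(** The powers of 2 in the leading coefficient of T_{2i+1} and in the expansion of cos^(2i+1)
    cancel. As the coefficients with j > i vanish, these diagonal entries give the determinant of
    the coefficient matrix. *)
Lemma cheb_coef_lead i : cheb_coef i i = k^-1 ^+ (2 * i + 1).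
Proof.
elim/cheb_odd_ind: i => [||i IH IH1]; first by rewrite expr1.
  by rewrite cheb_coef1 /L cheb_coef0 /= (_ : (2 * 1 + 1)%N = 3%N)//; field.
rewrite cheb_coefSS /L /= IH1 !cheb_coef_gt//.
have -> : (2 * i.+2 + 1 = (2 * i.+1 + 1).+2)%N by rewrite !mulnS.
by move: (2 * i.+1 + 1)%N => n; rewrite !exprS; field.
Qed.

Let co (j : nat) x := cos ((2 * j + 1)%:R * x).

Let sum_L (M : nat) (u : nat -> R) x : (forall j, (M <= j)%N -> u j = 0) ->
  \sum_(j < M.+1) L u j * co j x = (4 * (cos x / k) ^+ 2 - 2) * \sum_(j < M.+1) u j * co j x.
Proof.
move=> u0.
have E : \sum_(j < M.+1) ((if j : nat is l.+1 then u l else u 0%N) + u j.+1) * co j x =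
    2 * cos (x + x) * \sum_(j < M.+1) u j * co j x.
  pose cm (j : nat) := if j is l.+1 then co l x else co 0%N x.
  have -> : 2 * cos (x + x) * \sum_(j < M.+1) u j * co j x =
      \sum_(j < M.+1) (u j * co j.+1 x + u j * cm j).
    rewrite mulr_sumr; apply: eq_bigr => j _; rewrite -mulrDr mulrCA; congr (_ * _).
    have -> : co j.+1 x = cos ((2 * j + 1)%:R * x + (x + x)).
      by rewrite /co !natrD !natrM -natr1; congr cos; ring.
    have -> : cm j = cos ((2 * j + 1)%:R * x - (x + x)).
      rewrite /cm; case: (nat_of_ord j) => [|l].
        by rewrite /co -cosN (_ : (2 * 0 + 1)%N = 1%N)//; congr cos; ring.
      by rewrite /co !natrD !natrM -natr1; congr cos; ring.
    by rewrite cosB (cosD ((2 * j + 1)%:R * x)) /co; ring.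
  under eq_bigr do rewrite mulrDl.
  rewrite !big_split /= [X in _ + X = _]big_ord_recr /= (u0 M.+1)// mul0r addr0.
  rewrite [X in X + _ = _]big_ord_recl /=.
  rewrite [X in _ = X + _]big_ord_recr /= (u0 M)// mul0r addr0.
  rewrite [X in _ = _ + X]big_ord_recl /=.
  by rewrite [RHS]addrCA -addrA.
have -> : (4 * (cos x / k) ^+ 2 - 2) = k ^- 2 * (2 * cos (x + x)) + (2 * k ^- 2 - 2).
  rewrite cosD; have h := cos2Dsin2 x.
  have -> : sin x * sin x = 1 - cos x ^+ 2 by rewrite -h; ring.
  by field.
rewrite mulrDl -mulrA -E mulr_sumr mulr_sumr -big_split; apply: eq_bigr => j _ /=.
by rewrite /L; move: (match nat_of_ord j with 0%N => u 0%N | l.+1 => u l end) => X; ring.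
Qed.

Lemma cheb_odd_sum m i x : (i < m)%N ->
  \sum_(j < m) cheb_coef i j * cos ((2 * j + 1)%:R * x) = cheb_odd i (cos x / k).
Proof.
elim/cheb_odd_ind: i m => [||i IH IH1] [|m]// im.
- rewrite big_ord_recl big1 ?addr0 => [|j _]; last by rewrite cheb_coef0 /= mul0r.
  by rewrite cheb_coef0/= cheb_odd0 mul1r mulrC.
- have h0 : \sum_(j < m.+1) cheb_coef 0 j * co j x = cos x / k.
    rewrite big_ord_recl big1 ?addr0 => [|j _]; last by rewrite cheb_coef0 /= mul0r.
    by rewrite cheb_coef0/= /co mul1r mulrC.
  under eq_bigr do rewrite cheb_coef1 mulrBl.
  rewrite sumrB sum_L.
    by rewrite h0 cheb_odd1; ring.
  by move=> j mj; apply: cheb_coef_gt; exact: leq_trans mj.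
- under eq_bigr do rewrite cheb_coefSS mulrBl.
  rewrite sumrB sum_L.
    by rewrite /co IH1 ?IH ?cheb_oddSS// ltnW// ltnW.
  by move=> j mj; apply: cheb_coef_gt; exact: leq_trans mj.
Qed.

End Chebyshev.

(** * The test functions and the bound on the product of eigenvalues *)

Section TestSpace.
Local Open Scope classical_set_scope.
Variable R : realType.
Local Notation lbm := (@locally_bounded_measurable R).
Implicit Types (x y t : R).

Lemma sin_ge_cos x : 0 <= x <= 1 -> x * cos x <= sin x.
Proof.
move=> /andP[x0 x1].
have p2 := pi_ge2 R.
have := has_deriv_le (has_derivM (@has_deriv_id R) (@is_derive_cos R)) (@is_derive_sin R) x0.
rewrite /= mul0r sin0 !subr0; apply=> y /andP[y0 yx].
rewrite mul1r mulrN gerBl mulr_ge0// sin_ge0_pi// y0 /=.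
by apply: le_trans yx _; apply: le_trans x1 _; lra.
Qed.

(** From x cos x <= sin x and cos^2 x = 1 - sin^2 x >= 1 - x^2; it bounds the factor (sin a / a)^2
    of the transforms from below. *)
Lemma sin_sqr_ge x : 0 <= x <= 1 -> x ^+ 2 * (1 - x ^+ 2) <= sin x ^+ 2.
Proof.
move=> x01; have h := sin_ge_cos x01; have /andP[x0 x1] := x01.
have p2 := pi_ge2 R.
have c0 : 0 <= cos x by apply: cos_ge0_pihalf; apply/andP; split; lra.
have h2 : (x * cos x) ^+ 2 <= sin x ^+ 2.
  by rewrite lerXn2r// nnegrE ?mulr_ge0// (le_trans _ h)// mulr_ge0.
apply: le_trans h2; rewrite exprMn ler_wpM2l ?sqr_ge0//.
have := sin_lip_bound x; rewrite (ger0_norm x0) => h3.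
have : `|sin x| ^+ 2 <= x ^+ 2 by rewrite lerXn2r// nnegrE.
rewrite real_normK ?num_real//; have := cos2Dsin2 x; lra.
Qed.

Lemma cos_ge_sqr x : 1 - x ^+ 2 / 2 <= cos x.
Proof.
have -> : cos x = 1 - 2 * sin (x / 2) ^+ 2.
  rewrite [in LHS](_ : x = x / 2 + x / 2); last by field.
  by rewrite cosD -!expr2; have := cos2Dsin2 (x / 2); lra.
have := sin_lip_bound (x / 2) => h.
have : `|sin (x / 2)| ^+ 2 <= `|x / 2| ^+ 2 by rewrite lerXn2r// nnegrE.
by rewrite !real_normK ?num_real// expr_div_n; lra.
Qed.

(** The product is a combination of cosines of even frequencies, whose primitives vanish at 0 and
    pi/2. Reducing to j <= i keeps i - j a natural number. *)
Lemma itg_cos_odd (i j : nat) :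
  itg 0 (pi / 2) (fun x => cos ((2 * i + 1)%:R * x) * cos ((2 * j + 1)%:R * x)) =
  (i == j)%:R * (pi / 4) :> R.
Proof.
have p0 := pi_gt0 R.
have p2 : 0 <= pi / 2 :> R by rewrite divr_ge0// ltW.
have half (n : nat) (z : R) : z = n%:R -> z != 0 -> itg 0 (pi / 2) (fun x => cos (2 * z * x)) = 0.
  move=> zn z0; have z2 : 2 * z != 0 by rewrite mulf_neq0.
  have hd := has_derivZ (2 * z)^-1 (has_deriv_sin (2 * z)).
  rewrite (@eq_itg _ _ _ _ (fun x => (2 * z)^-1 * (2 * z * cos (2 * z * x)))); last first.
    by move=> x _; rewrite mulKf.
  rewrite (itg_ftc hd)//; last first.
    by apply: has_deriv_continuous; apply: has_derivZ; apply: has_derivZ; exact: has_deriv_cos.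
  rewrite mulr0 sin0 mulr0 subr0 (_ : 2 * z * (pi / 2) = n%:R * pi).
    by rewrite sin_natmul_pi mulr0.
  by rewrite zn; field.
wlog ij : i j / (j <= i)%N.
  move=> H; have [|/ltnW ij] := leqP j i; first exact: H.
  by rewrite eq_sym -H//; apply: eq_itg => x _; rewrite mulrC.
rewrite (@eq_itg _ _ _ _ (fun x => 2^-1 * (cos (2 * (i - j)%:R * x) + cos (2 * (i + j + 1)%:R * x)))); last first.
  move=> x _; set a := (2 * i + 1)%:R * x; set b := (2 * j + 1)%:R * x.
  have -> : 2 * (i - j)%:R * x = a - b by rewrite natrB// /a /b; ring.
  have -> : 2 * (i + j + 1)%:R * x = a + b by rewrite /a /b; ring.
  by rewrite cosB cosD; field.
rewrite itgZ; last by apply: lbmD; exact: lbm_cos.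
rewrite itgD; [|exact: lbm_cos..].
have hp : (i + j + 1)%:R != 0 :> R by rewrite addn1 pnatr_eq0.
rewrite (half _ _ erefl hp).
case: eqVneq => [->|ne].
  rewrite subnn (@eq_itg _ _ _ _ (fun=> 1)); last by move=> x _; rewrite mulr0 mul0r cos0.
  by rewrite itg_cst// !mul1r subr0 addr0; lra.
have hd : (i - j)%:R != 0 :> R by rewrite pnatr_eq0 subn_eq0 -ltnNge ltn_neqAle eq_sym ne.
by rewrite (half _ _ erefl hd) mul0r addr0 mulr0.
Qed.

Variables (s : R) (m : nat).
Hypotheses (s0 : 0 < s) (m0 : (0 < m)%N).
Let w : R := m%:R^-1.
Let b : R := w / 2 * s.
Hypothesis b1 : b <= 1.
Let k := cos b.

Let w0 : 0 < w. Proof. by rewrite invr_gt0 ltr0n. Qed.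
Let b0 : 0 < b. Proof. by rewrite mulr_gt0// divr_gt0. Qed.
Let bpi : b < pi / 2.
Proof.
(* The bound 1 <= pi/2 at hand is not strict; equality is excluded because cos 1 >= 1/2. *)
apply: le_lt_trans b1 _; have := @pihalf_ge1 R; rewrite le_eqVlt => /predU1P[E|//].
by have := @cos_pihalf R; rewrite -E => c1; have := cos_ge_sqr 1; rewrite c1 expr1n; lra.
Qed.

Let k0 : 0 < k.
Proof. by apply: cos_gt0_pihalf; rewrite bpi andbT; have := b0; have := pi_gt0 R; lra. Qed.
Let k1 : k < 1.
Proof.
rewrite -(@cos0 R) ltr_cos// in_itv/= ?lexx ?pi_ge0// (ltW b0)/=.
by have := bpi; have := pi_gt0 R; lra.
Qed.

(** With a = w t / 2, the cosine transform of this step function is 2 w (sin a / a) T_{2i+1}(cos a /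
    k). *)
Definition test_fun (i : nat) x := \sum_(j < m) cheb_coef k i j * even_step m j x.
Let P i x := cheb_odd i (cos x / k).

Lemma lbm_test_fun i : lbm (test_fun i).
Proof.
by apply: (@lbm_sum _ m (fun j x => cheb_coef k i j * even_step m j x)) => j _;
  apply: lbmZ; exact: lbm_even_step.
Qed.

Let kneq0 : k != 0. Proof. by rewrite gt_eqF. Qed.

Let P_sum i x : (i < m)%N -> P i x = \sum_(j < m) cheb_coef k i j * cos ((2 * j + 1)%:R * x).
Proof. by move=> im; rewrite cheb_odd_sum. Qed.

Let has_deriv_P i : (i < m)%N -> exists dP, has_deriv (P i) dP.
Proof.
move=> im; pose G j x := cheb_coef k i j * cos ((2 * j + 1)%:R * x).
have -> : P i = fun x => \sum_(j < m) G j x by apply/funext => x; rewrite P_sum.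
elim: (m) => [|n [dF hF]].
  by exists (fun=> 0); under eq_fun do rewrite big_ord0; exact: has_deriv_cst.
exists (fun x => dF x + cheb_coef k i n * - ((2 * n + 1)%:R * sin ((2 * n + 1)%:R * x))).
under eq_fun do rewrite big_ord_recr /=.
by apply: has_derivD => //; apply: has_derivZ; exact: has_deriv_cos.
Qed.

Let continuous_P2 i : (i < m)%N -> continuous (fun x => P i x ^+ 2).
Proof.
move=> /has_deriv_P[dP h]; have := has_deriv_continuous (has_derivM h h).
by under eq_fun do rewrite -expr2.
Qed.

Lemma ip_test_fun i l : ip (test_fun i) (test_fun l) =
  2 * w * \sum_(j < m) cheb_coef k i j * cheb_coef k l j.
Proof.
rewrite (@ip_bigsuml _ _ _ (fun j : 'I_m => fun x => cheb_coef k i j * even_step m j x)); last 2 first.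
- by move=> j; apply: lbmZ; exact: lbm_even_step.
- exact: lbm_test_fun.
rewrite mulr_sumr; apply: eq_bigr => j _.
rewrite ipZl; [|exact: lbm_even_step|exact: lbm_test_fun].
rewrite ipC (@ip_bigsuml _ _ _ (fun j : 'I_m => fun x => cheb_coef k l j * even_step m j x)); last 2 first.
- by move=> q; apply: lbmZ; exact: lbm_even_step.
- exact: lbm_even_step.
rewrite (bigD1 j)//= big1 ?addr0 => [|q qj].
  by rewrite ipZl ?ip_even_step// ?eqxx ?mul1r; [rewrite /w; ring|exact: lbm_even_step..].
rewrite ipZl ?ip_even_step//; [|exact: lbm_even_step..].
by rewrite (inj_eq val_inj) (negbTE qj) mul0r mulr0.
Qed.

(** Parseval for the odd cosines on [0, pi/2]: the norm involves [P i] on a quarter period only,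
    without the factor sin(a)/a. *)
Lemma ip_test_fun_itg i : (i < m)%N ->
  ip (test_fun i) (test_fun i) = 8 * w / pi * itg 0 (pi / 2) (fun x => P i x ^+ 2).
Proof.
move=> im; rewrite ip_test_fun.
have p0 := pi_gt0 R.
rewrite (@eq_itg _ _ _ _ (fun x => \sum_(j < m) \sum_(q < m)
   cheb_coef k i j * cheb_coef k i q * (cos ((2 * j + 1)%:R * x) * cos ((2 * q + 1)%:R * x)))); last first.
  move=> x _; rewrite P_sum// expr2 big_distrlr /=; apply: eq_bigr => j _; apply: eq_bigr => q _.
  by ring.
have lcc (j q : nat) : lbm (fun x => cos ((2 * j + 1)%:R * x) * cos ((2 * q + 1)%:R * x)).
  by apply: lbmM; exact: lbm_cos.
rewrite (@itg_sum _ _ _ m (fun j x => \sum_(q < m)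
   cheb_coef k i j * cheb_coef k i q * (cos ((2 * j + 1)%:R * x) * cos ((2 * q + 1)%:R * x)))); last first.
  by move=> j _; apply: (@lbm_sum _ m (fun q x => cheb_coef k i j * cheb_coef k i q *
    (cos ((2 * j + 1)%:R * x) * cos ((2 * q + 1)%:R * x)))) => q _; exact: lbmZ.
rewrite !mulr_sumr; apply: eq_bigr => j _.
rewrite (@itg_sum _ _ _ m (fun q x => cheb_coef k i j * cheb_coef k i q *
    (cos ((2 * j + 1)%:R * x) * cos ((2 * q + 1)%:R * x)))); last by move=> q _; exact: lbmZ.
rewrite (bigD1 j)//= big1 ?addr0 => [|q qj].
  rewrite itgZ// itg_cos_odd eqxx mul1r; move: (pi : R) p0 => p p0.
  by field; rewrite gt_eqF.
by rewrite itgZ// itg_cos_odd eq_sym (inj_eq val_inj) (negbTE qj) mul0r mulr0.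
Qed.

Lemma fcos_test_fun_ge i t : (i < m)%N -> 0 <= t <= s ->
  4 * w ^+ 2 * (1 - b ^+ 2) * P i (w / 2 * t) ^+ 2 <= fcos (test_fun i) t ^+ 2.
Proof.
move=> im /andP[t0 ts]; have bb : 0 <= 1 - b ^+ 2 by rewrite subr_ge0 exprn_ile1// ltW.
have fE : fcos (test_fun i) t = \sum_(j < m) cheb_coef k i j * fcos (even_step m j) t.
  rewrite /fcos /cos_tr (@eq_itg _ _ _ _ (fun x => \sum_(j < m) cheb_coef k i j * (even_step m j x * cos (t * x)))).
    rewrite (@itg_sum _ _ _ m (fun j x => cheb_coef k i j * (even_step m j x * cos (t * x)))).
      by apply: eq_bigr => j _; rewrite itgZ//; apply: lbm_mul_cos; exact: lbm_even_step.
    by move=> j _; apply: lbmZ; apply: lbm_mul_cos; exact: lbm_even_step.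
  by move=> x _; rewrite mulr_suml; apply: eq_bigr => j _; rewrite mulrA.
move: t0; rewrite le_eqVlt => /predU1P[t0|t0].
  have -> : fcos (test_fun i) t = 2 * w * P i (w / 2 * t).
    rewrite fE P_sum// mulr_sumr; apply: eq_bigr => j _.
    by rewrite -t0 fcos_even_step0// !mulr0 cos0 mulr1 mulrC.
  have -> : (2 * w * P i (w / 2 * t)) ^+ 2 = 4 * w ^+ 2 * P i (w / 2 * t) ^+ 2 by ring.
  rewrite [leLHS]mulrAC ler_piMr ?gerBl ?sqr_ge0//.
  by rewrite mulr_ge0 ?sqr_ge0// mulr_ge0 ?sqr_ge0.
set al := w / 2 * t.
have al01 : 0 <= al <= b.
  by rewrite /al /b mulr_ge0 ?(ltW t0) ?divr_ge0 ?(ltW w0)//= ler_wpM2l// divr_ge0// ltW.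
have /andP[al0 alb] := al01.
have tE : t * fcos (test_fun i) t = 4 * sin al * P i al.
  rewrite fE P_sum// !mulr_sumr; apply: eq_bigr => j _.
  by rewrite mulrCA fcos_even_step// -/w -/al; ring.
rewrite -(ler_pM2l (exprn_gt0 2 t0)) -exprMn tE.
have -> : t ^+ 2 * (4 * w ^+ 2 * (1 - b ^+ 2) * P i al ^+ 2) =
   16 * P i al ^+ 2 * (al ^+ 2 * (1 - b ^+ 2)) by rewrite /al; field.
have -> : (4 * sin al * P i al) ^+ 2 = 16 * P i al ^+ 2 * sin al ^+ 2 by ring.
apply: ler_wpM2l; first by rewrite mulr_ge0// sqr_ge0.
apply: le_trans (sin_sqr_ge _); last by rewrite al0 (le_trans alb b1).
rewrite ler_wpM2l ?sqr_ge0// lerD2l lerN2 lerXn2r// nnegrE; exact: ltW.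
Qed.

(** On the band, a lies in [0, b] and (sin a / a)^2 >= 1 - b^2. The constant 8 w / pi is that of
    [ip_test_fun_itg], so the integrals over [0, b] nearly cancel in the difference. *)
Lemma sinc_form_test_fun_ge i : (i < m)%N ->
  8 * w / pi * (1 - b ^+ 2) * itg 0 b (fun x => P i x ^+ 2) <=
  sinc_form s (test_fun i) (test_fun i).
Proof.
move=> im; rewrite /sinc_form.
have lg := lbm_test_fun i; have lc := lbm_fcos lg; have ls := lbm_fsin lg.
have cP2 := continuous_P2 im; have lP2 := lbm_continuous cP2.
have w2 : 0 < w / 2 by rewrite divr_gt0.
have lPw : lbm (fun t => P i (w / 2 * t) ^+ 2).
  have [dP h] := has_deriv_P im.
  have h2 := has_deriv_comp h (has_derivZ (w / 2) (@has_deriv_id R)).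
  have := lbm_deriv (has_derivM h2 h2).
  by under eq_fun do rewrite -expr2.
have -> : 8 * w / pi * (1 - b ^+ 2) * itg 0 b (fun x => P i x ^+ 2) =
    pi^-1 * itg 0 s (fun t => 4 * w ^+ 2 * (1 - b ^+ 2) * P i (w / 2 * t) ^+ 2).
  rewrite itgZ// (itg_scale cP2 w2 (ltW s0)) -/b.
  move: (pi^-1) (itg _ _ _) => p X; field; exact: lt0r_neq0.
rewrite ler_wpM2l ?invr_ge0 ?pi_ge0//; apply: le_itg.
- exact: lbmZ.
- by apply: lbmD; exact: lbmM.
- move=> t ht; rewrite -!expr2; apply: le_trans (fcos_test_fun_ge im ht) _.
  by rewrite lerDl sqr_ge0.
Qed.

(** Maps [0, pi/2] increasingly onto [b, pi/2], with P_i(F(x)) = cos((2i+1) x). *)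
Let F x := acos (k * cos x).
Let dF x := - (Num.sqrt (1 - (k * cos x) ^+ 2))^-1 * (k * - sin x).

Let kcos x : -1 < k * cos x < 1.
Proof.
rewrite -ltr_norml normrM (gtr0_norm k0); apply: le_lt_trans k1.
by rewrite ler_piMr ?(ltW k0)// ler_norml cos_geN1 cos_le1.
Qed.

Let has_deriv_F : has_deriv F dF.
Proof.
move=> x; have hk : has_deriv (fun x => k * cos x) (fun x => k * - sin x).
  by apply: has_derivZ; exact: is_derive_cos.
have ha : is_derive ((fun x => k * cos x) x) 1 (@acos R) (- (Num.sqrt (1 - (k * cos x) ^+ 2))^-1).
  exact: is_derive1_acos.
exact: (is_derive_eq (@is_derive1_comp _ (@acos R) (fun x => k * cos x) _ _ _ ha (hk x))).
Qed.

Let sq_gt0 x : 0 < 1 - (k * cos x) ^+ 2.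
Proof.
rewrite subr_gt0 -(real_normK (num_real _)) exprn_ilt1//.
by rewrite ltr_norml kcos.
Qed.

Let continuous_dF : continuous dF.
Proof.
have hk : has_deriv (fun x => 1 - k * cos x * (k * cos x))
  (fun x => 0 - (k * - sin x * (k * cos x) + k * cos x * (k * - sin x))).
  apply: has_derivB; first exact: has_deriv_cst.
  by apply: has_derivM; apply: has_derivZ; exact: is_derive_cos.
have ck := has_deriv_continuous hk.
move=> x; apply: cvgM; last first.
  apply: cvgM; first exact: cvg_cst.
  by apply: cvgN; exact: continuous_sin.
apply: cvgN; apply: cvgV; first by rewrite gt_eqF// sqrtr_gt0.
apply: (@continuous_comp _ _ _ (fun x => 1 - (k * cos x) ^+ 2) Num.sqrt); last exact: sqrt_continuous.
exact: ck.
Qed.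

Let F_cos x : cos (F x) = k * cos x.
Proof. by apply: acosK; have /andP[h1 h2] := kcos x; rewrite in_itv/= !ltW. Qed.

Let F_itv x : 0 <= F x <= pi.
Proof. by have /andP[h1 h2] := kcos x; rewrite acos_ge0 ?acos_lepi// !ltW. Qed.

Let F_incr x y : 0 <= x <= pi / 2 -> 0 <= y <= pi / 2 -> x < y -> F x < F y.
Proof.
have p0 := pi_gt0 R.
move=> /andP[x0 x1] /andP[y0 y1] xy.
rewrite -ltr_cos ?in_itv//= ?F_itv// !F_cos ltr_pM2l//.
by rewrite ltr_cos// in_itv/=; apply/andP; split=> //; lra.
Qed.

(** After substitution by [F], the integrand is cos^2((2i+1) x) times the Jacobian k sin x / sqrt(1
    - k^2 cos^2 x), which is at most 1 since k <= 1. *)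
Lemma itg_P_outer i : (i < m)%N -> itg b (pi / 2) (fun x => P i x ^+ 2) <= pi / 4.
Proof.
move=> im; have p0 := pi_gt0 R; have cP2 := continuous_P2 im.
have F0 : F 0 = b.
  by rewrite /F cos0 mulr1 cosK// in_itv/= (ltW b0)/=; have := bpi; lra.
have F1 : F (pi / 2) = pi / 2 by rewrite /F cos_pihalf mulr0 acos0.
have p2 : 0 <= pi / 2 :> R by rewrite divr_ge0// ltW.
have E := itg_subst has_deriv_F continuous_dF cP2 p2 F_incr.
rewrite F0 F1 in E; rewrite {}E.
have lc : lbm (fun x => cos ((2 * i + 1)%:R * x) * cos ((2 * i + 1)%:R * x)).
  by apply: lbmM; exact: lbm_cos.
have PF x : P i (F x) ^+ 2 = cos ((2 * i + 1)%:R * x) * cos ((2 * i + 1)%:R * x).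
  by rewrite /P F_cos mulrC mulKf// cheb_odd_cos expr2.
rewrite (@eq_itg _ _ _ _ (fun x => cos ((2 * i + 1)%:R * x) * cos ((2 * i + 1)%:R * x) * dF x)); last first.
  by move=> x _; rewrite PF.
apply: (@le_trans _ _ (itg 0 (pi / 2) (fun x => cos ((2 * i + 1)%:R * x) * cos ((2 * i + 1)%:R * x)))).
  apply: le_itg => //; first by apply: lbmM => //; exact: lbm_continuous.
  move=> x /andP[x0 x1]; rewrite ler_piMr//; first by rewrite -expr2 sqr_ge0.
  rewrite /dF mulrN mulrNN mulrC ler_pdivrMr ?sqrtr_gt0// mul1r.
  have sx : 0 <= sin x by rewrite sin_ge0_pi// x0/=; lra.
  rewrite -(ler_pXn2r (n := 2)) ?nnegrE ?sqrtr_ge0 ?mulr_ge0 ?(ltW k0)//.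
  rewrite sqr_sqrtr ?(ltW (sq_gt0 x))// !exprMn.
  have := cos2Dsin2 x => h; have -> : sin x ^+ 2 = 1 - cos x ^+ 2 by rewrite -h; ring.
  have : k ^+ 2 <= 1 by rewrite exprn_ile1// ltW.
  lra.
by rewrite itg_cos_odd eqxx mul1r.
Qed.

(** On [0, b], z = cos x / cos b exceeds 1 by at most b^2, so z + sqrt(z^2 - 1) <= 1 + 3b <=
    exp(3b). The degree is below 2m and 2m 3b = 3s, which makes the bound independent of m. *)
Lemma P_inner_bound i x : (i < m)%N -> 0 <= x <= b -> P i x ^+ 2 <= expR (6 * s).
Proof.
move=> im /andP[x0 xb]; have p0 := pi_gt0 R; have hb := bpi; have hb0 := b0.
pose z := cos x / k.
have z1 : 1 <= z.
  rewrite ler_pdivlMr// mul1r.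
  have hi y : 0 <= y -> y <= b -> y \in `[0, pi]%R.
    by move=> y0 yb; rewrite in_itv/= y0; lra.
  by rewrite leNgt ltr_cos ?hi// ?(ltW b0)// -leNgt.
have zk : z <= 1 + b ^+ 2.
  rewrite ler_pdivrMr//; apply: (@le_trans _ _ 1); first exact: cos_le1.
  have h := cos_ge_sqr b.
  apply: (@le_trans _ _ ((1 + b ^+ 2) * (1 - b ^+ 2 / 2))).
    have b2 : b ^+ 2 <= 1 by rewrite exprn_ile1// ltW.
    have b2' := sqr_ge0 b.
    rewrite -subr_ge0 (_ : _ - 1 = b ^+ 2 / 2 * (1 - b ^+ 2)); last by field.
    by rewrite mulr_ge0 ?divr_ge0// subr_ge0.
  by rewrite ler_wpM2l// addr_ge0 ?sqr_ge0.
have bb0 : 0 <= 2 * b by apply: mulr_ge0 => //; exact: ltW.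
have sq : Num.sqrt (z ^+ 2 - 1) <= 2 * b.
  rewrite -(ler_pXn2r (n := 2)) ?nnegrE ?sqrtr_ge0//.
  rewrite sqr_sqrtr; last by rewrite subr_ge0 exprn_ege1.
  have : z ^+ 2 <= (1 + b ^+ 2) ^+ 2 by rewrite lerXn2r// nnegrE ?addr_ge0 ?sqr_ge0//; lra.
  have b2 : b ^+ 2 <= 1 by rewrite exprn_ile1// ltW.
  have b4 : b ^+ 2 * b ^+ 2 <= b ^+ 2 by rewrite ler_piMr ?sqr_ge0.
  rewrite exprMn; have -> : (1 + b ^+ 2) ^+ 2 = 1 + 2 * b ^+ 2 + b ^+ 2 * b ^+ 2 by ring.
  lra.
have zr : z + Num.sqrt (z ^+ 2 - 1) <= expR (3 * b).
  have b2 : b ^+ 2 <= b by rewrite expr2 ler_piMr// ltW.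
  apply: le_trans (expR_ge1Dx _).
  rewrite (_ : 1 + 3 * b = (1 + b) + 2 * b); last by ring.
  by apply: (lerD _ sq); apply: le_trans zk _; rewrite lerD2l.
have /andP[c0 c1] := cheb_odd_bound i z1 zr.
have c2 : expR (3 * b) ^+ (2 * i + 1) <= expR (3 * s).
  rewrite -expRM_natl ler_expR.
  have -> : 3 * s = (2 * m)%:R * (3 * b).
    by rewrite /b /w natrM; field; rewrite pnatr_eq0 -lt0n.
  apply: ler_wpM2r; first by apply: mulr_ge0 => //; exact: ltW.
  by rewrite ler_nat addn1 ltn_pmul2l.
have -> : expR (6 * s) = expR (3 * s) ^+ 2 by rewrite -expRM_natl; congr expR; ring.
by rewrite lerXn2r// ?nnegrE ?expR_ge0// (le_trans c1).
Qed.

(** What remains is the integral over [b, pi/2], at most pi/4, plus b^2 times the one over [0, b],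
    at most b exp(6s); finally 4/pi <= 2. *)
Lemma test_fun_defect i : (i < m)%N ->
  ip (test_fun i) (test_fun i) - sinc_form s (test_fun i) (test_fun i) <=
  2 * w * (1 + 2 * b ^+ 3 * expR (6 * s)).
Proof.
move=> im; have p0 := pi_gt0 R; have hb := bpi; have hb0 := b0.
have lP2 := lbm_continuous (continuous_P2 im).
have h1 := ip_test_fun_itg im; have h2 := sinc_form_test_fun_ge im.
have h3 := itg_P_outer im.
have h4 : itg 0 b (fun x => P i x ^+ 2) <= expR (6 * s) * (b - 0).
  rewrite -itg_cst ?(ltW b0)//; apply: le_itg => //; first exact: lbm_cst.
  by move=> x; exact: P_inner_bound.
rewrite (itg_split lP2 (ltW b0) (ltW hb)) in h1.
set X := itg 0 b _ in h1 h2 h4; set Y := itg b _ _ in h1 h3.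
have E8 : 0 <= 8 * w / pi by rewrite divr_ge0 ?mulr_ge0 ?(ltW w0) ?(ltW p0).
apply: (@le_trans _ _ (8 * w / pi * (Y + b ^+ 2 * X))).
  rewrite h1 -subr_ge0; move: h2; rewrite -subr_ge0; set S := sinc_form _ _ _.
  by congr (0 <= _); ring.
apply: (@le_trans _ _ (8 * w / pi * (pi / 4 + b ^+ 2 * (expR (6 * s) * b)))).
  rewrite ler_wpM2l// lerD// ler_wpM2l ?sqr_ge0//; rewrite subr0 in h4; exact: h4.
have -> : 8 * w / pi * (pi / 4 + b ^+ 2 * (expR (6 * s) * b)) =
    2 * w * (1 + 4 / pi * (b ^+ 3 * expR (6 * s))).
  by move: (expR _) (pi : R) p0 => E p p0; field; rewrite gt_eqF.
rewrite ler_wpM2l ?mulr_ge0 ?(ltW w0)// lerD2l -(mulrA 2) ler_wpM2r//.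
  by rewrite mulr_ge0 ?expR_ge0// exprn_ge0// ltW.
by rewrite ler_pdivrMr//; have := pi_ge2 R; lra.
Qed.

Lemma prod_odd_exp (x : R) n : \prod_(i < n) x ^+ (2 * i + 1) = x ^+ (n ^ 2).
Proof.
elim: n => [|n IH]; first by rewrite big_ord0 expr0.
rewrite big_ord_recr /= IH -exprD; congr (_ ^+ _).
by rewrite -[n.+1]addn1 sqrnD exp1n muln1 -addnA (addnC 1%N).
Qed.

(** The Gram matrix is 2w U U^T with U lower triangular of diagonal k^-(2i+1), and 1 + 3 + ... + (2m
    - 1) = m^2. The factor (2w)^m cancels between the two sides. *)
Lemma prod_eigen_le e psi : spectral_list s m e psi ->
  \prod_(n < m) (1 - e n) <= (cos b ^+ 2) ^+ (m ^ 2) * (1 + 2 * b ^+ 3 * expR (6 * s)) ^+ m.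
Proof.
move=> sl.
have := det_gram_le s0 sl (fun i : 'I_m => lbm_test_fun i).
pose U : 'M[R]_m := \matrix_(i, j) cheb_coef k i j.
have -> : (\matrix_(i, j) ip (test_fun i) (test_fun j) : 'M[R]_m) = (2 * w) *: (U *m U^T).
  apply/matrixP => i j; rewrite !mxE ip_test_fun; congr (_ * _).
  by apply: eq_bigr => q _; rewrite !mxE.
have dU : \det U = k^-1 ^+ (m ^ 2).
  rewrite det_trig; last first.
    by apply/is_trig_mxP => i j ij; rewrite mxE cheb_coef_gt.
  by rewrite -prod_odd_exp; apply: eq_bigr => i _; rewrite mxE cheb_coef_lead.
rewrite detZ det_mulmx det_tr dU => H.
have H2 : \prod_(i < m) (ip (test_fun i) (test_fun i) - sinc_form s (test_fun i) (test_fun i))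
    <= (2 * w) ^+ m * (1 + 2 * b ^+ 3 * expR (6 * s)) ^+ m.
  rewrite -exprMn -[X in _ ^+ X](card_ord m) -prodr_const; apply: ler_prod => i _.
  rewrite test_fun_defect// andbT subr_ge0; apply: sinc_form_le; [exact: ltW|exact: lbm_test_fun].
have {H H2} := le_trans H H2.
have ww : 0 < (2 * w) ^+ m by rewrite exprn_gt0// mulr_gt0.
rewrite mulrCA ler_pM2l// -/k.
have kM : 0 < k ^+ (m ^ 2) by rewrite exprn_gt0.
rewrite exprVn -invfM ler_pdivrMr; last exact: mulr_gt0.
by move=> h; apply: le_trans h _; rewrite [k ^+ 2]expr2 [(k * k) ^+ _]exprMn [leLHS]mulrC lexx.
Qed.

End TestSpace.

(** * Numerical bounds for pi, ln(27/5) and alpha *)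

Section NumericalBounds.
Variable R : realType.
Implicit Types (x y : R).

Definition tmono (n : nat) x : R := x ^+ n / n`!%:R.

Lemma tmono0 x : tmono 0 x = 1. Proof. by rewrite /tmono expr0 fact0 divr1. Qed.

Lemma tmonoS0 n : tmono n.+1 0 = 0 :> R.
Proof. by rewrite /tmono expr0n mul0r. Qed.

Lemma tmonoS n x : tmono n.+1 x = tmono n x * (x / n.+1%:R).
Proof. by rewrite /tmono exprSr factS natrM invfM [_^-1 * _^-1]mulrC mulrACA. Qed.

Lemma tmono_ge0 n x : 0 <= x -> 0 <= tmono n x.
Proof. by move=> x0; rewrite divr_ge0 ?exprn_ge0. Qed.

Lemma has_deriv_exprn n : has_deriv (fun x : R => x ^+ n) (fun x => n%:R * x ^+ n.-1).
Proof.
elim: n => [|n IH]; first by move=> x; rewrite mul0r; exact: has_deriv_cst.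
move=> x; rewrite (_ : (fun x => x ^+ n.+1) = fun x => x * x ^+ n); last first.
  by apply/funext => y; rewrite exprS.
apply: is_derive_eq (has_derivM (@has_deriv_id R) IH x) _.
case: n IH => [|n] _ /=; first by rewrite !mul0r mulr0 addr0 expr0.
by rewrite -[n.+2]addn1 natrD exprS; ring.
Qed.

Lemma has_deriv_tmono n : has_deriv (tmono n.+1) (tmono n).
Proof.
move=> x; rewrite (_ : tmono n.+1 = fun x => (n.+1)`!%:R^-1 * x ^+ n.+1); last first.
  by apply/funext => y; rewrite /tmono mulrC.
apply: is_derive_eq (has_derivZ _ (has_deriv_exprn n.+1) x) _.
by rewrite /tmono factS natrM /= invfM [_^-1 * _^-1]mulrC mulrA divfK ?pnatr_eq0// mulrC.
Qed.

Lemma le_from0 (f g df dg : R -> R) x : has_deriv f df -> has_deriv g dg -> f 0 = g 0 ->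
  0 <= x -> (forall y, 0 <= y -> df y <= dg y) -> f x <= g x.
Proof.
move=> hf hg E x0 H; have := has_deriv_le hf hg x0 (fun y hy => H y (proj1 (andP hy))).
by rewrite E; lra.
Qed.

Lemma has_deriv_sin1 : has_deriv (@sin R) (@cos R). Proof. exact: is_derive_sin. Qed.
Lemma has_deriv_cos1 : has_deriv (@cos R) (fun x => - sin x). Proof. exact: is_derive_cos. Qed.

Let T := tmono.

(** Starting from cos <= 1, each Taylor inequality for sine or cosine results from integrating the
    previous one from 0. *)
Lemma sin_le_taylor5 x : 0 <= x -> sin x <= T 1 x - T 3 x + T 5 x.
Proof.
have d n := has_deriv_tmono n.
have s1 y : 0 <= y -> sin y <= T 1 y.
  move=> y0; apply: (le_from0 has_deriv_sin1 (d 0%N) _ y0); first by rewrite sin0 tmonoS0.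
  by move=> z _; rewrite tmono0 cos_le1.
have c2 y : 0 <= y -> 1 - T 2 y <= cos y.
  move=> y0; apply: (le_from0 (has_derivB (has_deriv_cst 1) (d 1%N)) has_deriv_cos1 _ y0 _) => //.
    by rewrite cos0 tmonoS0 subr0.
  by move=> z /s1 h; rewrite sub0r lerN2.
have s3 y : 0 <= y -> T 1 y - T 3 y <= sin y.
  move=> y0; apply: (le_from0 (has_derivB (d 0%N) (d 2%N)) has_deriv_sin1 _ y0 _).
    by rewrite sin0 !tmonoS0 subr0.
  by move=> z /c2; rewrite tmono0.
have c4 y : 0 <= y -> cos y <= 1 - T 2 y + T 4 y.
  move=> y0; have hd := has_derivD (has_derivB (has_deriv_cst 1) (d 1%N)) (d 3%N).
  apply: (le_from0 has_deriv_cos1 hd _ y0 _) => //.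
    by rewrite cos0 !tmonoS0 subr0 addr0.
  by move=> z /s3; rewrite /T; lra.
move=> x0; apply: (le_from0 has_deriv_sin1 (has_derivD (has_derivB (d 0%N) (d 2%N)) (d 4%N)) _ x0 _).
  by rewrite sin0 !tmonoS0 subr0 addr0.
by move=> z /c4; rewrite tmono0.
Qed.

Lemma sin_ge_taylor7 x : 0 <= x -> T 1 x - T 3 x + T 5 x - T 7 x <= sin x.
Proof.
have d n := has_deriv_tmono n.
have c6 y : 0 <= y -> 1 - T 2 y + T 4 y - T 6 y <= cos y.
  move=> y0; have hd := has_derivB (has_derivD (has_derivB (has_deriv_cst 1) (d 1%N)) (d 3%N)) (d 5%N).
  apply: (le_from0 hd has_deriv_cos1 _ y0 _) => //.
    by rewrite cos0 !tmonoS0 !subr0 addr0.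
  by move=> z /sin_le_taylor5; rewrite /T; lra.
move=> x0; have hd := has_derivB (has_derivD (has_derivB (d 0%N) (d 2%N)) (d 4%N)) (d 6%N).
apply: (le_from0 hd has_deriv_sin1 _ x0 _).
  by rewrite sin0 !tmonoS0 !subr0 addr0.
by move=> z /c6; rewrite tmono0.
Qed.

(** The equation sin(3y) = 1 at y = pi/6 reads (sin y + 1)(2 sin y - 1)^2 = 0. *)
Lemma sin_pi6 : sin (pi / 6) = 2^-1 :> R.
Proof.
have p0 := pi_gt0 R.
set y := pi / 6.
have y0 : 0 <= sin y by rewrite sin_ge0_pi// /y; apply/andP; split; lra.
have : sin (y + y + y) = 1 by rewrite (_ : y + y + y = pi / 2) ?sin_pihalf// /y; lra.
rewrite !sinD cosD => H.
have h := cos2Dsin2 y.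
have E : (sin y + 1) * (2 * sin y - 1) ^+ 2 = 0.
  have -> : (sin y + 1) * (2 * sin y - 1) ^+ 2 =
      1 - ((sin y * cos y + cos y * sin y) * cos y + (cos y * cos y - sin y * sin y) * sin y)
      + 3 * sin y * (cos y ^+ 2 + sin y ^+ 2 - 1) by ring.
  by rewrite H h !subrr mulr0 addr0.
have : sin y + 1 != 0 by rewrite gt_eqF// ltr_wpDl.
move: E => /eqP; rewrite mulf_eq0 => /orP[->//|]; rewrite sqrf_eq0 subr_eq0 => /eqP E _.
by apply: (@mulfI _ 2); rewrite // E divff.
Qed.

(** The bounds are 3.14 and 3.1425; their sixths 157/300 and 419/800 are compared with pi/6 through
    the sine, by Taylor polynomials. *)
Lemma pi_bounds : 157 / 50 <= (pi : R) <= 1257 / 400.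
Proof.
have p0 := pi_gt0 R; have p2 := pi_ge2 R.
have p4 : pi / 2 < 2 :> R by exact: pihalf_lt2.
have s6 := sin_pi6.
have inI x : 0 <= x -> x <= 1 -> x \in `[- (pi / 2), pi / 2]%R.
  by move=> x0 x1; rewrite in_itv/=; apply/andP; split; lra.
apply/andP; split; rewrite leNgt; apply/negP => H.
  have : sin (pi / 6) < sin (157 / 300 : R) by rewrite ltr_sin; [lra | apply: inI; lra..].
  have := @sin_le_taylor5 (157 / 300) _.
  rewrite s6 /T !tmonoS tmono0; lra.
have : sin (419 / 800 : R) < sin (pi / 6) by rewrite ltr_sin; [lra | apply: inI; lra..].
have := @sin_ge_taylor7 (419 / 800) _.
by rewrite s6 /T !tmonoS tmono0; lra.
Qed.

Fixpoint exp_taylor (n : nat) x : R :=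
  if n is k.+1 then exp_taylor k x + tmono k.+1 x else 1.

Lemma has_deriv_exp_taylor n : has_deriv (exp_taylor n.+1) (exp_taylor n).
Proof.
elim: n => [|n IH]; last exact: has_derivD IH (has_deriv_tmono n.+1).
have := has_derivD (has_deriv_cst (1 : R)) (has_deriv_tmono 0).
by rewrite (_ : (fun x : R => 0 + tmono 0 x) = exp_taylor 0)//; apply/funext => x; rewrite tmono0 add0r.
Qed.

Lemma exp_taylor0 n : exp_taylor n 0 = 1.
Proof. by elim: n => //= n ->; rewrite tmonoS0 addr0. Qed.

Lemma exp_taylor_le n x : 0 <= x -> exp_taylor n x <= expR x.
Proof.
elim: n x => [|n IH] x x0; first by rewrite /= -[leLHS]expR0 ler_expR.
apply: (le_from0 (has_deriv_exp_taylor n) (@is_derive_expR R) _ x0 IH).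
by rewrite exp_taylor0 expR0.
Qed.

(** The remainder contains exp(x) itself, so no prior bound on it is required; in use, the
    inequality is linear in exp(x) and solved for it. *)
Lemma exp_taylor_ge n x : 0 <= x -> expR x <= exp_taylor n x + tmono n.+1 x * expR x.
Proof.
have hT k : has_deriv (fun x => tmono k.+1 x * expR x) (fun x => tmono k x * expR x + tmono k.+1 x * expR x).
  exact: has_derivM (has_deriv_tmono k) (@is_derive_expR R).
have pT k y : 0 <= y -> 0 <= tmono k y * expR y.
  by move=> y0; rewrite mulr_ge0 ?expR_ge0// tmono_ge0.
elim: n x => [|n IH] x x0.
  apply: (le_from0 (@is_derive_expR R) (has_derivD (has_deriv_cst 1) (hT 0%N)) _ x0).
    by rewrite expR0 tmonoS0 mul0r addr0.
  by move=> y y0; rewrite tmono0 mul1r add0r lerDl pT.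
apply: (le_from0 (@is_derive_expR R) (has_derivD (has_deriv_exp_taylor n) (hT n.+1)) _ x0).
  by rewrite expR0 exp_taylor0 tmonoS0 mul0r addr0.
by move=> y y0; apply: le_trans (IH _ y0) _; rewrite addrA lerDl pT.
Qed.

Lemma ln_bounds : 59 / 35 <= ln (27 / 5 : R) <= 27 / 16.
Proof.
have p : (27 / 5 : R) \is Num.pos by rewrite posrE; lra.
apply/andP; split.
  rewrite -ler_expR (lnK p).
  have := @exp_taylor_ge 8 (59 / 35) _.
  rewrite /= !tmonoS tmono0; move: (expR _) => E; lra.
rewrite -ler_expR (lnK p).
have := @exp_taylor_le 7 (27 / 16) _.
by rewrite /= !tmonoS tmono0; move: (expR _) => E; lra.
Qed.

(** Since log(2 e gamma) = 1 + ln(27/5), alpha becomes a product that increases with pi and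
    decreases with ln(27/5); it is near 0.3746. *)
Lemma alphaE : alpha R = pi ^+ 2 * (78 / 10 - 2 * ln (27 / 5)) * (100 / 11664).
Proof.
rewrite /alpha /Defs.gamma.
have -> : 2 * expR 1 * (27 / 10) = expR 1 * (27 / 5) :> R by field.
rewrite lnM ?posrE ?expR_gt0 ?divr_gt0//.
by rewrite expRK; move: (pi : R) (ln _) => p L; field.
Qed.

Lemma alpha_bounds : 374 / 1000 <= alpha R < 375 / 1000.
Proof.
have /andP[p1 p2] := pi_bounds; have /andP[l1 l2] := ln_bounds.
rewrite alphaE; move: (pi : R) (ln _) p1 p2 l1 l2 => p L p1 p2 l1 l2.
have q1 : 9859 / 1000 <= p ^+ 2.
  have : 0 <= (p - 157 / 50) * (p + 157 / 50) by apply: mulr_ge0; lra.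
  lra.
have q2 : p ^+ 2 <= 2469 / 250.
  have : 0 <= (1257 / 400 - p) * (p + 1257 / 400) by apply: mulr_ge0; lra.
  lra.
move: (p ^+ 2) q1 q2 => P q1 q2; apply/andP; split.
  have : 0 <= (P - 9859 / 1000) * (78 / 10 - 2 * L) by apply: mulr_ge0; lra.
  lra.
have : 0 <= (2469 / 250 - P) * (78 / 10 - 2 * L) by apply: mulr_ge0; lra.
lra.
Qed.

End NumericalBounds.

(** * The Gaussian bound on the determinant *)

Section GapProbability.
Variable R : realType.
Implicit Types (s c : R).

Lemma fredholm_det_le_cos s (m : nat) : 0 < s -> (0 < m)%N -> m%:R^-1 / 2 * s <= 1 ->
  fredholm_det s <= (cos (m%:R^-1 / 2 * s) ^+ 2) ^+ (m ^ 2) *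
    (1 + 2 * (m%:R^-1 / 2 * s) ^+ 3 * expR (6 * s)) ^+ m.
Proof.
move=> s0 m0 b1; have [e [psi sl]] := spectral_list_exists s0 m.
apply: le_trans (fredholm_det_le s0 m) _.
apply: le_trans (prod_eigen_le s0 m0 b1 sl); apply: ler_prod => i _.
have /andP[l0 l1] := sinc_eigenvalue01 s0 i.
rewrite subr_ge0 l1 /= lerD2l lerN2; exact: (sinc_eigenvalue_ge s0 sl).
Qed.

(** Both factors are bounded by exponentials via 1 + x <= exp(x), with cos^2 b <= 1 - b^2 (1 - b^2).
    The relation m b = s/2 turns m^2 b^2 into s^2/4 and 2 m b^3 into s b^2. *)
Lemma fredholm_det_le_expR s (m : nat) : 0 < s -> (0 < m)%N -> m%:R^-1 / 2 * s <= 1 ->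
  fredholm_det s <= expR (- (s ^+ 2 / 4) +
    (m%:R^-1 / 2 * s) ^+ 2 * (s ^+ 2 / 4 + s * expR (6 * s))).
Proof.
move=> s0 m0 b1; apply: le_trans (fredholm_det_le_cos s0 m0 b1) _.
set b := m%:R^-1 / 2 * s in b1 *.
have b0 : 0 <= b by rewrite !mulr_ge0 ?invr_ge0// ltW.
have mb : m%:R * b = s / 2 by rewrite /b; field; rewrite pnatr_eq0 -lt0n.
clearbody b.
have E0 := expR_gt0 (6 * s); set E := expR (6 * s) in E0 *; clearbody E.
have c1 : cos b ^+ 2 <= expR (- (b ^+ 2 * (1 - b ^+ 2))).
  apply: le_trans (expR_ge1Dx _).
  have := sin_sqr_ge (introT andP (conj b0 b1)); have := cos2Dsin2 b; lra.
have c2 : (cos b ^+ 2) ^+ (m ^ 2) <= expR ((m ^ 2)%:R * - (b ^+ 2 * (1 - b ^+ 2))).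
  by rewrite expRM_natl lerXn2r// nnegrE ?sqr_ge0 ?expR_ge0.
have x0 : 0 <= 2 * b ^+ 3 * E by rewrite mulr_ge0 ?(ltW E0)// mulr_ge0// exprn_ge0.
have c3 : (1 + 2 * b ^+ 3 * E) ^+ m <= expR (m%:R * (2 * b ^+ 3 * E)).
  by rewrite expRM_natl lerXn2r ?nnegrE ?expR_ge0 ?expR_ge1Dx// addr_ge0.
have -> : - (s ^+ 2 / 4) + b ^+ 2 * (s ^+ 2 / 4 + s * E) =
    (m ^ 2)%:R * - (b ^+ 2 * (1 - b ^+ 2)) + m%:R * (2 * b ^+ 3 * E).
  have -> : s = 2 * (m%:R * b) by rewrite mb; field.
  by rewrite natrX; field.
by rewrite expRD ler_pM// exprn_ge0// ?sqr_ge0// addr_ge0.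
Qed.

(** The error b^2 D is at most b D, with D independent of m. The two summands of [x] make m large
    enough for b <= 1 and for b D <= d, the available margin. *)
Lemma fredholm_det_lt_gaussian s (a : R) : 0 < s -> a < s ^+ 2 / 4 -> fredholm_det s <= expR (- a).
Proof.
move=> s0 ha.
pose D := s ^+ 2 / 4 + s * expR (6 * s); pose d := s ^+ 2 / 4 - a.
have D0 : 0 <= D by rewrite addr_ge0 ?divr_ge0 ?sqr_ge0// mulr_ge0 ?expR_ge0// ltW.
have d0 : 0 < d by rewrite subr_gt0.
pose x := s / 2 + s / 2 * (D / d).
have x1 : 0 <= s / 2 by rewrite divr_ge0// ltW.
have x2 : 0 <= s / 2 * (D / d) by rewrite mulr_ge0// divr_ge0// ltW.
pose m := (Num.truncn x).+1.
have xm : x < m%:R by rewrite truncnS_gt.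
have m0 : 0 < m%:R :> R by rewrite ltr0n.
have bE : m%:R^-1 / 2 * s = s / 2 / m%:R by rewrite mulrC mulrA mulrAC.
have b1 : m%:R^-1 / 2 * s <= 1.
  by rewrite bE ler_pdivrMr// mul1r; apply: le_trans (ltW xm); rewrite /x lerDl.
have bD : m%:R^-1 / 2 * s * D <= d.
  rewrite bE mulrAC ler_pdivrMr// -ler_pdivrMl//.
  apply: le_trans (ltW xm); rewrite /x (_ : d^-1 * (s / 2 * D) = s / 2 * (D / d)); first by rewrite lerDr.
  by rewrite [LHS]mulrC mulrA.
apply: le_trans (fredholm_det_le_expR s0 _ b1) _ => //.
rewrite ler_expR -/D.
have b0 : 0 <= m%:R^-1 / 2 * s by rewrite bE divr_ge0// ltW.
set b := m%:R^-1 / 2 * s in b0 b1 bD *.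
have : b ^+ 2 * D <= b * D by rewrite ler_wpM2r// expr2 ler_piMr.
move: bD; rewrite /d; lra.
Qed.

End GapProbability.

(* alpha ~ 0.374 is the truncation to three decimals. *)
Theorem proposition5p3 (R : realType) :
  (374 / 1000 <= alpha R < 375 / 1000) /\
  (forall c : R, 5 <= c -> E2_0 c <= expR (- (alpha R * c ^+ 2))).
Proof.
split; first exact: alpha_bounds.
move=> c c5; have /andP[_ a1] := alpha_bounds R; have /andP[p1 _] := pi_bounds R.
have c2 : 0 < c ^+ 2 by rewrite exprn_gt0//; lra.
apply: fredholm_det_lt_gaussian; first by rewrite mulr_gt0//; lra.
(* For s = pi c / 2, s^2/4 is (pi/4)^2 c^2, and (3.14/4)^2 > 0.616 is well above alpha. *)
rewrite exprMn; have -> : (pi / 2) ^+ 2 * c ^+ 2 / 4 = (pi / 4) ^+ 2 * c ^+ 2 :> R.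
  by move: (pi : R) => p; field.
rewrite ltr_pM2r//; apply: lt_trans a1 _; rewrite expr2.
have : 0 <= (pi / 4 - 157 / 200) * (pi / 4 + 157 / 200) :> R by apply: mulr_ge0; lra.
lra.
Qed.
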